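(* Let $n\ge 3$ and let $M$ be a closed connected $n$-dimensional spin manifold with a fixed spin structure. For $r=n-1,n$ and $s=(g,\psi)\in\mathcal S_1$ let $$T_r(X_0,\dots,X_r)=\langle\nabla^g_{X_0}\psi,X_1\cdot\ldots\cdot X_r\cdot\psi\rangle_g,\qquad \mathcal E_r(s)=\frac12\int_M|T_r|_g^2\,\mathrm{vol}^g .$$ Then the critical points of the energy functional $\mathcal E_n+\mathcal E_{n-1}$ on $\mathcal S_1$ are $g$-parallel unit spinor fields; that is, if $(g,\psi)\in\mathcal S_1$ is a critical point, then $\nabla^g\psi=0$.
   Context: Setting. $M$ carries a spin structure $\widetilde{\mathcal P}\to\mathcal P$: a principal $\widetilde{\mathrm{GL}}^+$-bundle double-covering the bundle $\mathcal P$ of oriented frames, where $\widetilde{\mathrm{GL}}^+$ is the universal cover of $\mathrm{GL}^+(n,\mathbb R)$. $\Delta_n$ is a real irreducible module of the real Clifford algebra $\mathrm{Cl}_n$ (convention $x\cdot x=-|x|^2$), with a $\mathrm{Spin}(n)$-invariant scalar product for which Clifford multiplication by vectors is skew-symmetric. For a Riemannian metric $g$, $\widetilde{\mathcal P}^g\subset\widetilde{\mathcal P}$ is the induced $\mathrm{Spin}(n)$-reduction and $\Sigma^g=\widetilde{\mathcal P}^g\times_{\mathrm{Spin}(n)}\Delta_n$ is the real spinor bundle, with fibre metric $\langle\cdot,\cdot\rangle_g$ and spin Levi-Civita connection $\nabla^g$. The universal spinor bundle is $\Sigma=\widetilde{\mathcal P}\times_{\mathrm{Spin}(n)}\Delta_n$;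 its smooth sections over $M$ are pairs $s=(g,\psi)$ with $g$ a Riemannian metric on $M$ and $\psi\in\Gamma(M,\Sigma^g)$. $\mathcal S_1$ is the Fréchet manifold of such pairs with $|\psi|_g\equiv1$. The norm $|T_r|_g$ is the one induced by $g$ on $(r+1,0)$-tensors, and $\mathrm{vol}^g$ is the metric volume form. A critical point of a functional on $\mathcal S_1$ is a point $s$ where its differential vanishes on all of $T_s\mathcal S_1$ (both $g$ and $\psi$ vary, with $|\psi|_g\equiv 1$). *)

(* Defs.v *)
From HB Require Import structures.
From mathcomp Require Import all_boot all_order all_algebra.
From mathcomp Require Import all_classical all_reals all_analysis.

Set Implicit Arguments.
Unset Strict Implicit.
Unset Printing Implicit Defensive.

Import Order.TTheory GRing.Theory Num.Theory.
Import numFieldNormedType.Exports.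

Local Open Scope classical_set_scope.
Local Open Scope ring_scope.

Fixpoint Ck (R : realType) (U V : normedModType R) (k : nat) (A : set U)
    (f : U -> V) : Prop :=
  match k with
  | 0 => forall x, A x -> {for x, continuous f}
  | k'.+1 => (forall x, A x -> {for x, continuous f}) /\
      forall v : U, (forall x, A x -> derivable f x v) /\
                    Ck k' A (fun x => 'D_v f x)
  end.

Definition smooth (R : realType) (U V : normedModType R) (A : set U)
  (f : U -> V) : Prop := forall k, Ck k A f.

(** Column [j] of [Jacobian f y] is the partial derivative of [f] along the
    [j]-th coordinate (the library's [jacobian] acts on row vectors). *)
Definition Jacobian (R : realType) (n : nat) (f : 'cV[R]_n -> 'cV[R]_n)
    (y : 'cV[R]_n) : 'M[R]_n :=
  \matrix_(i, j) ('D_(delta_mx j 0) f y) i 0.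

(** Lebesgue integral over R^n as an iterated integral; it is only applied to
    continuous functions with compact support. *)
Fixpoint iterated_integral (R : realType) (n : nat) :
    ('cV[R]_n -> R) -> R :=
  match n with
  | 0 => fun f => f 0
  | n'.+1 => fun f =>
      \int[lebesgue_measure]_(x in [set: R])
        iterated_integral (fun y : 'cV[R]_n' => f (col_mx (x%:M : 'M[R]_1) y))
  end.

(** [param i] is the inverse of the chart [coord i], which maps the open set
    [dom i] homeomorphically onto the open set [coord i @` dom i].
    An orientation is given by charts with orientation-preserving changes of
    coordinates. *)
Record oriented_atlas (R : realType) (n : nat) (M : topologicalType) := {
  chart :> Type;
  dom : chart -> set M;
  coord : chart -> M -> 'cV[R]_n;
  param : chart -> 'cV[R]_n -> M;
  dom_open : forall i, open (dom i);
  dom_cover : forall x, exists i, dom i x;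
  cod_open : forall i, open (coord i @` dom i);
  coordK : forall i x, dom i x -> param i (coord i x) = x;
  coord_continuous : forall i x, dom i x -> {for x, continuous (coord i)};
  param_continuous : forall i y, (coord i @` dom i) y ->
    {for y, continuous (param i)};
  change_smooth : forall i j,
    smooth (coord i @` (dom i `&` dom j)) (coord j \o param i);
  change_oriented : forall i j x, dom i x -> dom j x ->
    0 < \det (Jacobian (coord j \o param i) (coord i x))
}.

Section Manifold.
Context {R : realType} {n : nat} {M : topologicalType}.
Variable A : oriented_atlas R n M.

Definition cod (i : A) : set 'cV[R]_n := coord i @` dom i.

(** Components of a tangent vector at [x] transform from the chart [i] to the
    chart [j] by [change i j x]. *)
Definition change (i j : A) (x : M) : 'M[R]_n :=
  Jacobian (coord j \o param i) (coord i x).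

(** A field of bilinear forms on TM is given by its matrix at [x] in each
    chart around [x]. *)
Definition bilinear_field : Type := A -> M -> 'M[R]_n.

Definition riemannian_metric (g : bilinear_field) : Prop :=
  [/\ forall i x, dom i x -> (g i x)^T = g i x,
      forall i x (v : 'cV[R]_n), dom i x -> v != 0 ->
        0 < (v^T *m g i x *m v) 0 0,
      forall i j x, dom i x -> dom j x ->
        g i x = (change i j x)^T *m g j x *m change i j x &
      forall i, smooth (cod i) (g i \o param i)].

(** The matrix [(\sum_a v_a Gamma^k_ab)_(k, b)] of Christoffel symbols of [g]
    in the chart [i], contracted with [v]. *)
Definition christoffel (g : bilinear_field) (i : A) (x : M) (v : 'cV[R]_n) :
    'M[R]_n :=
  let d a : 'M[R]_n := 'D_(delta_mx a 0) (g i \o param i) (coord i x) in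
  invmx (g i x) *m
  \matrix_(l, b) (2^-1 * \sum_a v a 0 * (d a l b + d b l a - d l a b)).

Record partition_of_unity := {
  pu_size : nat;
  pu_chart : 'I_pu_size -> A;
  pu_fun : 'I_pu_size -> M -> R;
  pu_continuous : forall k, continuous (pu_fun k);
  pu_ge0 : forall k x, 0 <= pu_fun k x;
  pu_sum : forall x, \sum_k pu_fun k x = 1;
  pu_support : forall k,
    closure [set x | pu_fun k x != 0] `<=` dom (pu_chart k)
}.

(** The integral of [f] against the volume form of [g]. On a compact manifold
    a partition of unity exists and the value does not depend on it. *)
Definition vol_integral (chi : partition_of_unity) (g : bilinear_field)
    (f : M -> R) : R :=
  \sum_(k < pu_size chi) iterated_integral (fun y =>
    let i := pu_chart k in let x := param i y in
    \1_(cod i) y * (pu_fun k x * f x * Num.sqrt (\det (g i x)))).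

End Manifold.

HB.mixin Record isTopGroup G of Group G & Topological G := {
  mulg_continuous : continuous (fun p : G * G => (p.1 * p.2)%g);
  invg_continuous : continuous (fun a : G => (a^-1)%g)
}.

#[short(type="topGroupType")]
HB.structure Definition TopGroup :=
  {G of Group G & Topological G & isTopGroup G}.

Definition evenly_covered (T U : topologicalType) (p : T -> U) (V : set U) :=
  exists (I : Type) (s : I -> U -> T),
    [/\ forall k u, V u -> {for u, continuous (s k)},
        forall k u, V u -> p (s k u) = u,
        forall k, open (s k @` V) &
        forall q, V (p q) -> exists! k, s k (p q) = q].

Definition covering_onto (T U : topologicalType) (p : T -> U) (B : set U) :=
  [/\ continuous p, range p = B &
      forall u, B u -> exists V : set U,
        [/\ open V, V u, V `<=` B & evenly_covered p V]].

Definition path_connected_space (R : realType) (T : topologicalType) :=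
  forall a b : T, exists c : R -> T,
    [/\ {within `[0, 1], continuous c}, c 0 = a & c 1 = b].

Definition simply_connected_space (R : realType) (T : topologicalType) :=
  path_connected_space R T /\
  forall c : R -> T, {within `[0, 1], continuous c} -> c 0 = c 1 ->
  exists H : R * R -> T,
    [/\ {within `[0, 1] `*` `[0, 1], continuous H},
        forall t, t \in `[0, 1] -> H (0, t) = c t,
        forall t, t \in `[0, 1] -> H (1, t) = c 0 &
        forall s, s \in `[0, 1] -> H (s, 0) = c 0 /\ H (s, 1) = c 0].

Definition GLplus (R : realType) (n : nat) : set 'M[R]_n :=
  [set B | 0 < \det B].

Definition universal_cover_GLplus (R : realType) (n : nat) (G : topGroupType)
    (theta : G -> 'M[R]_n) :=
  [/\ forall a b, theta (a * b)%g = theta a *m theta b,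
      covering_onto theta (@GLplus R n) &
      simply_connected_space R G].

(** A principal bundle for the universal cover [theta : G -> GL^+(n, R)],
    together with an equivariant bundle map to the bundle of oriented frames:
    [frame i q] is the matrix whose columns are the components in the chart
    [i] of the vectors of the frame below [q]. *)
Record spin_structure (R : realType) (n : nat) (M : topologicalType)
    (A : oriented_atlas R n M) (G : topGroupType) (theta : G -> 'M[R]_n) := {
  total :> topologicalType;
  proj : total -> M;
  act : total -> G -> total;
  frame : A -> total -> 'M[R]_n;
  proj_continuous : continuous proj;
  act_continuous : continuous (fun p : total * G => act p.1 p.2);
  act1 : forall q, act q 1%g = q;
  actM : forall q a b, act q (a * b)%g = act (act q a) b;
  proj_act : forall q a, proj (act q a) = proj q;
  locally_trivial : forall x, exists (O : set M) (s : M -> total)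
      (h : total -> G),
    [/\ open O, O x,
        forall y, O y -> {for y, continuous s} /\ proj (s y) = y,
        forall q, O (proj q) ->
          {for q, continuous h} /\ act (s (proj q)) (h q) = q &
        forall y a, O y -> h (act (s y) a) = a];
  frame_oriented : forall i q, dom i (proj q) -> GLplus (frame i q);
  frame_change : forall i j q, dom i (proj q) -> dom j (proj q) ->
    frame j q = change i j (proj q) *m frame i q;
  frame_continuous : forall i q, dom i (proj q) ->
    {for q, continuous (frame i)};
  frame_act : forall i q a, dom i (proj q) ->
    frame i (act q a) = frame i q *m theta a
}.

Definition sqnorm (R : realType) (n : nat) (v : 'cV[R]_n) : R :=
  (v^T *m v) 0 0.

Definition is_clifford_algebra (R : realType) (n : nat) (Cl : algType R)
    (iota : {linear 'cV[R]_n -> Cl}) :=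
  (forall v, iota v * iota v = - (sqnorm v)%:A) /\
  forall (B : algType R) (f : {linear 'cV[R]_n -> B}),
    (forall v, f v * f v = - (sqnorm v)%:A) ->
    exists2 F : {lrmorphism Cl -> B}, F \o iota =1 f &
      forall F' : {lrmorphism Cl -> B}, F' \o iota =1 f -> F' =1 F.

Definition spin_group (R : realType) (n : nat) (Cl : algType R)
    (iota : {linear 'cV[R]_n -> Cl}) : set Cl :=
  [set x | exists s : seq 'cV[R]_n,
    [/\ ~~ odd (size s), forall v, v \in s -> sqnorm v = 1 &
        x = \prod_(v <- s) iota v]].

Definition orthogonal_mx (R : realType) (n : nat) : set 'M[R]_n :=
  [set B | B^T *m B = 1%:M].

(** [kappa] identifies the subgroup of the universal cover lying over
    SO(n) = O(n) :&: GL^+(n, R) with Spin(n), compatibly with the twisted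
    adjoint covering of SO(n). Continuity is with respect to the standard
    topology of the finite-dimensional space [Cl]; the inverse is then
    continuous by compactness. *)
Definition spin_identification (R : realType) (n : nat) (G : topGroupType)
    (theta : G -> 'M[R]_n) (Cl : algType R) (iota : {linear 'cV[R]_n -> Cl})
    (kappa : G -> Cl) :=
  let H := theta @^-1` @orthogonal_mx R n in
  [/\ set_bij H (spin_group iota) kappa,
      {in H &, forall a b, kappa (a * b)%g = kappa a * kappa b},
      {in H, forall a v, kappa a * iota v = iota (theta a *m v) * kappa a} &
      forall l : {linear Cl -> R^o}, {within H, continuous (l \o kappa)}].

Definition irreducible_module (R : realType) (N : nat) (Cl : algType R)
    (rho : {lrmorphism Cl -> 'M[R]_N.+1}) :=
  forall W : set 'cV[R]_N.+1, W 0 ->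
    (forall u v, W u -> W v -> W (u + v)) ->
    (forall (t : R) v, W v -> W (t *: v)) ->
    (forall a v, W v -> W (rho a *m v)) ->
    W = [set 0] \/ W = setT.

Definition inner (R : realType) (N : nat) (Q : 'M[R]_N) (u v : 'cV[R]_N) : R :=
  (u^T *m Q *m v) 0 0.

Definition spinor_product (R : realType) (n N : nat) (Cl : algType R)
    (iota : {linear 'cV[R]_n -> Cl}) (rho : {lrmorphism Cl -> 'M[R]_N.+1})
    (Q : 'M[R]_N.+1) :=
  [/\ forall u v, inner Q u v = inner Q v u,
      forall v, v != 0 -> 0 < inner Q v v,
      forall a u v, spin_group iota a ->
        inner Q (rho a *m u) (rho a *m v) = inner Q u v &
      forall x u v, inner Q (rho (iota x) *m u) v =
                    - inner Q u (rho (iota x) *m v)].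

Section Spinors.
Context {R : realType} {n : nat} {M : topologicalType}.
Context {A : oriented_atlas R n M} {G : topGroupType} {theta : G -> 'M[R]_n}.
Variable P : spin_structure A theta.

(** The Spin(n)-reduction induced by [g]: the lifts of [g]-orthonormal
    oriented frames. *)
Definition orthonormal_lift (g : bilinear_field A) : set P :=
  [set q | forall i, dom i (proj q) ->
    (frame i q)^T *m g i (proj q) *m frame i q = 1%:M].

(** Smooth maps from an open subset of R^m to the total space, whose smooth
    structure is the one making [(coord i \o proj, frame i)] a local
    diffeomorphism. *)
Definition smooth_plot (m : nat) (W : set 'cV[R]_m) (c : 'cV[R]_m -> P) :=
  [/\ open W, forall w, W w -> {for w, continuous c} &
      forall i : A, let W' := W `&` [set w | dom i (proj (c w))] in
        smooth W' (coord i \o @proj _ _ _ _ _ _ P \o c) /\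
        smooth W' (frame i \o c)].

Variables (Cl : algType R) (iota : {linear 'cV[R]_n -> Cl}) (kappa : G -> Cl).
Variables (N : nat) (rho : {lrmorphism Cl -> 'M[R]_N.+1}) (Q : 'M[R]_N.+1).

(** Spinors of [g] are classes [[q, v]] with [q] in [orthonormal_lift g] and
    [v] in the spinor module, modulo
    [[q a, v] = [q, rho (kappa a) v]]. A field of spinors is encoded by the
    equivariant function [psi] on [orthonormal_lift g] with
    [psi(proj q) = [q, psi q]]; its values elsewhere are irrelevant. *)
Definition spinor_field : Type := P -> 'cV[R]_N.+1.

(** A function on the submanifold [orthonormal_lift g] is smooth when its
    composites with smooth maps into this submanifold are smooth. *)
Definition spinor_section (g : bilinear_field A) (psi : spinor_field) :=
  (forall q a, orthonormal_lift g q -> orthogonal_mx (theta a) ->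
     psi (act q a) = rho (kappa a^-1%g) *m psi q) /\
  (forall m (W : set 'cV[R]_m) c, smooth_plot W c ->
     (forall w, W w -> orthonormal_lift g (c w)) -> smooth W (psi \o c)).

Definition unit_spinor (g : bilinear_field A) (psi : spinor_field) :=
  forall q, orthonormal_lift g q -> inner Q (psi q) (psi q) = 1.

Definition unit_pair (g : bilinear_field A) (psi : spinor_field) :=
  [/\ riemannian_metric g, spinor_section g psi & unit_spinor g psi].

(** [c] is a curve in [orthonormal_lift g] through [q] whose velocity at time
    0 is the horizontal lift, for the Levi-Civita connection of [g], of the
    tangent vector with components [X] in the frame below [q]: in a chart,
    [x' = E X] and the covariant derivative [E' + Gamma(x') E] of the frame
    [E] along the curve vanishes. *)
Definition horizontal_curve (g : bilinear_field A) (q : P) (X : 'cV[R]_n)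
    (c : R -> P) :=
  [/\ c 0 = q, {for 0, continuous c},
      \forall t \near (0 : R), orthonormal_lift g (c t) &
      forall i, dom i (proj q) ->
        is_derive (0 : R) (1 : R) (fun t => coord i (proj (c t)))
          (frame i q *m X) /\
        is_derive (0 : R) (1 : R) (fun t => frame i (c t))
          (- (christoffel g i (proj q) (frame i q *m X) *m frame i q))].

(** The spin Levi-Civita connection: the covariant derivative of
    [[q, psi q]] in the direction [X] (in components with respect to the
    frame below [q]) is [[q, w]], with [w] the derivative of [psi] along the
    horizontal lift of [X] at [q]. *)
Definition nabla (g : bilinear_field A) (psi : spinor_field) (q : P)
    (X : 'cV[R]_n) : 'cV[R]_N.+1 :=
  xget 0 [set w | exists2 c, horizontal_curve g q X c &
                   is_derive (0 : R) (1 : R) (psi \o c) w].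

(** [T_r(X_0, ..., X_r)] at [proj q], the vectors being given by their
    components in the frame below [q]. *)
Definition Ttensor (r : nat) (g : bilinear_field A) (psi : spinor_field)
    (q : P) (X : 'I_r.+1 -> 'cV[R]_n) : R :=
  inner Q (nabla g psi q (X ord0))
    (rho (\prod_(k < r) iota (X (lift ord0 k))) *m psi q).

(** The squared norm of the tensor at [x]: the sum of the squares of its
    components in any [g]-orthonormal frame. *)
Definition Tnorm2 (r : nat) (g : bilinear_field A) (psi : spinor_field)
    (x : M) : R :=
  xget 0 [set w | exists q, [/\ proj q = x, orthonormal_lift g q &
    w = \sum_(e : {ffun 'I_r.+1 -> 'I_n})
          (@Ttensor r g psi q (fun k => delta_mx (e k) 0)) ^+ 2]].

Variable chi : partition_of_unity A.

Definition energy (r : nat) (g : bilinear_field A) (psi : spinor_field) : R :=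
  2^-1 * vol_integral chi g (Tnorm2 r g psi).

(** Smooth curves in the Frechet manifold of pairs satisfying [unit_pair]:
    smoothness is joint in the time and space variables. *)
Definition smooth_curve (gt : R -> bilinear_field A)
    (psit : R -> spinor_field) :=
  [/\ forall t, unit_pair (gt t) (psit t),
      forall i, smooth [set p : R * 'cV[R]_n | cod i p.2]
                  (fun p => gt p.1 i (param i p.2)) &
      forall m (W : set 'cV[R]_m) (tau : 'cV[R]_m -> R) c,
        smooth W tau -> smooth_plot W c ->
        (forall w, W w -> orthonormal_lift (gt (tau w)) (c w)) ->
        smooth W (fun w => psit (tau w) (c w))].

(** The differential on the Frechet manifold of pairs satisfying [unit_pair]:
    every tangent vector is the velocity of a smooth curve, so it vanishes at
    a point when the derivatives along all smooth curves through this point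
    do. *)
Definition critical_point (F : bilinear_field A -> spinor_field -> R)
    (g : bilinear_field A) (psi : spinor_field) :=
  forall gt psit, smooth_curve gt psit -> gt 0 = g -> psit 0 = psi ->
    is_derive (0 : R) (1 : R) (fun t => F (gt t) (psit t)) 0.

End Spinors.

(* Main.v *)
From HB Require Import structures.
Require Import Defs.
From mathcomp Require Import all_boot all_order all_algebra.
From mathcomp Require Import all_classical all_reals all_analysis.
From mathcomp Require Import ring lra zify.
                                                                             
                         
Require Import Defs.

Import Order.TTheory GRing.Theory Num.Theory.
Import numFieldNormedType.Exports.

Local Open Scope classical_set_scope.
Local Open Scope ring_scope.

                                                                               
                                                                             
                                                                             
                                                                  
                                                                            
                                                                            
                                                                            
                                                                              
                                                                         
                                                       

                                                                               
                                                                               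
                                                                

(** A single deformation of [(g, psi)] suffices: the homothety g_t = e^(2t) g, with the spinor
    carried along. A constant rescaling leaves the Levi-Civita connection unchanged. In orthonormal
    frames only the differentiation slot X_0 of T_r acquires a factor e^(-t), because Clifford
    multiplication is expressed through components in the frame. Hence |T_r|^2 scales by e^(-2t),
    the volume form by e^(nt), and every E_r by the same factor e^((n-2)t). At a critical point
    (n-2)(E_n + E_(n-1)) = 0. Since n > 2 and both energies are nonnegative, both vanish, and then
    T_n and T_(n-1) vanish identically because the norms are continuous.

    The rest is pointwise algebra. The vector nabla_X psi is orthogonal to w psi for every product w
    of n or n-1 basis vectors. Inserting e_i e_i = -1 lengthens a short product by two, and a
    product of more than n basis vectors repeats one of them and can be shortened by two. So nabla_X
    psi is orthogonal to the whole orbit Cl psi ([clifford_vanish]), which is the full module by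
    irreducibility and |psi| = 1; it is therefore zero ([nabla_eq0]).

    Most of the work justifies the calculus behind this. The dilations lift to a continuous central
    one-parameter subgroup of the universal cover ([dilation_lift]), and right translation by it
    gives a smooth curve of unit pairs ([dilate_smooth_curve]). The derivative [nabla], defined by a
    choice over horizontal curves, becomes an ordinary directional derivative in local coordinates
    ([nabla_plot]) and behaves well under right translation ([nabla_act]). The tensor norm is
    independent of the frame and continuous ([Tnorm2E], [Tnorm2_continuous]). The chartwise integral
    is positive and scales correctly ([vol_integral_eq0], [vol_integralZ]). *)

Set Implicit Arguments.
Unset Strict Implicit.
Unset Printing Implicit Defensive.

                                       

(** * Continuity and derivatives of matrix-valued maps *)

Section MatrixCalculus.
Context {R : realType}.

Lemma cvg_mxP (T : Type) (F : set_system T) (FF : Filter F) (p q : nat)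
    (f : T -> 'M[R]_(p, q)) (l : 'M[R]_(p, q)) :
  f @ F --> l <-> forall i j, (fun x => f x i j) @ F --> l i j.
Proof.
split=> [fl i j|fl].
  apply: (@cvg_comp _ _ _ f (fun B : 'M[R]_(p, q) => B i j) _ _ _ fl).
  exact: matrix_normedtype.coord_continuous.
apply/cvgrPdist_le => /= e e0; near=> x.
rewrite /Num.Def.normr/= mx_normrE (bigmax_le _ (ltW e0))//= => i _.
rewrite !mxE; move: i; near: x; apply: filter_forall => /= i.
exact: ((cvgrPdist_le _ _).1 (fl i.1 i.2)).
Unshelve. all: by end_near. Qed.

Lemma continuous_mxP (T : topologicalType) (p q : nat)
    (f : T -> 'M[R]_(p, q)) (x : T) :
  {for x, continuous f} <-> forall i j, {for x, continuous (fun y => f y i j)}.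
Proof. exact: cvg_mxP. Qed.

Lemma cvg_sum (V : normedModType R) (T I : Type) (F : set_system T)
    (FF : Filter F) (s : seq I) (P : pred I) (f : I -> T -> V) (l : I -> V) :
  (forall i, f i @ F --> l i) ->
  (fun x => \sum_(i <- s | P i) f i x) @ F --> \sum_(i <- s | P i) l i.
Proof.
move=> fl; elim: s => [|i s ih].
  by under eq_fun do rewrite big_nil; rewrite big_nil; exact: cvg_cst.
under eq_fun do rewrite big_cons; rewrite big_cons; case: ifP => // _.
by  apply: cvgD; [exact: fl|exact: ih].
Qed.

Lemma continuous_mulmx (T : topologicalType) (p q r : nat)
    (f : T -> 'M[R]_(p, q)) (h : T -> 'M[R]_(q, r)) (x : T) :
  {for x, continuous f} -> {for x, continuous h} ->
  {for x, continuous (fun y => f y *m h y)}.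
Proof.
move=> /continuous_mxP cf /continuous_mxP ch; apply/continuous_mxP => i j.
rewrite /prop_for /continuous_at.
under eq_fun do rewrite mxE; rewrite mxE.
apply: cvg_sum => k; apply: cvgM; [exact: cf|exact: ch].
Qed.

Lemma continuous_trmx (T : topologicalType) (p q : nat)
    (f : T -> 'M[R]_(p, q)) (x : T) :
  {for x, continuous f} -> {for x, continuous (fun y => (f y)^T)}.
Proof.
move=> /continuous_mxP cf; apply/continuous_mxP => i j.
rewrite /prop_for /continuous_at.
under eq_fun do rewrite mxE; rewrite mxE; exact: cf.
Qed.

Lemma continuous_prod (T : topologicalType) (I : Type) (s : seq I)
    (f : I -> T -> R) (x : T) : (forall i, {for x, continuous (f i)}) ->
  {for x, continuous (fun y => \prod_(i <- s) f i y)}.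
Proof.
move=> cf; elim: s => [|i s ih]; rewrite /prop_for /continuous_at.
  by under eq_fun do rewrite big_nil; rewrite big_nil; exact: cvg_cst.
under eq_fun do rewrite big_cons; rewrite big_cons.
by apply: cvgM; [exact: cf|exact: ih].
Qed.

Lemma continuous_det (T : topologicalType) (p : nat)
    (f : T -> 'M[R]_p) (x : T) :
  {for x, continuous f} -> {for x, continuous (fun y => \det (f y))}.
Proof.
move=> /continuous_mxP cf; rewrite /prop_for /continuous_at /determinant.
apply: cvg_sum => s; apply: cvgM; first exact: cvg_cst.
by apply: continuous_prod => i; exact: cf.
Qed.

(** The determinant stays nonzero near the point, so Cramer's rule expresses the inverse there
    through determinants. *)
Lemma continuous_invmx (T : topologicalType) (p : nat)
    (f : T -> 'M[R]_p) (x : T) : f x \in unitmx ->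
  {for x, continuous f} -> {for x, continuous (fun y => invmx (f y))}.
Proof.
move=> ux cf; have cd := continuous_det cf.
have d0 : \det (f x) != 0 by move: ux; rewrite unitmxE unitfE.
have nd : \forall y \near x, f y \in unitmx.
  have : \forall y \near x, \det (f y) != 0 by exact: (cvgr_neq0 _ cd d0).
  by apply: filterS => y yd; rewrite unitmxE unitfE.
suff ch : {for x, continuous (fun y => (\det (f y))^-1 *: \adj (f y))}.
  have E : {near x, (fun y => (\det (f y))^-1 *: \adj (f y)) =1
      (fun y => invmx (f y))}.
    by apply: filterS nd => y uy; rewrite /invmx uy.
  rewrite /prop_for /continuous_at -(nbhs_singleton E).
  exact: cvg_trans (near_eq_cvg E) ch.
move/continuous_mxP : cf => cf.
apply/continuous_mxP => i j; rewrite /prop_for /continuous_at.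
under eq_fun do rewrite !mxE; rewrite !mxE.
apply: cvgM; first exact: cvgV.
rewrite /cofactor; apply: cvgM; first exact: cvg_cst.
apply: (@continuous_det _ _ (fun y => row' j (col' i (f y)))).
by apply/continuous_mxP => k l; rewrite /prop_for /continuous_at;
  under eq_fun do rewrite !mxE; rewrite !mxE; exact: cf.
Qed.

Lemma is_derive_mxP (V : normedModType R) (p q : nat) (f : V -> 'M[R]_(p, q))
    (x v : V) (df : 'M[R]_(p, q)) :
  is_derive x v f df <->
  forall i j, is_derive x v (fun y => f y i j) (df i j).
Proof.
split=> [[fx <-] i j|fx].
  have := (derivable_mxP f x v).1 fx i j => /derivableP fij.
  by rewrite (derive_mx fx) mxE.
have fd : derivable f x v by apply/derivable_mxP => i j; have [] := fx i j.
split => //; rewrite (derive_mx fd); apply/matrixP => i j; rewrite mxE.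
by have [] := fx i j.
Qed.

Lemma is_derive_mul (V : normedModType R) (f h : V -> R) (x v : V)
    (df dh : R) :
  is_derive x v f df -> is_derive x v h dh ->
  is_derive x v (fun y => f y * h y) (df * h x + f x * dh).
Proof.
move=> ff hh; have := is_deriveM ff hh.
by rewrite addrC [X in X + _]mulrC.
Qed.

Lemma is_derive_mulmx (V : normedModType R) (p q r : nat)
    (f : V -> 'M[R]_(p, q)) (h : V -> 'M[R]_(q, r)) (x v : V)
    (df : 'M[R]_(p, q)) (dh : 'M[R]_(q, r)) :
  is_derive x v f df -> is_derive x v h dh ->
  is_derive x v (fun y => f y *m h y) (df *m h x + f x *m dh).
Proof.
move=> /is_derive_mxP ff /is_derive_mxP hh; apply/is_derive_mxP => i j.
have -> : (fun y => (f y *m h y) i j) =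
    \sum_k (fun y => f y i k * h y k j).
  by apply/funext => y; rewrite mxE fct_sumE.
rewrite !mxE -big_split /=.
apply: is_derive_sum => k.
exact: is_derive_mul.
Qed.

Lemma is_derive_trmx (V : normedModType R) (p q : nat)
    (f : V -> 'M[R]_(p, q)) (x v : V) (df : 'M[R]_(p, q)) :
  is_derive x v f df -> is_derive x v (fun y => (f y)^T) df^T.
Proof.
move=> /is_derive_mxP ff; apply/is_derive_mxP => i j; rewrite mxE.
by under eq_fun do rewrite mxE.
Qed.


Lemma is_derive_scale_dir (V W : normedModType R) (f : V -> W) (x v : V)
    (c : R) (df : W) :
  is_derive x v f df -> is_derive x (c *: v) f (c *: df).
Proof.
move=> [fx <-]; have [->|c0] := eqVneq c 0.
  by rewrite !scale0r; exact: is_derive0.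
suff H : (fun h => h^-1 *: (f (h *: (c *: v) + x) - f x)) @ 0^' -->
    c *: 'D_v f x.
  by apply: DeriveDef; [apply/cvg_ex; eexists; exact: H|exact/cvg_lim].
have -> : (fun h => h^-1 *: (f (h *: (c *: v) + x) - f x)) =
    (fun h => c *: ((h * c)^-1 *: (f ((h * c) *: v + x) - f x))).
  apply/funext => h; rewrite !scalerA; congr (_ *: _).
  by rewrite invfM mulrCA divff // mulr1.
apply: cvgZ; first exact: cvg_cst.
have hc : (fun h : R => h * c) @ 0^' --> 0^'.
  have H : (fun h : R => h * c) @ (0 : R) --> (0 : R).
    by rewrite -[X in _ --> X](mul0r c); apply: cvgM; [exact: cvg_id|exact: cvg_cst].
  move=> B nB; have {}nB : \forall y \near (0 : R), y != 0 -> B y by [].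
  have : \forall h \near (0 : R), h * c != 0 -> B (h * c) := H _ nB.
  by apply: filterS => h Bh h0; apply: Bh; rewrite mulf_neq0.
exact: (cvg_comp _ _ hc fx).
Qed.

Lemma is_derive_line (V W : normedModType R) (f : V -> W) (a v : V) (t : R)
    (df : W) : is_derive (a + t *: v) v f df ->
  is_derive t 1 (fun s => f (a + s *: v)) df.
Proof.
move=> [fx <-].
have E : (fun h : R => h^-1 *: (((fun s => f (a + s *: v)) \o shift t) (h *: 1)
     - f (a + t *: v))) =
   (fun h => h^-1 *: ((f \o shift (a + t *: v)) (h *: v) - f (a + t *: v))).
  apply/funext => h /=; congr (_ *: (f _ - _)).
  by rewrite [h *: 1]mulr1 scalerDl addrCA.
by apply: DeriveDef; rewrite /derivable /derive E.
Qed.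

Lemma mvt_line (V : normedModType R) (f : V -> R) (a v : V) (df : V -> R) :
  (forall t : R, 0 <= t <= 1 -> is_derive (a + t *: v) v f (df (a + t *: v))) ->
  exists2 t : R, 0 <= t <= 1 & f (a + v) - f a = df (a + t *: v).
Proof.
move=> fd.
have [||t t01] := @MVT R (fun s => f (a + s *: v))
    (fun s => df (a + s *: v)) 0 1 ltr01.
- move=> t t01; apply: is_derive_line; apply: fd.
  by move: t01; rewrite in_itv /= => /andP[/ltW -> /ltW ->].
- apply: derivable_within_continuous => t; rewrite in_itv /= => /fd fdt.
  by have [] := is_derive_line fdt.
rewrite scale1r scale0r addr0 subr0 mulr1 => E.
by exists t => //; move: t01; rewrite in_itv /= => /andP[/ltW -> /ltW ->].
Qed.

Lemma is_derive_comp1 (V W : normedModType R) (f : V -> W) (c : R -> V)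
    (t : R) (v : V) (L : W) :
  differentiable f (c t) -> is_derive t 1 c v -> 'D_v f (c t) = L ->
  is_derive t 1 (f \o c) L.
Proof.
move=> fd [cd cv] <-.
have cdf : differentiable c t by exact/derivable1_diffP.
have fcd : differentiable (f \o c) t by exact: differentiable_comp.
apply: DeriveDef; first exact: diff_derivable.
by rewrite deriveE // diff_comp //= [in RHS]deriveE // -cv deriveE.
Qed.

Lemma col_sum_delta (m : nat) (h : 'cV[R]_m) :
  h = \sum_j h j 0 *: delta_mx j 0.
Proof.
rewrite [LHS]matrix_sum_delta; apply: eq_bigr => j _.
by rewrite big_ord1.
Qed.

Lemma norm_coord (m p : nat) (h : 'M[R]_(m, p)) i j : `|h i j| <= `|h|.
Proof.
rewrite [leRHS]/Num.Def.normr/= mx_normrE.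
exact: le_trans (le_bigmax _ _ (i, j)).
Qed.

Lemma norm_delta (m : nat) (j : 'I_m) : `|delta_mx j 0 : 'cV[R]_m| <= 1.
Proof.
rewrite /Num.Def.normr/= mx_normrE; apply: bigmax_le => // i _.
by rewrite mxE; case: (_ && _); rewrite ?normr1 ?normr0.
Qed.

(** The coordinates of the increment are added one at a time. Each new one is handled by the mean
    value theorem on a segment parallel to an axis, and continuity of the partial derivative at [x]
    bounds the error. Working with a list [s] of coordinates makes this an induction. *)
Lemma partials_increment (m : nat) (f : 'cV[R]_m -> R) (x : 'cV[R]_m)
    (df : 'I_m -> 'cV[R]_m -> R) (s : seq 'I_m) :
  (\forall y \near x, forall j, is_derive y (delta_mx j 0) f (df j y)) ->
  (forall j, {for x, continuous (df j)}) ->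
  forall e : R, 0 < e -> \forall h \near (0 : 'cV[R]_m),
  `|f (x + \sum_(j <- s) (h : 'cV[R]_m) j 0 *: delta_mx j 0) - f x
     - \sum_(j <- s) h j 0 * df j x| <= e * `|h|.
Proof.
move=> fd cd; elim: s => [|i s ih] e e0.
  by near=> h; rewrite !big_nil addr0 !subrr normr0 mulr_ge0 // ltW.
have e20 : 0 < e / 2 by rewrite divr_gt0.
have {}cd : \forall y \near x, `|df i x - df i y| <= e / 2.
  exact: (cvgrPdist_le _ _).1 (cd i) _ e20.
have [d /= d0 xd] := (nbhs_ballP _ _).1 (filterI fd cd).
near=> h.
rewrite !big_cons; set p := \sum_(j <- s) h j 0 *: delta_mx j 0.
(* Every point of the segment is within (size s + 1)|h| of [x], as basis vectors have sup norm at
   most 1. *)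
have ball_small (t : R) : 0 <= t <= 1 ->
    ball x d ((x + p) + t *: (h i 0 *: delta_mx i 0)).
  move=> /andP[t0 t1]; rewrite -ball_normE /ball_ /=.
  rewrite -addrA opprD addNKr normrN.
  apply: (@le_lt_trans _ _ ((size s).+1%:R * `|h|)).
    have hj j : `|h j 0 *: (delta_mx j 0 : 'cV[R]_m)| <= `|h|.
      rewrite normrZ -[leRHS]mulr1; apply: ler_pM => //; first exact: norm_coord.
      exact: norm_delta.
    have -> : (size s).+1%:R * `|h| = (size s)%:R * `|h| + `|h|.
      by rewrite -natr1 mulrDl mul1r.
    rewrite (le_trans (ler_normD _ _)) // lerD //.
      rewrite (le_trans (ler_norm_sum _ _ _)) //.
      rewrite -sum1_size natr_sum mulr_suml; apply: ler_sum => j _.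
      by rewrite mul1r.
    rewrite normrZ -[leRHS]mul1r ler_pM // ger0_norm //.
  rewrite mulrC -ltr_pdivlMr ?ltr0n //; near: h.
  by apply: (@nbhs0_lt R 'cV[R]_m); rewrite divr_gt0 // ltr0n.
have [t t01 Et] : exists2 t : R, 0 <= t <= 1 &
    f ((x + p) + h i 0 *: delta_mx i 0) - f (x + p) =
    h i 0 * df i ((x + p) + t *: (h i 0 *: delta_mx i 0)).
  apply: (@mvt_line _ f (x + p) (h i 0 *: delta_mx i 0)
    (fun y => h i 0 * df i y)) => t t01; apply: is_derive_scale_dir.
  by have [] := xd _ (ball_small t t01).
rewrite [_ *: _ + p]addrC addrA.
have -> : f ((x + p) + h i 0 *: delta_mx i 0) - f x -
    (h i 0 * df i x + \sum_(j <- s) h j 0 * df j x) =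
    h i 0 * (df i ((x + p) + t *: (h i 0 *: delta_mx i 0)) - df i x) +
    (f (x + p) - f x - \sum_(j <- s) h j 0 * df j x).
  by rewrite mulrBr -Et; ring.
rewrite (le_trans (ler_normD _ _)) // (splitr e) mulrDl lerD //.
  rewrite normrM mulrC ler_pM //; last exact: norm_coord.
  by rewrite distrC; have [] := xd _ (ball_small t t01).
by rewrite /p; near: h; exact: ih.
Unshelve. all: by end_near. Qed.

(** The classical criterion by continuous partial derivatives. It is the bridge from [Ck], which
    speaks only of directional derivatives, to Frechet differentiability and hence to the chain
    rule. *)
Lemma partials_differentiable (m : nat) (f : 'cV[R]_m -> R) (x : 'cV[R]_m)
    (df : 'I_m -> 'cV[R]_m -> R) :
  (\forall y \near x, forall j, is_derive y (delta_mx j 0) f (df j y)) ->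
  (forall j, {for x, continuous (df j)}) ->
  differentiable f x /\ forall v, 'D_v f x = \sum_j v j 0 * df j x.
Proof.
move=> fd cd; pose d (h : 'cV[R]_m) : R := \sum_j h j 0 * df j x.
have lin_d : linear d.
  move=> a u v; rewrite /d scaler_sumr -big_split /=.
  by apply: eq_bigr => j _; rewrite !mxE mulrDl -mulrA.
pose dM := GRing.isLinear.Build _ _ _ _ _ lin_d.
pose dL : {linear _ -> _} := HB.pack d dM.
have cdL : continuous dL.
  move=> y; apply: (@cvg_sum _ _ _ (nbhs y)) => j.
  by apply: cvgM; [exact: matrix_normedtype.coord_continuous|exact: cvg_cst].
have fo : f \o shift x = cst (f x) + dL +o_ (0 : 'cV[R]_m) id.
  apply/eqaddoP => e e0.
  have := partials_increment (index_enum _) fd cd e0.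
  apply: filterS => h; rewrite -col_sum_delta => H.
  suff -> : (f \o shift x - (cst (f x) + dL)) h = f (x + h) - f x - dL h by [].
  by rewrite -[LHS]/(f (h + x) - (f x + dL h)) opprD addrA [h + x]addrC.
have Ed := diff_unique cdL fo.
have df_ : differentiable f x.
  by apply/diff_locallyP; rewrite Ed; split.
by split => // v; rewrite deriveE // Ed.
Qed.

End MatrixCalculus.

                          

(** * Closure properties of C^k maps and symmetry of second derivatives *)

Section CkTheory.
Context {R : realType}.
Implicit Types U V W : normedModType R.

Lemma is_derive_precomp_linear U U' V (L : U' -> U) (f : U -> V) (x v : U')
    (df : V) : linear L -> is_derive (L x) (L v) f df ->
  is_derive x v (f \o L) df.
Proof.
move=> linL [fx <-].
have E : (fun h : R => h^-1 *: (((f \o L) \o shift x) (h *: v) - (f \o L) x)) =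
   (fun h => h^-1 *: ((f \o shift (L x)) (h *: L v) - f (L x))).
  by apply/funext => h /=; rewrite linL.
by apply: DeriveDef; rewrite /derivable /derive E.
Qed.

Lemma is_derive_shiftr U V (f : U -> V) (x u v : U) (df : V) :
  is_derive (x + v) u f df -> is_derive x u (fun y => f (y + v)) df.
Proof.
move=> [fx <-].
have E : (fun h : R => h^-1 *: (((fun y => f (y + v)) \o shift x) (h *: u)
     - f (x + v))) =
   (fun h => h^-1 *: ((f \o shift (x + v)) (h *: u) - f (x + v))).
  by apply/funext => h /=; rewrite addrA.
by apply: DeriveDef; rewrite /derivable /derive E.
Qed.

Lemma is_derive_postcomp_real V (f : V -> R) (h : R -> R) (x v : V)
    (df dh : R) : is_derive x v f df -> is_derive (f x) 1 h dh ->
  is_derive x v (h \o f) (dh * df).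
Proof.
move=> ff hh.
have fl : is_derive (0 : R) 1 (fun s => f (x + s *: v)) df.
  by apply: is_derive_line; rewrite scale0r addr0.
have hd : differentiable h (f (x + 0 *: v)).
  by rewrite scale0r addr0; apply/derivable1_diffP; case: hh.
have key : is_derive (0 : R) 1 (h \o (fun s => f (x + s *: v))) (dh * df).
  apply: (is_derive_comp1 hd fl).
  have : is_derive (f (x + 0 *: v)) (df *: 1) h (df *: dh).
    by apply: is_derive_scale_dir; rewrite scale0r addr0.
  by rewrite [df *: 1]mulr1 [df *: dh]mulrC => -[].
have E : (fun t : R => t^-1 *: (((h \o f) \o shift x) (t *: v) - (h \o f) x)) =
   (fun t => t^-1 *: (((h \o (fun s => f (x + s *: v))) \o shift 0) (t *: 1)
        - (h \o (fun s => f (x + s *: v))) 0)).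
  apply/funext => t /=.
  by rewrite addr0 scale0r addr0 [t *: 1]mulr1 [x + _]addrC.
by case: key => kd kE; apply: DeriveDef; rewrite /derivable /derive E.
Qed.

Lemma near_open (T : topologicalType) (A : set T) (P : T -> Prop) x :
  open A -> A x -> (forall y, A y -> P y) -> \forall y \near x, P y.
Proof.
by move=> oA Ax AP; apply: filterS AP _; exact: open_nbhs_nbhs.
Qed.

Lemma near_continuous (T S : topologicalType) (f h : T -> S) (x : T) :
  {near x, f =1 h} -> {for x, continuous f} -> {for x, continuous h}.
Proof.
move=> E; rewrite /prop_for /continuous_at -(nbhs_singleton E).
exact: cvg_trans (near_eq_cvg E).
Qed.

Lemma Ck_ext U V k (A : set U) (f h : U -> V) : open A ->
  (forall x, A x -> f x = h x) -> Ck k A f -> Ck k A h.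
Proof.
elim: k f h => [|k ih] f h oA fh /=.
  move=> cf x Ax; apply: near_continuous (cf x Ax).
  exact: near_open oA Ax fh.
move=> [cf df]; split.
  move=> x Ax; apply: near_continuous (cf x Ax).
  exact: near_open oA Ax fh.
move=> v; have [fv Dv] := df v; split.
  move=> x Ax; apply: near_eq_derivable (fv x Ax).
  exact: near_open oA Ax fh.
apply: ih Dv => // x Ax; apply: near_eq_derive.
exact: near_open oA Ax fh.
Qed.

(** The induction step in usable form: an explicit formula [df], valid on the open set [A], may
    stand in for ['D_v f], whose values off [A] are uncontrolled. *)
Lemma Ck_step U V k (A : set U) (f : U -> V) (df : U -> U -> V) : open A ->
  (forall x, A x -> {for x, continuous f}) ->
  (forall v x, A x -> is_derive x v f (df v x)) ->
  (forall v, Ck k A (df v)) -> Ck k.+1 A f.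
Proof.
move=> oA cf fd Cd; split => // v; split; first by move=> x /(fd v) [].
by apply: Ck_ext (Cd v) => // x /(fd v) [].
Qed.

Lemma Ck_is_derive U V k (A : set U) (f : U -> V) x v :
  Ck k.+1 A f -> A x -> is_derive x v f ('D_v f x).
Proof. by move=> [_ fd] Ax; apply: DeriveDef => //; exact: (fd v).1. Qed.

Lemma Ck_derive U V k (A : set U) (f : U -> V) v :
  Ck k.+1 A f -> Ck k A ('D_v f).
Proof. by move=> [_ fd]; exact: (fd v).2. Qed.

Lemma Ck_continuous U V k (A : set U) (f : U -> V) x :
  Ck k A f -> A x -> {for x, continuous f}.
Proof. by case: k => [|k] /=; [apply|case=> + _; apply]. Qed.

Lemma Ck_pred U V k (A : set U) (f : U -> V) : Ck k.+1 A f -> Ck k A f.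
Proof.
elim: k f => [|k ih] f [cf fd] //; split => // v; have [fv Dv] := fd v.
by split => //; apply: ih.
Qed.

Lemma Ck_subset U V k (A B : set U) (f : U -> V) :
  B `<=` A -> Ck k A f -> Ck k B f.
Proof.
move=> BA; elim: k f => [|k ih] f /=; first by move=> cf x /BA; exact: cf.
move=> [cf fd]; split; first by move=> x /BA; exact: cf.
move=> v; have [fv Dv] := fd v.
by split; [move=> x /BA; exact: fv|exact: ih].
Qed.

Lemma Ck_cst U V k (A : set U) (c : V) : open A -> Ck k A (fun=> c).
Proof.
move=> oA; elim: k c => [|k ih] c; first by move=> x _; exact: cvg_cst.
apply: (@Ck_step _ _ _ _ _ (fun _ _ => 0)) => //.
by move=> x _; exact: cvg_cst.
Qed.

Lemma CkD U V k (A : set U) (f h : U -> V) : open A ->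
  Ck k A f -> Ck k A h -> Ck k A (fun x => f x + h x).
Proof.
move=> oA; elim: k f h => [|k ih] f h Cf Ch.
  by move=> x Ax; apply: cvgD; [exact: Cf|exact: Ch].
apply: (@Ck_step _ _ _ _ _ (fun v x => 'D_v f x + 'D_v h x)) => //.
- by move=> x Ax; apply: cvgD;
    [exact: Ck_continuous Cf Ax|exact: Ck_continuous Ch Ax].
- by move=> v x Ax; apply: is_deriveD;
    [exact: Ck_is_derive Cf Ax|exact: Ck_is_derive Ch Ax].
- by move=> v; apply: ih; exact: Ck_derive.
Qed.

Lemma CkM U k (A : set U) (f h : U -> R) : open A ->
  Ck k A f -> Ck k A h -> Ck k A (fun x => f x * h x).
Proof.
move=> oA; elim: k f h => [|k ih] f h Cf Ch.
  by move=> x Ax; apply: cvgM; [exact: Cf|exact: Ch].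
apply: (@Ck_step _ _ _ _ _ (fun v x => 'D_v f x * h x + f x * 'D_v h x)) => //.
- by move=> x Ax; apply: cvgM;
    [exact: Ck_continuous Cf Ax|exact: Ck_continuous Ch Ax].
- by move=> v x Ax; apply: is_derive_mul;
    [exact: Ck_is_derive Cf Ax|exact: Ck_is_derive Ch Ax].
- move=> v; apply: CkD => //; apply: ih;
    by [exact: Ck_derive|exact: Ck_pred].
Qed.

Lemma Ck_sum U V k (A : set U) (I : Type) (s : seq I) (P : pred I)
    (f : I -> U -> V) : open A ->
  (forall i, Ck k A (f i)) -> Ck k A (fun x => \sum_(i <- s | P i) f i x).
Proof.
move=> oA Cf; elim: s => [|i s ih].
  by under eq_fun do rewrite big_nil; exact: Ck_cst.
under eq_fun do rewrite big_cons.
by case: (P i) => //; apply: CkD.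
Qed.

Lemma Ck_mxP U k (A : set U) (p q : nat) (f : U -> 'M[R]_(p, q)) : open A ->
  Ck k A f <-> forall i j, Ck k A (fun x => f x i j).
Proof.
move=> oA; elim: k f => [|k ih] f.
  split=> [Cf i j x Ax|Cf x Ax]; first exact: (continuous_mxP _ _).1 (Cf x Ax) i j.
  by apply/continuous_mxP => i j; exact: Cf.
split=> [Cf i j|Cf].
  apply: (@Ck_step _ _ _ _ _ (fun v x => 'D_v f x i j)) => //.
  - by move=> x Ax; exact: (continuous_mxP _ _).1 (Ck_continuous Cf Ax) i j.
  - by move=> v x Ax; exact: (is_derive_mxP _ _ _ _).1 (Ck_is_derive v Cf Ax) i j.
  - by move=> v; exact: ((ih _).1 (Ck_derive v Cf)).
apply: (@Ck_step _ _ _ _ _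
  (fun v x => \matrix_(i, j) 'D_v (fun y => f y i j) x)) => //.
- by move=> x Ax; apply/continuous_mxP => i j; exact: Ck_continuous (Cf i j) Ax.
- move=> v x Ax; apply/is_derive_mxP => i j; rewrite mxE.
  exact: Ck_is_derive (Cf i j) Ax.
- move=> v; apply/ih => i j; under eq_fun do rewrite mxE.
  exact: Ck_derive (Cf i j).
Qed.

Lemma Ck_mulmx U k (A : set U) (p q r : nat) (f : U -> 'M[R]_(p, q))
    (h : U -> 'M[R]_(q, r)) : open A -> Ck k A f -> Ck k A h ->
  Ck k A (fun x => f x *m h x).
Proof.
move=> oA /(Ck_mxP _ _ oA) Cf /(Ck_mxP _ _ oA) Ch; apply/Ck_mxP => // i j.
under eq_fun do rewrite mxE.
by apply: Ck_sum => // l; exact: CkM.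
Qed.

Lemma Ck_scalemx U k (A : set U) (p q : nat) (f : U -> R)
    (h : U -> 'M[R]_(p, q)) : open A -> Ck k A f -> Ck k A h ->
  Ck k A (fun x => f x *: h x).
Proof.
move=> oA Cf /(Ck_mxP _ _ oA) Ch; apply/Ck_mxP => // i j.
by under eq_fun do rewrite mxE; exact: CkM.
Qed.

Lemma Ck_trmx U k (A : set U) (p q : nat) (f : U -> 'M[R]_(p, q)) : open A ->
  Ck k A f -> Ck k A (fun x => (f x)^T).
Proof.
move=> oA /(Ck_mxP _ _ oA) Cf; apply/Ck_mxP => // i j.
by under eq_fun do rewrite mxE.
Qed.

(** The difference quotients of [f \o L] along [v] are those of [f] along [L v], so the two
    derivative functions agree at every point and the identity can be iterated. *)
Lemma Ck_precomp_linear U U' V k (A : set U) (L : U' -> U) (f : U -> V) :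
  linear L -> continuous L -> Ck k A f -> Ck k (L @^-1` A) (f \o L).
Proof.
move=> linL cL; elim: k f => [|k ih] f /=.
  by move=> Cf x Ax; apply: continuous_comp; [exact: cL|exact: Cf].
move=> [cf fd]; split.
  by move=> x Ax; apply: continuous_comp; [exact: cL|exact: cf].
have DL v x : A (L x) -> is_derive x v (f \o L) ('D_(L v) f (L x)).
  move=> Ax; apply: is_derive_precomp_linear => //; apply: DeriveDef => //.
  exact: (fd (L v)).1.
have E v : (fun x => 'D_v (f \o L) x) = (fun x => 'D_(L v) f x) \o L.
  apply/funext => x; rewrite /derive.
  suff -> : (fun h : R => h^-1 *: (((f \o L) \o shift x) (h *: v) -
      (f \o L) x)) =
    (fun h => h^-1 *: ((f \o shift (L x)) (h *: L v) - f (L x))) by [].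
  by apply/funext => h /=; rewrite linL.
move=> v; split; first by move=> x Ax; have [] := DL v x Ax.
by rewrite E; apply: ih; exact: (fd (L v)).2.
Qed.

Lemma Ck_linear U V k (A : set U) (L : U -> V) : open A ->
  linear L -> continuous L -> Ck k A L.
Proof.
move=> oA linL cL; case: k => [|k]; first by move=> x _; exact: cL.
apply: (@Ck_step _ _ _ _ _ (fun v _ => L v)) => //.
- by move=> x _; exact: cL.
- by move=> v x _; apply: (@is_derive_precomp_linear _ _ _ L id).
- by move=> v; exact: Ck_cst.
Qed.

Lemma Ck_expR U k (A : set U) (f : U -> R) : open A ->
  Ck k A f -> Ck k A (fun x => expR (f x)).
Proof.
move=> oA; elim: k => [|k ih] Cf.
  by move=> x Ax; apply: continuous_comp; [exact: Cf|exact: continuous_expR].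
apply: (@Ck_step _ _ _ _ _ (fun v x => expR (f x) * 'D_v f x)) => //.
- move=> x Ax; apply: continuous_comp; first exact: Ck_continuous Cf Ax.
  exact: continuous_expR.
- move=> v x Ax; apply: (@is_derive_postcomp_real _ f).
  exact: Ck_is_derive Cf Ax.
- by move=> v; apply: CkM => //; [apply/ih/Ck_pred|exact: Ck_derive Cf].
Qed.

Lemma continuous_rsqrt (T : topologicalType) (f : T -> R) x : 0 < f x ->
  {for x, continuous f} ->
  {for x, continuous (fun y => (Num.sqrt (f y))^-1)}.
Proof.
move=> f0 cf; apply: cvgV; first by rewrite gt_eqF // sqrtr_gt0.
by apply: continuous_comp => //; exact: sqrt_continuous.
Qed.

Lemma is_derive_rsqrt V (f : V -> R) (x v : V) (df : R) : 0 < f x ->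
  is_derive x v f df ->
  is_derive x v (fun y => (Num.sqrt (f y))^-1)
    (- 2^-1 * (Num.sqrt (f x))^-1 ^+ 3 * df).
Proof.
move=> f0 ff.
have s0 : Num.sqrt (f x) != 0 by rewrite gt_eqF // sqrtr_gt0.
have sd : is_derive (f x) 1 Num.sqrt (2 * Num.sqrt (f x))^-1.
  exact: is_derive1_sqrt.
apply: (@is_derive_postcomp_real _ f (fun t => (Num.sqrt t)^-1)) => //.
have sdd : derivable Num.sqrt (f x) 1 by [].
apply: DeriveDef; first exact: derivableV.
rewrite deriveV // derive_val -[_ *: _]/(_ * _) invfM.
by field.
Qed.

(** With h = f^(-1/2) the derivative is -(1/2) h^3 Df, again a polynomial in h, so the induction on
    [k] closes. *)
Lemma Ck_rsqrt U k (A : set U) (f : U -> R) : open A ->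
  (forall x, A x -> 0 < f x) ->
  Ck k A f -> Ck k A (fun x => (Num.sqrt (f x))^-1).
Proof.
move=> oA f0; elim: k => [|k ih] Cf.
  by move=> x Ax; apply: continuous_rsqrt; [exact: f0|exact: Cf].
apply: (@Ck_step _ _ _ _ _
  (fun v x => - 2^-1 * (Num.sqrt (f x))^-1 ^+ 3 * 'D_v f x)) => //.
- move=> x Ax; apply: continuous_rsqrt; first exact: f0.
  exact: Ck_continuous Cf Ax.
- move=> v x Ax; apply: is_derive_rsqrt; first exact: f0.
  exact: Ck_is_derive Cf Ax.
- move=> v; have Ch := ih (Ck_pred Cf).
  apply: CkM => //; last exact: Ck_derive Cf.
  apply: CkM => //; first exact: Ck_cst.
  have -> : (fun x => (Num.sqrt (f x))^-1 ^+ 3) =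
    (fun x => (Num.sqrt (f x))^-1 * ((Num.sqrt (f x))^-1 * (Num.sqrt (f x))^-1)).
    by apply/funext => x; rewrite !exprS expr0 mulr1.
  by do 2![apply: CkM => //].
Qed.

(** The mean value theorem is applied in direction [u] to y -> f(y + v) - f(y), and then in
    direction [v] to the resulting difference of [fu]. *)
Lemma schwarz_increment V (f fu fvu : V -> R) (x u v : V) :
  (forall a b : R, 0 <= a <= 1 -> 0 <= b <= 1 ->
     is_derive (x + a *: u + b *: v) u f (fu (x + a *: u + b *: v)) /\
     is_derive (x + a *: u + b *: v) v fu (fvu (x + a *: u + b *: v))) ->
  exists ab : R * R, [/\ 0 <= ab.1 <= 1, 0 <= ab.2 <= 1 &
    f (x + u + v) - f (x + u) - (f (x + v) - f x) =
    fvu (x + ab.1 *: u + ab.2 *: v)].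
Proof.
move=> fd.
have [a a01 Ea] : exists2 a : R, 0 <= a <= 1 &
    (fun y => f (y + v) - f y) (x + u) - (fun y => f (y + v) - f y) x =
    (fun y => fu (y + v) - fu y) (x + a *: u).
  apply: (@mvt_line _ _ (fun y => f (y + v) - f y) x u
    (fun y => fu (y + v) - fu y)) => a a01.
  apply: is_deriveB.
    apply: is_derive_shiftr.
    by have [] := fd a 1 a01; rewrite ?scale1r // ler01 lexx.
  by have [] := fd a 0 a01; rewrite ?scale0r ?addr0 // ler01 lexx.
have [b b01 Eb] : exists2 b : R, 0 <= b <= 1 &
    fu (x + a *: u + v) - fu (x + a *: u) = fvu (x + a *: u + b *: v).
  by apply: mvt_line => b b01; have [] := fd a b a01 b01.
by exists (a, b); split => //=; rewrite -Eb -Ea.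
Qed.

(** The second difference over a small parallelogram is symmetric in the two directions. Computed in
    both orders it equals s^2 times each mixed derivative at points close to [x], and continuity of
    these derivatives gives the equality at [x]. *)
Lemma schwarz V (A : set V) (f : V -> R) (x u v : V) : open A -> A x ->
  Ck 2 A f -> 'D_v ('D_u f) x = 'D_u ('D_v f) x.
Proof.
move=> oA Ax Cf; apply/eqP; rewrite -subr_eq0 -normr_le0.
apply/ler_addgt0Pr => e e0; rewrite add0r.
have e20 : 0 < e / 2 by rewrite divr_gt0.
have cd p q : \forall y \near x, A y /\
    `|'D_p ('D_q f) x - 'D_p ('D_q f) y| <= e / 2.
  apply: filterI; first exact: open_nbhs_nbhs.
  apply: (cvgrPdist_le _ _).1 e20.
  exact: Ck_continuous (Ck_derive p (Ck_derive q Cf)) Ax.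
have [d /= d0 xd] := (nbhs_ballP _ _).1 (filterI (cd v u) (cd u v)).
(* This keeps the parallelogram with sides [s *: u] and [s *: v] inside the ball of radius [d]; the
   summand 1 makes the denominator positive. *)
pose s := d / 2 / (`|u| + `|v| + 1).
have n0 : 0 < `|u| + `|v| + 1 by rewrite ltr_wpDl // addr_ge0.
have s0 : 0 < s by rewrite !divr_gt0.
have sE : s * (`|u| + `|v| + 1) = d / 2 by rewrite /s divfK ?gt_eqF.
clearbody s.
have sb (p q : V) (a b : R) : `|p| + `|q| = `|u| + `|v| ->
    0 <= a <= 1 -> 0 <= b <= 1 -> ball x d (x + a *: (s *: p) + b *: (s *: q)).
  move=> pq /andP[a0 a1] /andP[b0 b1]; rewrite -ball_normE /ball_ /=.
  rewrite -addrA opprD addNKr normrN (le_lt_trans (ler_normD _ _)) //.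
  rewrite !normrZ !ger0_norm ?(ltW s0) //.
  apply: (@le_lt_trans _ _ (s * (`|u| + `|v| + 1))); last first.
    by rewrite sE ltr_pdivrMr // ltr_pMr // ltr1n.
  rewrite -pq mulrDr mulr1 mulrDr -[leLHS]addr0 lerD ?(ltW s0) //.
  by apply: lerD; apply: ler_piMl => //; apply: mulr_ge0 => //; exact: ltW.
have inc p q : (forall y, ball x d y -> A y) -> `|p| + `|q| = `|u| + `|v| ->
  exists y, ball x d y /\ f (x + s *: p + s *: q) - f (x + s *: p) -
    (f (x + s *: q) - f x) = s * (s * 'D_q ('D_p f) y).
  move=> dA pq.
  have [a b|[a b] /= [a01 b01 ->]] := @schwarz_increment _ f (fun y => s * 'D_p f y)
      (fun y => s * (s * 'D_q ('D_p f) y)) x (s *: p) (s *: q).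
    move=> a01 b01; have /dA Ay := sb p q a b pq a01 b01; split.
      by apply: is_derive_scale_dir; exact: Ck_is_derive Cf Ay.
    apply: is_derive_scale_dir.
    apply: (@is_deriveZ _ _ _ ('D_p f) s).
    exact: Ck_is_derive (Ck_derive p Cf) Ay.
  by exists (x + a *: (s *: p) + b *: (s *: q)); split => //; exact: sb.
have dA y : ball x d y -> A y by move=> /xd [] [].
have [y [/xd [[_ yb] _] Ey]] := inc u v dA erefl.
have [z [/xd [_ [_ zb]] Ez]] := inc v u dA (addrC _ _).
have sn0 : s != 0 by rewrite gt_eqF.
rewrite [x + s *: v + s *: u]addrAC in Ez.
move: Ey Ez yb zb.
move: ('D_v ('D_u f) y) ('D_u ('D_v f) z) ('D_v ('D_u f) x)
  ('D_u ('D_v f) x) (f _) (f _) (f _) (f _) => a b a' b' f1 f2 f3 f4 Ea Eb aa bb.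
have ab : a = b by apply: (mulfI sn0); apply: (mulfI sn0); rewrite -Ea -Eb; ring.
have -> : a' - b' = (a' - a) - (b' - b) by rewrite ab; ring.
by rewrite (le_trans (ler_normB _ _)) // (splitr e) lerD.
Qed.

Lemma C1_differentiable m (A : set 'cV[R]_m) (f : 'cV[R]_m -> R) x :
  open A -> A x -> Ck 1 A f ->
  differentiable f x /\
  forall v, 'D_v f x = \sum_j v j 0 * 'D_(delta_mx j 0) f x.
Proof.
move=> oA Ax Cf.
apply: (@partials_differentiable _ _ _ _ (fun j => 'D_(delta_mx j 0) f)).
  by apply: (near_open oA Ax) => y Ay j; exact: Ck_is_derive Cf Ay.
by move=> j; exact: Ck_continuous (Ck_derive _ Cf) Ax.
Qed.

Lemma C1_derive_sum m p q (A : set 'cV[R]_m) (f : 'cV[R]_m -> 'M[R]_(p, q)) x v :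
  open A -> A x -> Ck 1 A f ->
  'D_v f x = \sum_j v j 0 *: 'D_(delta_mx j 0) f x.
Proof.
move=> oA Ax Cf; apply/matrixP => i k; rewrite summxE.
have D w : is_derive x w (fun y => f y i k) ('D_w f x i k).
  by move: i k; apply/is_derive_mxP; exact: Ck_is_derive Cf Ax.
have [_ /(_ v)] := C1_differentiable oA Ax ((Ck_mxP _ _ oA).1 Cf i k).
have [_ ->] := D v => ->; apply: eq_bigr => j _; rewrite mxE.
by have [_ ->] := D (delta_mx j 0).
Qed.

Lemma C1_is_derive_comp m p q (A : set 'cV[R]_m) (f : 'cV[R]_m -> 'M[R]_(p, q))
    (c : R -> 'cV[R]_m) (t : R) (v : 'cV[R]_m) :
  open A -> A (c t) -> Ck 1 A f -> is_derive t 1 c v ->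
  is_derive t 1 (f \o c) ('D_v f (c t)).
Proof.
move=> oA Act Cf cv; apply/is_derive_mxP => i j.
have Cij := (Ck_mxP _ _ oA).1 Cf i j.
have [fd _] := C1_differentiable oA Act Cij.
apply: (is_derive_comp1 fd cv).
by have [] := (is_derive_mxP _ _ _ _).1 (Ck_is_derive v Cf Act) i j.
Qed.

End CkTheory.

                                           

(** * Gram-Schmidt orthonormalisation through a Cholesky factor *)

Section Blocks.
Context {R : realType}.

Lemma is_derive_block (V : normedModType R) (p1 p2 q1 q2 : nat)
    (a : V -> 'M[R]_(p1, q1)) (b : V -> 'M[R]_(p1, q2))
    (c : V -> 'M[R]_(p2, q1)) (d : V -> 'M[R]_(p2, q2)) (x v : V) a' b' c' d' :
  is_derive x v a a' -> is_derive x v b b' -> is_derive x v c c' ->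
  is_derive x v d d' ->
  is_derive x v (fun y => block_mx (a y) (b y) (c y) (d y))
    (block_mx a' b' c' d').
Proof.
move=> /is_derive_mxP Ha /is_derive_mxP Hb /is_derive_mxP Hc /is_derive_mxP Hd.
apply/is_derive_mxP => i j.
case: (split_ordP i) => {}i ->; case: (split_ordP j) => {}j ->.
- by rewrite block_mxEul; under eq_fun do rewrite block_mxEul.
- by rewrite block_mxEur; under eq_fun do rewrite block_mxEur.
- by rewrite block_mxEdl; under eq_fun do rewrite block_mxEdl.
- by rewrite block_mxEdr; under eq_fun do rewrite block_mxEdr.
Qed.

Lemma Ck_block (V : normedModType R) k (A : set V) (p1 p2 q1 q2 : nat)
    (a : V -> 'M[R]_(p1, q1)) (b : V -> 'M[R]_(p1, q2))
    (c : V -> 'M[R]_(p2, q1)) (d : V -> 'M[R]_(p2, q2)) : open A ->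
  Ck k A a -> Ck k A b -> Ck k A c -> Ck k A d ->
  Ck k A (fun y => block_mx (a y) (b y) (c y) (d y)).
Proof.
move=> oA /(Ck_mxP _ _ oA) Ha /(Ck_mxP _ _ oA) Hb /(Ck_mxP _ _ oA) Hc
  /(Ck_mxP _ _ oA) Hd.
apply/Ck_mxP => // i j.
case: (split_ordP i) => {}i ->; case: (split_ordP j) => {}j ->.
- by under eq_fun do rewrite block_mxEul.
- by under eq_fun do rewrite block_mxEur.
- by under eq_fun do rewrite block_mxEdl.
- by under eq_fun do rewrite block_mxEdr.
Qed.

End Blocks.

Section Cholesky.
Context {R : realType}.

Definition posdef (n : nat) (S : 'M[R]_n) : Prop :=
  S^T = S /\ forall v : 'cV[R]_n, v != 0 -> 0 < (v^T *m S *m v) 0 0.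

(** The Schur complement of the top left entry. The inverse of that entry is written as the square
    of an inverse square root, the same smooth function that occurs in [cholesky]. *)
Definition schur (n : nat) (S : 'M[R]_(1 + n)) : 'M[R]_n :=
  drsubmx S - ((Num.sqrt (S 0 0))^-1 ^+ 2) *: (dlsubmx S *m ursubmx S).

                                                                              
                                           
(** The upper triangular matrix C with positive diagonal such that C^T S C = 1, that is,
    Gram-Schmidt for the form S. Being an explicit formula, it depends smoothly on S. *)
Fixpoint cholesky (n : nat) : 'M[R]_n -> 'M[R]_n :=
  match n with
  | 0 => fun S => S
  | n'.+1 => fun S : 'M[R]_(1 + n') =>
      let h := (Num.sqrt (S 0 0))^-1 in
      let V := cholesky (schur S) in
      block_mx h%:M (- (h ^+ 2 *: (ursubmx S *m V))) 0 V
  end.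

Arguments cholesky {n} S.

Lemma posdef_diag (n : nat) (S : 'M[R]_(1 + n)) : posdef S -> 0 < S 0 0.
Proof.
move=> [_ pS]; have := pS (delta_mx 0 0).
rewrite trmx_delta -rowE -colE !mxE; apply.
apply/eqP => /matrixP/(_ 0 0)/eqP; rewrite !mxE !eqxx /=.
by rewrite oner_eq0.
Qed.

Lemma posdef_ul (n : nat) (S : 'M[R]_(1 + n)) : ulsubmx S = (S 0 0)%:M.
Proof.
by apply/matrixP => i j; rewrite !ord1 !mxE eqxx mulr1n; congr (S _ _);
  apply/val_inj.
Qed.

Lemma posdef_block (n : nat) (S : 'M[R]_(1 + n)) : posdef S ->
  S = block_mx (S 0 0)%:M (ursubmx S) (ursubmx S)^T (drsubmx S).
Proof.
by move=> [symS _]; rewrite -posdef_ul trmx_ursub symS submxK.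
Qed.

Lemma sqr_rsqrt (s : R) : 0 < s -> (Num.sqrt s)^-1 ^+ 2 = s^-1.
Proof. by move=> s0; rewrite exprVn sqr_sqrtr // ltW. Qed.

Lemma posdef_schur (n : nat) (S : 'M[R]_(1 + n)) : posdef S -> posdef (schur S).
Proof.
move=> pS; have s0 := posdef_diag pS; have SE := posdef_block pS.
have [symS pv] := pS.
have drT : (drsubmx S)^T = drsubmx S by rewrite trmx_drsub symS.
have dl : dlsubmx S = (ursubmx S)^T by rewrite trmx_ursub symS.
rewrite /schur sqr_rsqrt // dl.
move: SE drT pv s0; move: (ursubmx S) (drsubmx S) (S 0 0) => r S' s -> drT pv s0.
split.
  by rewrite linearB /= [(_ *: _)^T]linearZ /= trmx_mul trmxK drT.
move=> v v0.
(* Completing the square: for this first component the form of [S] at [w] equals the Schur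
   complement at [v]. *)
pose w : 'cV[R]_(1 + n) := col_mx (- (s^-1 *: (r *m v))) v.
have w0 : w != 0.
  by apply: contra v0 => /eqP; rewrite /w -col_mx0 => /eq_col_mx [_ ->].
have := pv w w0; congr (0 < _).
congr (fun B : 'M[R]_1 => B 0 0).
rewrite /w tr_col_mx mul_row_block mul_row_col mul_mx_scalar.
rewrite [(- _)^T]linearN [X in - X]linearZ /= trmx_mul.
rewrite !scalerN scalerA divff ?gt_eqF // scale1r addNr mul0mx add0r.
by rewrite mulmxBr mulNmx -!scalemxAl -scalemxAr mulmxA addrC.
Qed.

Lemma cholesky_gram (n : nat) (S : 'M[R]_n) : posdef S ->
  (cholesky S)^T *m S *m cholesky S = 1%:M.
Proof.
elim: n S => [|n ih] S pS; first by apply/matrixP => -[].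
rewrite /cholesky -/cholesky.
have s0 := posdef_diag pS; have SE := posdef_block pS; have [symS _] := pS.
have dl : dlsubmx (S : 'M[R]_(1 + n)) = (ursubmx (S : 'M[R]_(1 + n)))^T.
  by rewrite trmx_ursub symS.
have := ih _ (posdef_schur pS); move: (cholesky (schur S)) => V.
rewrite /schur dl; set h := (Num.sqrt _)^-1 => ihV.
have hs : h ^+ 2 * S 0 0 = 1 by rewrite /h sqr_rsqrt // mulVf // gt_eqF.
move: ihV SE hs; move: (S 0 0) h.
move: (ursubmx (S : 'M[R]_(1 + n))) (drsubmx (S : 'M[R]_(1 + n))) => r S' s h.
move=> ihV -> hs.
have -> : (1%:M : 'M[R]_n.+1) = block_mx (1%:M : 'M[R]_1) 0 0 (1%:M : 'M[R]_n).
  by rewrite -scalar_mx_block.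
change ((block_mx h%:M (- (h ^+ 2 *: (r *m V))) 0 V)^T *m
  block_mx s%:M r r^T S' *m block_mx h%:M (- (h ^+ 2 *: (r *m V))) 0 V =
  block_mx 1%:M 0 0 1%:M :> 'M[R]_(1 + n)).
rewrite tr_block_mx !mulmx_block.
rewrite trmx0 !mulmx0 !mul0mx !addr0 tr_scalar_mx -!scalar_mxM.
rewrite !mul_scalar_mx !mul_mx_scalar.
have NT : (- (h ^+ 2 *: (r *m V)))^T = - (h ^+ 2 *: (V^T *m r^T)).
  by rewrite [(- _)^T]linearN [X in - X]linearZ /= trmx_mul.
rewrite NT.
have E : s *: - (h ^+ 2 *: (V^T *m r^T)) = - (V^T *m r^T).
  by rewrite scalerN scalerA [s * _]mulrC hs scale1r.
congr block_mx.
- by rewrite -hs; congr (_%:M); ring.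
- rewrite -scalemxAl !scalerN !scalerA -[h * s * _]mulrA [s * _]mulrC hs mulr1.
  by rewrite addNr.
- by rewrite E addNr scaler0.
- rewrite E addNr mul0mx add0r -ihV mulmxBr; congr (_ *m V).
  by rewrite addrC mulNmx -scalemxAl -scalemxAr mulmxA.
Qed.

Lemma cholesky1 (n : nat) : cholesky (1%:M : 'M[R]_n) = 1%:M.
Proof.
elim: n => [|n ih]; first by apply/matrixP => -[].
rewrite /cholesky -/cholesky /schur.
have -> : (1%:M : 'M[R]_n.+1) = block_mx (1%:M : 'M[R]_1) 0 0 (1%:M : 'M[R]_n).
  by rewrite -scalar_mx_block.
rewrite block_mxKur block_mxKdr block_mxKdl.
rewrite mul0mx scaler0 oppr0 mulmx0 scaler0 subr0 ih.
rewrite [X in Num.sqrt X](_ : _ = 1); first by rewrite sqrtr1 invr1.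
by rewrite -[in LHS]scalar_mx_block mxE eqxx.
Qed.

(** The factor is triangular with positive diagonal. Positivity of its determinant allows it to be
    lifted to the universal cover of GL^+. *)
Lemma cholesky_det_gt0 (n : nat) (S : 'M[R]_n) : posdef S ->
  0 < \det (cholesky S).
Proof.
elim: n S => [|n ih] S pS; first by rewrite det_mx00.
rewrite /cholesky -/cholesky.
rewrite (det_ublock (_ : 'M[R]_1)) det_scalar1 mulr_gt0 //.
  by rewrite invr_gt0 sqrtr_gt0; exact: posdef_diag.
exact/ih/posdef_schur.
Qed.

Lemma posdef_det_gt0 (n : nat) (S : 'M[R]_n) : posdef S -> 0 < \det S.
Proof.
move=> pS; have := congr1 determinant (cholesky_gram pS).
have c0 := cholesky_det_gt0 pS.
rewrite !det_mulmx det_tr det1 mulrAC => E.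
have : 0 < \det (cholesky S) * \det (cholesky S) * \det S by rewrite E.
by rewrite pmulr_rgt0 // mulr_gt0.
Qed.

Lemma posdef_congr (n : nat) (S B : 'M[R]_n) : posdef S -> B \in unitmx ->
  posdef (B^T *m S *m B).
Proof.
move=> [symS pS] uB; split; first by rewrite !trmx_mul trmxK symS mulmxA.
move=> v v0; have := pS (B *m v); rewrite trmx_mul !mulmxA; apply.
by apply: contra v0 => /eqP Bv; rewrite -[v]mul1mx -(mulVmx uB) -mulmxA Bv mulmx0.
Qed.

(** Each entry of the factor is a differentiable expression in entries of [S], so it is stationary
    when [S] is. It will be applied to the Gram matrix along a line with horizontal velocity:
    orthonormalising then has no first-order effect. *)
Lemma is_derive_cholesky (V : normedModType R) (n : nat) (S : V -> 'M[R]_n)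
    (x v : V) : posdef (S x) -> is_derive x v S 0 ->
  is_derive x v (cholesky \o S) 0.
Proof.
elim: n S => [|n ih] S pS dS //.
have s0 := posdef_diag pS.
have e00 : is_derive x v (fun y => S y 0 0) 0.
  by have /is_derive_mxP/(_ 0 0) := dS; rewrite mxE.
have dh : is_derive x v (fun y => (Num.sqrt (S y 0 0))^-1) 0.
  by have := is_derive_rsqrt s0 e00; rewrite mulr0.
have dh2 : is_derive x v (fun y => (Num.sqrt (S y 0 0))^-1 ^+ 2) 0.
  by have := is_derive_mul dh dh; rewrite mul0r mulr0 addr0.
have sub (p q : nat) (f : 'I_p -> 'I_n.+1) (h : 'I_q -> 'I_n.+1) :
    is_derive x v (fun y => \matrix_(i, j) S y (f i) (h j)) 0.
  apply/is_derive_mxP => i j; rewrite mxE; under eq_fun do rewrite mxE.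
  by have /is_derive_mxP/(_ (f i) (h j)) := dS; rewrite mxE.
have dur : is_derive x v (fun y => ursubmx (S y : 'M[R]_(1 + n))) 0.
  apply/is_derive_mxP => i j; rewrite mxE; under eq_fun do rewrite !mxE.
  by have /is_derive_mxP/(_ (lshift n i) (rshift 1 j)) := dS; rewrite mxE.
have ddl : is_derive x v (fun y => dlsubmx (S y : 'M[R]_(1 + n))) 0.
  apply/is_derive_mxP => i j; rewrite mxE; under eq_fun do rewrite !mxE.
  by have /is_derive_mxP/(_ (rshift 1 i) (lshift n j)) := dS; rewrite mxE.
have ddr : is_derive x v (fun y => drsubmx (S y : 'M[R]_(1 + n))) 0.
  apply/is_derive_mxP => i j; rewrite mxE; under eq_fun do rewrite !mxE.
  by have /is_derive_mxP/(_ (rshift 1 i) (rshift 1 j)) := dS; rewrite mxE.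
have dsc p q (f : V -> R) (F : V -> 'M[R]_(p, q)) : is_derive x v f 0 ->
    is_derive x v F 0 -> is_derive x v (fun y => f y *: F y) 0.
  move=> df dF; apply/is_derive_mxP => i j; rewrite mxE.
  under eq_fun do rewrite mxE.
  have /is_derive_mxP/(_ i j) := dF; rewrite mxE => Fij.
  by have := is_derive_mul df Fij; rewrite mul0r mulr0 addr0.
have dmul p q r (F : V -> 'M[R]_(p, q)) (H : V -> 'M[R]_(q, r)) :
    is_derive x v F 0 ->
    is_derive x v H 0 -> is_derive x v (fun y => F y *m H y) 0.
  by move=> dF dH; have := is_derive_mulmx dF dH; rewrite mul0mx mulmx0 addr0.
have dschur : is_derive x v (fun y => schur (S y : 'M[R]_(1 + n))) 0.
  by have := is_deriveB ddr (dsc _ _ _ _ dh2 (dmul _ _ _ _ _ ddl dur));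
    rewrite subr0.
have dV := ih _ (posdef_schur pS) dschur.
rewrite -[0](block_mx0 R 1 n 1 n).
apply: (@is_derive_block _ _ _ _ _ _ (fun y => ((Num.sqrt (S y 0 0))^-1)%:M)
  (fun y => - (((Num.sqrt (S y 0 0))^-1) ^+ 2 *:
     (ursubmx (S y : 'M[R]_(1 + n)) *m cholesky (schur (S y : 'M[R]_(1 + n))))))
   (fun=> 0) (fun y => cholesky (schur (S y : 'M[R]_(1 + n))))) => //.
- apply/is_derive_mxP => i j; rewrite mxE; under eq_fun do rewrite mxE.
  by rewrite !ord1 eqxx; under eq_fun do rewrite mulr1n.
- by have := is_deriveN (dsc _ _ _ _ dh2 (dmul _ _ _ _ _ dur dV));
    rewrite oppr0.
Qed.

Lemma Ck_cholesky (V : normedModType R) k (A : set V) (n : nat)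
    (S : V -> 'M[R]_n) : open A -> (forall x, A x -> posdef (S x)) ->
  Ck k A S -> Ck k A (cholesky \o S).
Proof.
move=> oA; elim: n S => [|n ih] S pS dS //.
have s0 x : A x -> 0 < S x 0 0 by move=> /pS /posdef_diag.
have Cij i j : Ck k A (fun y => S y i j) by exact: (Ck_mxP _ _ oA).1 dS i j.
have dh : Ck k A (fun y => (Num.sqrt (S y 0 0))^-1) by exact: Ck_rsqrt.
have dh2 : Ck k A (fun y => (Num.sqrt (S y 0 0))^-1 ^+ 2) by exact: CkM.
have dur : Ck k A (fun y => ursubmx (S y : 'M[R]_(1 + n))).
  by apply/Ck_mxP => // i j; under eq_fun do rewrite !mxE.
have ddl : Ck k A (fun y => dlsubmx (S y : 'M[R]_(1 + n))).
  by apply/Ck_mxP => // i j; under eq_fun do rewrite !mxE.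
have ddr : Ck k A (fun y => drsubmx (S y : 'M[R]_(1 + n))).
  by apply/Ck_mxP => // i j; under eq_fun do rewrite !mxE.
have CN p q (F : V -> 'M[R]_(p, q)) : Ck k A F -> Ck k A (fun y => - F y).
  move=> CF; under eq_fun do rewrite -scaleN1r.
  by apply: Ck_scalemx => //; exact: Ck_cst.
have dschur : Ck k A (fun y => schur (S y : 'M[R]_(1 + n))).
  apply: CkD => //; apply: CN; apply: Ck_scalemx => //; exact: Ck_mulmx.
have dV := ih _ (fun x Ax => posdef_schur (pS x Ax)) dschur.
apply: (@Ck_block _ _ _ _ _ _ _ _ (fun y => ((Num.sqrt (S y 0 0))^-1)%:M)
  (fun y => (- (((Num.sqrt (S y 0 0))^-1) ^+ 2 *:
     (ursubmx (S y : 'M[R]_(1 + n)) *m cholesky (schur (S y : 'M[R]_(1 + n)))))))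
   (fun=> 0) (fun y => cholesky (schur (S y : 'M[R]_(1 + n))))) => //.
- apply/Ck_mxP => // i j; under eq_fun do rewrite mxE.
  by rewrite !ord1 eqxx; under eq_fun do rewrite mulr1n.
- by apply: CN; apply: Ck_scalemx => //; exact: Ck_mulmx.
- exact: Ck_cst.
Qed.

End Cholesky.

(** * The Koszul formula in coordinates *)

Section ChristoffelUniqueness.
Context {R : realType} {n : nat}.

(** Here [K v] plays the role of g Gamma(v), the Christoffel matrix with lowered index, and [d a]
    that of the derivative of g along coordinate [a]. Torsion-freeness gives both linearity in [v]
    and a symmetry of indices; adding and subtracting the three permuted compatibility equations
    isolates [K]. *)
Lemma koszul_unique (K : 'cV[R]_n -> 'M[R]_n) (d : 'I_n -> 'M[R]_n) :
  (forall v, K v + (K v)^T = \sum_a v a 0 *: d a) ->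
  (forall u v, K v *m u = K u *m v) ->
  forall v, K v = \matrix_(l, b) (2^-1 * \sum_a v a 0 *
    (d a l b + d b l a - d l a b)).
Proof.
move=> compat torsion v; apply/matrixP => l b; rewrite mxE.
have KE w i : K w *m delta_mx i 0 = col i (K w) by rewrite colE.
have E1 w i j : K w i j = \sum_a w a 0 * K (delta_mx j 0) i a.
  have := torsion (delta_mx j 0) w; rewrite KE => /matrixP/(_ i 0).
  by rewrite !mxE => ->; apply: eq_bigr => a _; rewrite mulrC.
have E2 i j k : d i j k = K (delta_mx i 0) j k + K (delta_mx i 0) k j.
  have /matrixP/(_ j k) := compat (delta_mx i 0).
  rewrite !mxE => ->; rewrite summxE (bigD1 i) //= !mxE !eqxx mul1r.
  by rewrite big1 ?addr0 // => a ai; rewrite !mxE (negbTE ai) mul0r.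
have E3 i j k : K (delta_mx i 0) j k = K (delta_mx k 0) j i.
  rewrite E1 (bigD1 i) //= !mxE !eqxx mul1r big1 ?addr0 // => a ai.
  by rewrite !mxE (negbTE ai) mul0r.
rewrite mulr_sumr (E1 v); apply: eq_bigr => a _.
rewrite !E2 (E3 l b a) (E3 a b l) (E3 a l b) (E3 l a b).
by field.
Qed.

Lemma koszul_compat (d : 'I_n -> 'M[R]_n) (v : 'cV[R]_n) :
  (forall a, (d a)^T = d a) ->
  let K := \matrix_(l, b) (2^-1 * \sum_a v a 0 *
    (d a l b + d b l a - d l a b)) in
  K + K^T = \sum_a v a 0 *: d a.
Proof.
move=> ds /=; apply/matrixP => l b; rewrite !mxE summxE -mulrDr -big_split /=.
rewrite mulr_sumr; apply: eq_bigr => a _.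
have s i j k : d i j k = d i k j by rewrite -[in LHS]ds mxE.
by rewrite mxE (s a b l) (s b l a) (s l b a); field.
Qed.

End ChristoffelUniqueness.

                                        

(** * Generation of the Clifford algebra by vectors, and reduction of words *)

Section Subalgebra.
Context {R : realType} {Cl : algType R}.
Variable S : Cl -> Prop.
Hypotheses (S1 : S 1) (S_lin : forall a u v, S u -> S v -> S (a *: u + v))
  (S_mul : forall u v, S u -> S v -> S (u * v)).

Definition subalg_pred : Cl -> bool := fun x => `[< S x >].

Lemma subalg_pred_closed : GRing.subalg_closed subalg_pred.
Proof.
split; first exact/asboolP.
- by move=> a u v /asboolP Su /asboolP Sv; apply/asboolP; exact: S_lin.
- by move=> u v /asboolP Su /asboolP Sv; apply/asboolP; exact: S_mul.
Qed.

HB.instance Definition _ := GRing.isSubalgClosed.Build R Cl subalg_pred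
  (GRing.subalg_closed_semi subalg_pred_closed).

Definition subalg : Type := {x : Cl | subalg_pred x}.

HB.instance Definition _ := SubType.on subalg.
HB.instance Definition _ := Choice.on subalg.
HB.instance Definition _ := [SubChoice_isSubAlgebra of subalg by <:].

                                                                                
                                    
(** By the universal property [iota], regarded as a map into the subalgebra [S], extends to a
    morphism from [Cl] to [S]. Followed by the inclusion it fixes [iota], hence is the identity by
    uniqueness. *)
Lemma clifford_ind (n : nat) (iota : {linear 'cV[R]_n -> Cl}) :
  is_clifford_algebra iota -> (forall v, S (iota v)) -> forall x, S x.
Proof.
move=> [sq univ] Siota x.
have Pi v : subalg_pred (iota v) by apply/asboolP.
pose f v : subalg := exist _ (iota v) (Pi v).
have lin_f : linear f.
  by move=> a u v; apply/val_inj; rewrite /= linearP.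
pose fM := GRing.isLinear.Build _ _ _ _ _ lin_f.
pose fL : {linear 'cV[R]_n -> subalg} := HB.pack f fM.
have fsq v : fL v * fL v = - (sqnorm v)%:A.
  by apply/val_inj; rewrite /= sq.
have [F Ff _] := univ subalg fL fsq.
(* [G] is only a common reference point: the composite through [S] and the identity both extend
   [iota], so both equal [G]. *)
have [G _ Guniq] := univ Cl iota sq.
pose F0 (y : Cl) : Cl := val (F y).
have lin_F0 : linear F0 by move=> a u v; rewrite /F0 !linearP.
have mul_F0 : GRing.monoid_morphism F0.
  by split=> [|u v]; rewrite /F0 ?rmorph1 // !rmorphM.
pose F' : {lrmorphism Cl -> Cl} := HB.pack F0
  (GRing.isLinear.Build _ _ _ _ _ lin_F0)
  (GRing.isMonoidMorphism.Build _ _ _ mul_F0).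
have E1 : F' =1 G.
  apply: Guniq => v; rewrite /= -[RHS]/(val (fL v)).
  by rewrite -(Ff v).
have E2 : idfun =1 G by apply: (Guniq idfun).
by have := valP (F x); rewrite -[val _]/(F' x) E1 -E2 => /asboolP.
Qed.

End Subalgebra.

Section Words.
Context {R : realType} {n : nat} {Cl : algType R}.
Variable iota : {linear 'cV[R]_n -> Cl}.
Hypothesis Cl_clifford : is_clifford_algebra iota.

Definition basis_word (s : seq 'I_n) : Cl := \prod_(i <- s) iota (delta_mx i 0).

Lemma basis_word_cat s t : basis_word (s ++ t) = basis_word s * basis_word t.
Proof. exact: big_cat. Qed.

Lemma basis_word_cons i t : basis_word (i :: t) = iota (delta_mx i 0) * basis_word t.
Proof. exact: big_cons. Qed.

Lemma sqnorm_delta (i : 'I_n) : sqnorm (delta_mx i 0 : 'cV[R]_n) = 1.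
Proof. by rewrite /sqnorm trmx_delta -rowE !mxE !eqxx. Qed.

Lemma iota_delta_sq i : iota (delta_mx i 0) * iota (delta_mx i 0) = - 1.
Proof. by rewrite (Cl_clifford.1) sqnorm_delta scale1r. Qed.

Lemma iota_anticomm (u v : 'cV[R]_n) : (u^T *m v) 0 0 = 0 ->
  iota u * iota v = - (iota v * iota u).
Proof.
move=> uv; have vu : (v^T *m u) 0 0 = 0.
  by rewrite -[v^T *m u]trmxK trmx_mul trmxK mxE.
have := Cl_clifford.1 (u + v).
have -> : sqnorm (u + v) = sqnorm u + sqnorm v.
  rewrite /sqnorm [(u + v)^T]linearD /= mulmxDl !mulmxDr.
  by rewrite ![(_ + _ : 'M[R]_1) _ _]mxE uv vu addr0 add0r.
rewrite linearD /= mulrDl !mulrDr !(Cl_clifford.1) scalerDl opprD.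
rewrite addrA [_ + _ - _]addrAC => E.
apply/eqP; rewrite -addr_eq0; apply/eqP.
apply: (addrI (- (sqnorm u)%:A - (sqnorm v)%:A)).
by rewrite addr0 -[RHS]E addrACA !addrA.
Qed.

(** Only vanishing of functionals on words matters below, so the sign is kept as an unspecified
    scalar. *)
Lemma iota_delta_comm i j : exists c : R,
  iota (delta_mx i 0) * iota (delta_mx j 0) =
  c *: (iota (delta_mx j 0) * iota (delta_mx i 0)).
Proof.
have [->|ij] := eqVneq i j; first by exists 1; rewrite scale1r.
exists (- 1); rewrite scaleN1r; apply: iota_anticomm.
by rewrite trmx_delta -rowE !mxE eqxx andbT (negbTE ij).
Qed.

Lemma iota_delta_word i s : exists c : R,
  iota (delta_mx i 0) * basis_word s = c *: (basis_word s * iota (delta_mx i 0)).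
Proof.
elim: s => [|j s [c ih]].
  by exists 1; rewrite /basis_word big_nil mul1r mulr1 scale1r.
have [d Ed] := iota_delta_comm i j; exists (d * c).
rewrite basis_word_cons mulrA Ed -scalerAl -[iota _ * _ * basis_word s]mulrA ih.
by rewrite -scalerAr scalerA mulrA.
Qed.

Lemma basis_word_repeat i s t u : exists c : R,
  basis_word (s ++ i :: t ++ i :: u) = c *: basis_word (s ++ t ++ u).
Proof.
have [c Ec] := iota_delta_word i t; exists (- c).
rewrite !basis_word_cat basis_word_cons basis_word_cat basis_word_cons.
rewrite [_ * (basis_word t * _)]mulrA Ec -!scalerAl mulrA.
rewrite -[_ * (iota _ * basis_word u)]mulrA [iota _ * (iota _ * _)]mulrA.
by rewrite iota_delta_sq mulN1r mulrN scalerN scaleNr mulrN -scalerAr mulrA.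
Qed.

Lemma non_uniq_split (T : eqType) (s : seq T) : ~~ uniq s ->
  exists i a b c, s = a ++ i :: b ++ i :: c.
Proof.
elim: s => [|x s ih] //=; have [xs _|xs /= /ih[i [a [b [c ->]]]]] := boolP (x \in s).
  by case/splitPr: xs => p1 p2; exists x, [::], p1, p2.
by exists i, (x :: a), b, c.
Qed.

(** By the pigeonhole principle some basis vector occurs twice; moving the two occurrences together
    costs a scalar, and their product is -1. *)
Lemma basis_word_long s : (n < size s)%N -> exists c : R, exists2 t,
  size s = (size t).+2 & basis_word s = c *: basis_word t.
Proof.
move=> ns; have /non_uniq_split[i [a [b [d E]]]] : ~~ uniq s.
  apply: contraL ns => /card_uniqP <-; rewrite -leqNgt.
  by rewrite -[X in (_ <= X)%N]card_ord max_card.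
have [c Ec] := basis_word_repeat i a b d; exists c, (a ++ b ++ d).
  by rewrite E !size_cat /= size_cat /= !addnS.
by rewrite E.
Qed.

Lemma basis_word_pad i s : basis_word s = - 1 *: basis_word [:: i, i & s].
Proof.
by rewrite !basis_word_cons mulrA iota_delta_sq mulN1r scalerN scaleN1r opprK.
Qed.

(** This is why the two degrees n and n-1 are enough: multiplying by e_i e_i = -1 raises the length
    of a short word by two until it is n or n-1, according to parity, while a word longer than n is
    shortened until its length is at most n. *)
Lemma basis_words_vanish (l : Cl -> R) : (0 < n)%N ->
  (forall (c : R) x, l (c *: x) = c * l x) ->
  (forall s, size s = n \/ size s = n.-1 -> l (basis_word s) = 0) ->
  forall s, l (basis_word s) = 0.
Proof.
move=> n0 lZ ln s.
(* [k] bounds the missing length and drops by two with each padding. *)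
have short k t : (n <= size t + k)%N -> (size t <= n)%N -> l (basis_word t) = 0.
  elim/ltn_ind: k t => k ih t nk tn.
  have [E|E] := eqVneq (size t) n; first by apply: ln; left.
  have [E'|E'] := eqVneq (size t) n.-1; first by apply: ln; right.
  rewrite (basis_word_pad (Ordinal n0)) lZ (ih (k - 2)%N) ?mulr0 //=; lia.
elim/ltn_ind: {s}(size s) {-2}s (erefl (size s)) => k ih s sk.
have [sn|ns] := leqP (size s) n; first by apply: (short n); rewrite ?leq_addl.
have [c [t st ->]] := basis_word_long ns.
by rewrite lZ (ih (size t)) ?mulr0 // -sk st.
Qed.

(** In place of an explicit spanning statement, let [V] be the set of y with l(y w) = 0 for all
    basis words w. The elements whose right multiplication preserves [V] form a subalgebra
    containing all vectors, hence everything by [clifford_ind]; since 1 lies in [V], so does every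
    x. *)
Lemma clifford_vanish (l : {linear Cl -> R^o}) : (0 < n)%N ->
  (forall s, size s = n \/ size s = n.-1 -> l (basis_word s) = 0) ->
  forall x, l x = 0.
Proof.
move=> n0 ln x.
have lZ (c : R) y : l (c *: y) = c * l y by rewrite linearZ.
have lw := basis_words_vanish n0 lZ ln.
pose V (y : Cl) := forall s, l (y * basis_word s) = 0.
pose S (y : Cl) := forall z, V z -> V (z * y).
have Sx : S x.
  apply: (@clifford_ind R Cl S _ _ _ n iota Cl_clifford).
  - by move=> z Vz; rewrite mulr1.
  - move=> a u v Su Sv z Vz s.
    by rewrite mulrDr -scalerAr mulrDl -scalerAl linearP (Su _ Vz) (Sv _ Vz)
      scaler0 addr0.
  - by move=> u v Su Sv z Vz; rewrite mulrA; apply: Sv; exact: Su.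
  - move=> v z Vz s; rewrite [v]col_sum_delta linear_sum mulr_sumr mulr_suml.
    rewrite linear_sum big1 // => i _.
    rewrite linearZ /= -scalerAr -scalerAl -mulrA -basis_word_cons linearZ /=.
    by rewrite Vz scaler0.
have V1 : V 1 by move=> s; rewrite mul1r.
by have := Sx _ V1 [::]; rewrite mul1r /basis_word big_nil mulr1.
Qed.

End Words.

(** * Orthogonal invariance of the sum of squared tensor components *)

Section TensorNorm.
Context {R : realType}.

(** A tensor power of an orthogonal matrix is orthogonal, so it preserves the Euclidean norm of the
    family of components. *)
Lemma orthogonal_sum_sq (n : nat) (I : finType) (B : 'M[R]_n)
    (T : {ffun I -> 'I_n} -> R) : B^T *m B = 1%:M ->
  \sum_(f : {ffun I -> 'I_n})
     (\sum_(e : {ffun I -> 'I_n}) (\prod_k B (e k) (f k)) * T e) ^+ 2 =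
  \sum_e T e ^+ 2.
Proof.
move=> /mulmx1C BB.
(* Orthonormality of the rows of the tensor power: the sum over all [f] factors into one row product
   of [B] for each slot. *)
have key (e e' : {ffun I -> 'I_n}) :
    \sum_(f : {ffun I -> 'I_n}) (\prod_k B (e k) (f k)) * (\prod_k B (e' k) (f k))
    = (e == e')%:R.
  under eq_bigr do rewrite -big_split /=.
  rewrite -(bigA_distr_bigA (fun k j => B (e k) j * B (e' k) j)).
  have E k : \sum_j B (e k) j * B (e' k) j = (e k == e' k)%:R.
    have /matrixP/(_ (e k) (e' k)) := BB; rewrite !mxE => <-.
    by apply: eq_bigr => j _; rewrite mxE.
  under eq_bigr do rewrite E.
  have [->|ee] := eqVneq e e'; first by rewrite big1 // => k _; rewrite eqxx.
  have [k ek] : exists k, e k != e' k.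
    apply/existsP; apply: contraNT ee; rewrite negb_exists => /forallP H.
    by apply/eqP/ffunP => k; apply/eqP; have := H k; rewrite negbK.
  by rewrite (bigD1 k) //= (negbTE ek) mul0r.
under eq_bigr do rewrite expr2 big_distrl /=.
rewrite exchange_big /=; apply: eq_bigr => e _.
under eq_bigr do rewrite big_distrr /=.
rewrite exchange_big /= (bigD1 e) //= [X in _ + X]big1 ?addr0.
  have := key e e; rewrite eqxx => /(congr1 (fun z => z * (T e * T e))).
  rewrite mul1r expr2 mulr_suml => <-.
  by apply: eq_bigr => f _; ring.
move=> e' ee'; transitivity ((e == e')%:R * (T e * T e')).
  by rewrite -key mulr_suml; apply: eq_bigr => f _; ring.
by rewrite eq_sym (negbTE ee') mul0r.
Qed.

(** Separates the differentiation slot 0 from the r Clifford slots in a sum over multi-indices. *)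
Lemma sum_ffun_recl (J : finType) (r : nat) (V : nmodType)
    (F : J -> {ffun 'I_r -> J} -> V) :
  \sum_(e : {ffun 'I_r.+1 -> J}) F (e ord0) [ffun k => e (lift ord0 k)] =
  \sum_j \sum_f F j f.
Proof.
rewrite pair_big /=.
pose cons (p : J * {ffun 'I_r -> J}) : {ffun 'I_r.+1 -> J} :=
  [ffun k => if unlift ord0 k is Some k' then p.2 k' else p.1].
have consK (e : {ffun 'I_r.+1 -> J}) : cons (e ord0, [ffun k => e (lift ord0 k)]) = e.
  apply/ffunP => k; rewrite ffunE; case: unliftP => [k' ->|->] //=.
  by rewrite ffunE.
rewrite (reindex cons) /=.
  apply: eq_bigr => -[j f] _ /=; rewrite ffunE unlift_none /=; congr (F _ _).
  by apply/ffunP => k; rewrite !ffunE liftK.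
exists (fun e : {ffun 'I_r.+1 -> J} => (e ord0, [ffun k => e (lift ord0 k)])).
  move=> [j f] _; rewrite ffunE unlift_none /=; congr (_, _).
  by apply/ffunP => k; rewrite !ffunE liftK.
by move=> e _; exact: consK.
Qed.

End TensorNorm.

                           

(** * Iterated integrals of continuous functions with bounded support *)

Section IteratedIntegral.
Context {R : realType}.

Definition supp_box (n : nat) (K : R) (f : 'cV[R]_n -> R) : Prop :=
  forall (y : 'cV[R]_n) i, K < `|y i 0| -> f y = 0.

Let mu := @lebesgue_measure R.

Lemma integrable_supp (K : R) (F : R -> R) : continuous F ->
  (forall x, K < `|x| -> F x = 0) -> mu.-integrable setT (EFin \o F).
Proof.
move=> cF F0.
have -> : EFin \o F = (EFin \o F) \_ `[- K, K].
  apply/funext => x; rewrite patchE; case: ifPn => //.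
  rewrite notin_setE /= in_itv /= => /negP.
  by rewrite -ler_norml -ltNge => /F0 /= ->.
have mK : measurable (`[- K, K]%classic : set (measurableTypeR R)).
  exact: measurable_itv.
apply: (integrable_mkcond _ mK).1.
apply: continuous_compact_integrable; first exact: segment_compact.
exact: continuous_subspaceT.
Qed.

Lemma Rintegral_supp (K : R) (F : R -> R) :
  (forall x, K < `|x| -> F x = 0) ->
  \int[mu]_(x in [set: R]) F x = \int[mu]_(x in `[- K, K]) F x.
Proof.
move=> F0; rewrite [RHS]Rintegral_mkcond; apply: eq_Rintegral => x _.
rewrite patchE; case: ifPn => //.
rewrite notin_setE /= in_itv /= => /negP.
by rewrite -ler_norml -ltNge => /F0.
Qed.

Lemma lebesgue_measure_cc (a b : R) : a <= b -> mu `[a, b] = (b - a)%:E.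
Proof.
move=> ab; have := lebesgue_measure_itv `[a, b]; rewrite /= lte_fin.
case: ifPn => [_|]; first by move=> H; rewrite EFinB; exact: H.
rewrite -leNgt => ba H; rewrite (_ : b - a = 0); first exact: H.
by apply/eqP; rewrite subr_eq0 eq_le ab ba.
Qed.

Lemma Rintegral_supp_le (K e : R) (F : R -> R) : 0 <= K -> continuous F ->
  (forall x, K < `|x| -> F x = 0) -> (forall x, `|F x| <= e) ->
  `|\int[mu]_(x in [set: R]) F x| <= 2 * K * e.
Proof.
move=> K0 cF F0 Fe; rewrite (Rintegral_supp F0).
have ciF (H : R -> R) : continuous H -> mu.-integrable `[- K, K] (EFin \o H).
  move=> cH; apply: continuous_compact_integrable; first exact: segment_compact.
  exact: continuous_subspaceT.
apply: le_trans (le_normr_Rintegral _ (ciF _ cF)) _ => //.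
apply: (@le_trans _ _ (\int[mu]_(x in `[- K, K]) e)).
  apply: le_Rintegral => //.
    by apply: ciF => x; apply: cvg_norm; exact: cF.
  by apply: ciF => x; exact: cvg_cst.
rewrite Rintegral_cst; last exact: measurable_itv.
have KK : - K <= K by lra.
rewrite (_ : fine _ = K - - K); last exact: (congr1 fine (lebesgue_measure_cc KK)).
by rewrite opprK mulrC (_ : K + K = 2 * K) //; ring.
Qed.

(** If F(x0) > 0, then F dominates the step function of height F(x0)/2 on a small interval around
    x0, whose integral is positive. *)
Lemma Rintegral_eq0 (K : R) (F : R -> R) : continuous F ->
  (forall x, K < `|x| -> F x = 0) -> (forall x, 0 <= F x) ->
  \int[mu]_(x in [set: R]) F x = 0 -> forall x, F x = 0.
Proof.
move=> cF F0 Fge0 I0 x0; apply/eqP; rewrite eq_le Fge0 andbT leNgt.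
apply/negP => Fx0.
have a0 : 0 < F x0 / 2 by rewrite divr_gt0.
have [d /= d0 xd] := (nbhs_ballP _ _).1 ((cvgrPdist_lt _ _).1 (cF x0) _ a0).
pose D := `[x0 - d / 2, x0 + d / 2]%classic.
pose S := (fun=> F x0 / 2 : R) \_ D.
have iS : mu.-integrable setT (EFin \o S).
  have mD : measurable (D : set (measurableTypeR R)) by exact: measurable_itv.
  rewrite (_ : EFin \o S = (EFin \o (fun=> F x0 / 2)) \_ D).
    2: by rewrite restrict_EFin.
  apply: (integrable_mkcond _ mD).1.
  apply: continuous_compact_integrable; first exact: segment_compact.
  by apply: continuous_subspaceT => x; exact: cvg_cst.
have : \int[mu]_(x in [set: R]) S x <= \int[mu]_(x in [set: R]) F x.
  apply: le_Rintegral => //; first exact: integrable_supp F0.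
  move=> x _; rewrite /S patchE; case: ifPn => [|_]; last exact: Fge0.
  rewrite inE /D /= in_itv /= => /andP[x1 x2].
  have /= := xd x; rewrite -ball_normE /ball_ /= => /(_ _) H.
  have {}H : `|F x0 - F x| < F x0 / 2.
    by apply: H; rewrite ltr_norml; apply/andP; split; lra.
  by move: H; rewrite ltr_norml => /andP[_]; lra.
rewrite I0 -Rintegral_mkcond Rintegral_cst //; last exact: measurable_itv.
have xx : x0 - d / 2 <= x0 + d / 2 by lra.
rewrite (_ : fine _ = (x0 + d / 2) - (x0 - d / 2)); last first.
  exact: (congr1 fine (lebesgue_measure_cc xx)).
apply/negP; rewrite -ltNge /= mulr_gt0 //; lra.
Qed.

Lemma box_compact (n : nat) (K : R) :
  compact [set y : 'cV[R]_n | forall i, `|y i 0| <= K].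
Proof.
have C : compact [set v : 'rV[R]_n | forall i, `[- K, K]%classic (v ord0 i)].
  by apply: (@rV_compact R n (fun=> `[- K, K]%classic)) => i; exact: segment_compact.
have -> : [set y : 'cV[R]_n | forall i, `|y i 0| <= K] =
    trmx @` [set v : 'rV[R]_n | forall i, `[- K, K]%classic (v ord0 i)].
  apply/seteqP; split => [y /= yK|_ /= [v vK <-] i].
    by exists y^T; rewrite ?trmxK // => i; rewrite mxE in_itv /= -ler_norml.
  by rewrite mxE; have := vK i; rewrite /= in_itv /= -ler_norml.
apply: continuous_compact C; apply: continuous_subspaceT => v.
exact: (@continuous_trmx R _ _ _ id).
Qed.

Definition consc (n : nat) (x : R) (y : 'cV[R]_n) : 'cV[R]_(1 + n) :=
  col_mx (x%:M : 'M[R]_1) y.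

Lemma consc_entry (n : nat) (x : R) (y : 'cV[R]_n) (i : 'I_(1 + n)) :
  consc x y i 0 = if fintype.split i is inr j then y j 0 else x.
Proof.
rewrite /consc mxE; case: splitP => j _ //.
by rewrite mxE ord1 eqxx mulr1n.
Qed.

Lemma consc_continuous (n : nat) :
  continuous (fun p : R * 'cV[R]_n => consc p.1 p.2).
Proof.
move=> p; apply/continuous_mxP => i j; rewrite ord1 {j}.
rewrite /prop_for /continuous_at consc_entry.
under eq_fun do rewrite consc_entry.
case: (fintype.split i) => [_|j]; first exact: cvg_fst.
apply: (@continuous_comp _ _ _ snd (fun y : 'cV[R]_n => y j 0)).
  exact: cvg_snd.
exact: matrix_normedtype.coord_continuous.
Qed.

Lemma consc_surj (n : nat) (y : 'cV[R]_(1 + n)) :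
  y = consc (y (lshift n 0) 0) (dsubmx y).
Proof.
rewrite -[LHS]vsubmxK /consc; congr col_mx.
by apply/matrixP => i j; rewrite !ord1 !mxE eqxx mulr1n.
Qed.

Lemma supp_box_consc n K (f : 'cV[R]_(1 + n) -> R) x : supp_box K f ->
  supp_box K (fun y => f (consc x y)).
Proof.
move=> sf y i yi; apply: (sf _ (rshift 1 i)).
by rewrite consc_entry (unsplitK (inr i)).
Qed.

Lemma consc_far n K (f : 'cV[R]_(1 + n) -> R) x y : supp_box K f ->
  K < `|x| -> f (consc x y) = 0.
Proof.
move=> sf xK; apply: (sf _ (lshift n 0)).
by rewrite consc_entry (unsplitK (inl _)).
Qed.

(** Compactness of the support box in the last n variables makes continuity in the first variable
    uniform in the others. *)
Lemma tube n K (f : 'cV[R]_(1 + n) -> R) x0 (e : R) : 0 < e -> continuous f ->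
  supp_box K f ->
  \forall x \near x0, forall y, `|f (consc x0 y) - f (consc x y)| <= e.
Proof.
move=> e0 cf sf; have e20 : 0 < e / 2 by rewrite divr_gt0.
have cG : continuous (fun p : R * 'cV[R]_n => f (consc p.1 p.2)).
  move=> p; apply: (@continuous_comp _ _ _
    (fun p : R * 'cV[R]_n => consc p.1 p.2) f).
    exact: consc_continuous.
  exact: cf.
have : \forall x \near x0, [set y : 'cV[R]_n | forall i, `|y i 0| <= K] `<=`
    (fun y => `|f (consc x0 y) - f (consc x y)| <= e).
  apply: ((compact_near_coveringP _).1 (@box_compact n K) R (nbhs x0)
    (fun x y => `|f (consc x0 y) - f (consc x y)| <= e)) => y _.
  have [[A B] /= [Ax By] AB] := (cvgrPdist_lt _ _).1 (cG (x0, y)) _ e20.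
  exists (B, A) => //= -[y' x] /= [By' Ax'].
  have H1 := AB (x, y') (conj Ax' By').
  have H2 := AB (x0, y') (conj (nbhs_singleton Ax) By').
  move: H1 H2; rewrite /= => H1 H2.
  rewrite -(subrKA (f (consc x0 y))) (splitr e) (le_trans (ler_normD _ _)) //.
  by rewrite lerD // ltW // distrC.
apply: filterS => x xK y.
have [yK|/existsNP[i /negP yi]] := pselect (forall i, `|y i 0| <= K).
  exact: xK.
rewrite -ltNge in yi.
by rewrite !(supp_box_consc _ sf yi) subrr normr0 ltW.
Qed.

(** The properties are bundled for a joint induction on dimension: to integrate over one more
    variable, the inner integral must be continuous in it, and this uses both linearity and the sup
    bound in the lower dimension. *)
Record iint_spec (n : nat) (K : R) : Prop := {
  iint_lin : forall (a : R) (f h : 'cV[R]_n -> R),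
    continuous f -> continuous h -> supp_box K f -> supp_box K h ->
    iterated_integral (fun y => a * f y + h y) =
    a * iterated_integral f + iterated_integral h;
  iint_le : forall (e : R) (f : 'cV[R]_n -> R), continuous f -> supp_box K f ->
    (forall y, `|f y| <= e) -> `|iterated_integral f| <= (2 * K) ^+ n * e;
  iint_ge0 : forall (f : 'cV[R]_n -> R), continuous f -> supp_box K f ->
    (forall y, 0 <= f y) -> 0 <= iterated_integral f;
  iint_eq0 : forall (f : 'cV[R]_n -> R), continuous f -> supp_box K f ->
    (forall y, 0 <= f y) -> iterated_integral f = 0 -> forall y, f y = 0
}.

Lemma iint_specP (n : nat) (K : R) : 0 <= K -> iint_spec n K.
Proof.
move=> K0; elim: n => [|n ih].
  split => //= [e f _ _ fe|f _ _ _ f0 y].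
  - by rewrite expr0 mul1r.
  - by rewrite -f0; congr (f _); apply/matrixP => -[].
have sl (f : 'cV[R]_(1 + n) -> R) x : continuous f ->
    continuous (fun y => f (consc x y)).
  move=> cf y; apply: (@continuous_comp _ _ _ (consc x) f); last exact: cf.
  apply/continuous_mxP => i j; rewrite ord1 /prop_for /continuous_at consc_entry.
  under eq_fun do rewrite consc_entry.
  case: (fintype.split i) => [_|k]; last exact: matrix_normedtype.coord_continuous.
  by apply: cvg_cst; exact: (nbhs_filter (y : 'cV[R]_n)).
pose I (f : 'cV[R]_(1 + n) -> R) x := iterated_integral (fun y => f (consc x y)).
have IE (f : 'cV[R]_(1 + n) -> R) :
    @iterated_integral R n.+1 f = \int[mu]_(x in [set: R]) I f x by [].
have I0 (f : 'cV[R]_(1 + n) -> R) : continuous f -> supp_box K f ->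
    forall x, K < `|x| -> I f x = 0.
  move=> cf sf x xK; apply/eqP; rewrite -normr_le0.
  have := iint_le ih (sl _ x cf) (supp_box_consc x sf) (_ : forall y, _ <= 0).
  by rewrite mulr0; apply => y; rewrite (consc_far _ sf) // normr0.
(* The difference of two inner integrals is the integral of a difference that [tube] makes uniformly
   small. The tolerance is divided by (2K)^n + 1 because (2K)^n may be 0. *)
have Ic (f : 'cV[R]_(1 + n) -> R) : continuous f -> supp_box K f ->
    continuous (I f).
  move=> cf sf x; apply/cvgrPdist_le => /= e e0.
  have C0 : 0 < (2 * K) ^+ n + 1 by rewrite ltr_wpDl // exprn_ge0 // mulr_ge0.
  have := tube x (divr_gt0 e0 C0) cf sf; apply: filterS => x' xx'.
  have -> : I f x - I f x' =
      iterated_integral (fun y => (- 1) * f (consc x' y) + f (consc x y)).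
    rewrite (iint_lin ih); [by rewrite mulN1r addrC|exact: sl|exact: sl|
      exact: supp_box_consc|exact: supp_box_consc].
  have cd : continuous (fun y => (- 1) * f (consc x' y) + f (consc x y)).
    move=> y; apply: (@cvgD _ _ _ (nbhs (y : 'cV[R]_n))); last exact: sl.
    apply: (@cvgM _ _ (nbhs (y : 'cV[R]_n))); last exact: sl.
    exact: (@cvg_cst _ _ _ (nbhs (y : 'cV[R]_n))).
  have sd : supp_box K (fun y => (- 1) * f (consc x' y) + f (consc x y)).
    move=> y i yi; rewrite (supp_box_consc x' sf yi) (supp_box_consc x sf yi).
    by rewrite mulr0 addr0.
  have := iint_le ih cd sd (_ : forall y, _ <= e / ((2 * K) ^+ n + 1)).
  have H y : `|(- 1) * f (consc x' y) + f (consc x y)| <=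
      e / ((2 * K) ^+ n + 1) by rewrite mulN1r addrC; exact: xx'.
  move=> /(_ H) /le_trans; apply.
  rewrite mulrCA ger_pMr // ler_pdivrMr // mul1r lerDl //.
have Ii f cf sf : mu.-integrable setT (EFin \o I f) :=
  integrable_supp (Ic f cf sf) (I0 f cf sf).
split.
- move=> a f h cf ch sf sh.
  rewrite !IE -RintegralZl //; last exact: Ii.
  rewrite -RintegralD //; last exact: Ii.
    apply: eq_Rintegral => x _.
    by rewrite [LHS](iint_lin ih) //; [exact: sl|exact: sl|
      exact: supp_box_consc|exact: supp_box_consc].
  have -> : EFin \o (fun x => a * I f x) = (fun x => a%:E * (EFin \o I f) x)%E.
    by apply/funext => x /=; rewrite EFinM.
  by apply: integrableZl => //; exact: Ii.
- move=> e f cf sf fe; rewrite IE exprS -mulrA.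
  apply: Rintegral_supp_le => //; [exact: Ic|exact: I0|].
  move=> x; apply: (iint_le ih); [exact: sl|exact: supp_box_consc|].
  by move=> y; exact: fe.
- move=> f cf sf f0; rewrite IE; apply: Rintegral_ge0 => x _.
  by apply: (iint_ge0 ih); [exact: sl|exact: supp_box_consc|move=> y; exact: f0].
- move=> f cf sf f0; rewrite IE => If0 y.
  have Ix := Rintegral_eq0 (Ic f cf sf) (I0 f cf sf) _ If0.
  have [a [z ->]] : exists a z, y = consc a z by do 2!eexists; exact: consc_surj.
  have Ia : I f a = 0.
    apply: Ix => x.
    by apply: (iint_ge0 ih); [exact: sl|exact: supp_box_consc|move=> w; exact: f0].
  exact: (iint_eq0 ih (f := fun w => f (consc a w)) (sl f a cf)
    (supp_box_consc a sf) (fun w => f0 _) Ia z).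
Qed.

End IteratedIntegral.

                                                 

(** * Lifting the dilations to the universal cover of GL^+ *)

Section Cover.
Context {R : realType} {n : nat} {G : topGroupType} {theta : G -> 'M[R]_n}.
Hypothesis theta_cover : universal_cover_GLplus theta.

Lemma thetaM a b : theta (a * b)%g = theta a *m theta b.
Proof. by case: theta_cover. Qed.

Lemma theta_GL a : 0 < \det (theta a).
Proof.
case: theta_cover => _ [_ rg _] _.
by have : range theta (theta a) by []; rewrite rg.
Qed.

Lemma theta_surj B : 0 < \det B -> exists a, theta a = B.
Proof.
case: theta_cover => _ [_ rg _] _ B0.
by have : (@GLplus R n) B by []; rewrite -rg => -[a _ <-]; exists a.
Qed.

Lemma theta_unit a : theta a \in unitmx.
Proof. by rewrite unitmxE unitfE gt_eqF // theta_GL. Qed.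

Lemma theta1 : theta 1%g = 1%:M.
Proof.
have := thetaM 1 1; rewrite mulg1 => /(congr1 (mulmx (invmx (theta 1%g)))).
by rewrite mulmxA mulVmx ?theta_unit // mul1mx.
Qed.

Lemma thetaV a : theta a^-1%g = invmx (theta a).
Proof.
have := thetaM a^-1 a; rewrite mulVg theta1 => /(congr1 (mulmx^~ (invmx (theta a)))).
by rewrite mul1mx -mulmxA mulmxV ?theta_unit // mulmx1 => <-.
Qed.

Lemma theta_section (a : G) : exists (V : set 'M[R]_n) (s : 'M[R]_n -> G),
  [/\ open V, V (theta a), s (theta a) = a,
      forall B, V B -> {for B, continuous s} /\ theta (s B) = B &
      \forall b \near a, s (theta b) = b].
Proof.
case: theta_cover => _ [tc _ ev] _.
have [V [oV Va VGL [I [s [sc ts so sk]]]]] := ev _ (theta_GL a).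
have [k [Ek _]] := sk a Va.
exists V, (s k); split => //; first by move=> B VB; split; [exact: sc|exact: ts].
have : \forall b \near a, (s k @` V) b.
  by apply: open_nbhs_nbhs; split; [exact: so|exists (theta a)].
by apply: filterS => b [B VB <-]; rewrite ts.
Qed.

Lemma mulg_continuous2 (T : topologicalType) (f h : T -> G) (x : T) :
  {for x, continuous f} -> {for x, continuous h} ->
  {for x, continuous (fun y => (f y * h y)%g)}.
Proof.
move=> cf ch; apply: (@continuous_comp _ _ _ (fun y => (f y, h y))
  (fun p : G * G => (p.1 * p.2)%g)); last exact: mulg_continuous.
exact: cvg_pair.
Qed.

Lemma expg_continuous (T : topologicalType) (f : T -> G) (x : T) k :
  {for x, continuous f} -> {for x, continuous (fun y => (f y ^+ k)%g)}.
Proof.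
move=> cf; elim: k => [|k ih]; rewrite /prop_for /continuous_at.
  by under eq_fun do rewrite expg0; exact: cvg_cst.
by under eq_fun do rewrite expgS; rewrite expgS; exact: mulg_continuous2 cf ih.
Qed.

                                                                           
                                                                        
(** The scalar matrices e^t are lifted by the sheet through 1. Two elements near 1 with the same
    image under [theta] coincide, which gives both the addition law and commutation with a given
    [a]; the interval for the latter depends on [a]. *)
Lemma dilation_local : exists (e : R) (f : R -> G), 0 < e /\
  [/\ f 0 = 1%g, forall t, `|t| < e -> {for t, continuous f},
      forall t, `|t| < e -> theta (f t) = (expR t)%:M,
      forall t u, `|t| < e -> `|u| < e -> f (t + u) = (f t * f u)%g &
      forall a, \forall t \near (0 : R), (f t * a = a * f t)%g].
Proof.
have [V [s [oV V1 s1 sV sn]]] := theta_section 1%g.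
rewrite theta1 in V1 s1.
pose f (t : R) := s (expR t)%:M.
have cE : continuous (fun t : R => (expR t)%:M : 'M[R]_n).
  move=> t; apply/continuous_mxP => i j; rewrite /prop_for /continuous_at mxE.
  under eq_fun do rewrite mxE.
  case: (i == j); last by rewrite !mulr0n; under eq_fun do rewrite mulr0n; exact: cvg_cst.
  by rewrite mulr1n; under eq_fun do rewrite mulr1n; exact: continuous_expR.
have E0 : (expR 0)%:M = 1%:M :> 'M[R]_n by rewrite expR0.
have f0 : f 0 = 1%g by rewrite /f E0.
have nV : \forall t \near (0 : R), V (expR t)%:M.
  apply: cE; rewrite E0; exact: open_nbhs_nbhs.
have fV t : V (expR t)%:M -> {for t, continuous f} /\ theta (f t) = (expR t)%:M.
  move=> Vt; have [sc st] := sV _ Vt; split => //.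
  by apply: (@continuous_comp _ _ _ (fun t : R => (expR t)%:M : 'M[R]_n)); [exact: cE|].
have fc0 : {for 0, continuous f} by have [] := fV 0 (nbhs_singleton nV).
have fuv : \forall p \near ((0, 0) : R * R), s (theta (f p.1 * f p.2)%g) = (f p.1 * f p.2)%g.
  have c : {for (0, 0), continuous (fun p : R * R => (f p.1 * f p.2)%g)}.
    apply: mulg_continuous2.
      by apply: (@continuous_comp _ _ _ fst f); [exact: cvg_fst|].
    by apply: (@continuous_comp _ _ _ snd f); [exact: cvg_snd|].
  have c' : (fun p : R * R => (f p.1 * f p.2)%g) @ ((0, 0) : R * R) --> (1%g : G).
    by move: c; rewrite /prop_for /continuous_at /= f0 mulg1.
  exact: c' _ sn.
have [d /= d0 dV] := (nbhs_ballP _ _).1 nV.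
have [[A B] /= [A0 B0] AB] := fuv.
have [d' /= d'0 dA] := (nbhs_ballP _ _).1 (filterI A0 B0).
have absb (t e : R) : `|t| < e -> ball (0 : R) e t.
  by rewrite -ball_normE /ball_ /= sub0r normrN.
exists (Num.min d d'), f; split; first by rewrite lt_min d0 d'0.
split => //.
- by move=> t; rewrite lt_min => /andP[td _]; have [] := fV t (dV _ (absb _ _ td)).
- by move=> t; rewrite lt_min => /andP[td _]; have [] := fV t (dV _ (absb _ _ td)).
- move=> t u; rewrite !lt_min => /andP[td td'] /andP[ud ud'].
  have [At _] := dA _ (absb _ _ td'); have [_ Bu] := dA _ (absb _ _ ud').
  have := AB (t, u) (conj At Bu) => /= <-.
  rewrite thetaM (fV t (dV _ (absb _ _ td))).2 (fV u (dV _ (absb _ _ ud))).2.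
  by rewrite -scalar_mxM -expRD.
move=> a.
have c : {for 0, continuous (fun t => (a^-1 * (f t * a))%g)}.
  apply: mulg_continuous2; first exact: cvg_cst.
  by apply: mulg_continuous2 => //; exact: cvg_cst.
(* The conjugate of [f t] lies over the same scalar matrix and is close to 1, so it must be [f t]
   itself. *)
have n1 : \forall t \near (0 : R), s (theta (a^-1 * (f t * a))%g) = (a^-1 * (f t * a))%g.
  have c' : (fun t => (a^-1 * (f t * a))%g) @ (0 : R) --> (1%g : G).
    by move: c; rewrite /prop_for /continuous_at /= f0 mul1g mulVg.
  exact: c' _ sn.
apply: filterS2 n1 nV => t st /fV[_ ft].
move: st; rewrite !thetaM ft thetaV mul_scalar_mx -scalemxAr mulVmx ?theta_unit //.
rewrite scalemx1 -/(f t) => E.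
by rewrite [in RHS]E !mulgA mulgV mul1g.
Qed.

(** The local lift is extended by z(t) = f(t/m)^m with m large. Passing to the common refinement of
    two subdivisions shows that the value does not depend on m, and continuity and centrality are
    then inherited from small parameters. *)
Lemma dilation_lift : exists z : R -> G,
  [/\ z 0 = 1%g, continuous z, forall t, theta (z t) = (expR t)%:M &
      forall t a, (z t * a = a * z t)%g].
Proof.
have [e [f [e0 [f0 fc ft fD fa]]]] := dilation_local.
have fX (m : nat) t : (0 < m)%N -> `|t| < e -> f t = (f (t / m%:R)%R ^+ m)%g.
  move=> m0 te.
  have m0' : 0 < m%:R :> R by rewrite ltr0n.
  have key k : (k <= m)%N -> f (k%:R * (t / m%:R)) = (f (t / m%:R)%R ^+ k)%g.
    elim: k => [|k ih] km; first by rewrite mul0r f0.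
    rewrite -addn1 natrD mulrDl mul1r addn1 expgSr -ih ?(ltnW km) //.
    apply: fD.
      rewrite normrM (le_lt_trans _ te) // normrM normfV.
      rewrite [`|k%:R|]ger0_norm // [`|m%:R|]ger0_norm ?(ltW m0') //.
      rewrite mulrCA ler_piMr // ler_pdivrMr // mul1r ler_nat ltnW //.
    rewrite normrM normfV [`|m%:R|]ger0_norm ?(ltW m0') //.
    rewrite ltr_pdivrMr // (lt_le_trans te) // ler_peMr ?(ltW e0) //.
    by rewrite ler1n.
  by rewrite -key // mulrC divfK // gt_eqF.
(* One more than the integer part of |t|/e, so that |t/m| < e strictly. *)
pose m (t : R) := (Num.truncn (`|t| / e)).+1.
pose z t := (f (t / (m t)%:R)%R ^+ m t)%g.
have small (k : nat) t : (m t <= k)%N -> `|t / k%:R| < e.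
  move=> mk; have k0 : (0 < k)%N by exact: leq_trans mk.
  rewrite normrM normfV [`|k%:R|]ger0_norm // ltr_pdivrMr ?ltr0n //.
  rewrite mulrC -ltr_pdivrMr //; apply: lt_le_trans (_ : (m t)%:R <= _).
    by rewrite /m truncnS_gt.
  by rewrite ler_nat.
have zE (k : nat) t : (0 < k)%N -> `|t / k%:R| < e -> z t = (f (t / k%:R)%R ^+ k)%g.
  move=> k0 tk; rewrite /z.
  have mt : `|t / (m t)%:R| < e by exact: small.
  rewrite (fX k _ k0 mt) (fX (m t) _ _ tk) // -!expgnA mulnC.
  by rewrite -!mulrA -!invfM -!natrM [X in (_ / X%:R)]mulnC.
exists z; split.
- by rewrite (zE 1%N) ?mul0r ?normr0 // f0 expg1n.
- move=> t; pose k := (m t).+1.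
  have tk : `|t / k%:R| < e by apply: small; rewrite /k.
  have nk : \forall u \near t, `|u / k%:R| < e.
    have c : {for t, continuous (fun u : R => `|u / k%:R|)}.
      by apply: cvg_norm; apply: cvgM; [exact: cvg_id|exact: cvg_cst].
    exact: (cvgr_lt _ c _ tk).
  suff : {for t, continuous z} by [].
  apply: (@near_continuous R G (fun u => (f (u / k%:R)%R ^+ k)%g) z t).
    by apply: filterS nk => u uk; rewrite (zE k).
  have cf : {for t, continuous (fun u : R => f (u / k%:R))}.
    apply: (@continuous_comp _ _ _ (fun u : R => u / k%:R) f); last exact: fc.
    by apply: cvgM; [exact: cvg_id|exact: cvg_cst].
  exact: (@expg_continuous R (fun u : R => f (u / k%:R)) t k cf).
- move=> t; have mt : `|t / (m t)%:R| < e by exact: small.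
  have E l : theta (f (t / (m t)%:R)%R ^+ l)%g = (expR ((t / (m t)%:R) *+ l))%:M.
    elim: l => [|l ih]; first by rewrite expg0 mulr0n expR0 theta1.
    by rewrite expgS thetaM ih ft // -scalar_mxM -expRD -mulrS.
  by rewrite /z E -mulr_natr divfK // pnatr_eq0.
- move=> t a.
  have [d /= d0 da] := (nbhs_ballP _ _).1 (fa a).
  (* A finer subdivision than [m t]: t/k must also fall in the interval of radius [d] on which [f]
     commutes with this [a]. *)
  pose k := (maxn (m t) (Num.truncn (`|t| / d)).+1).
  have k0 : (0 < k)%N by rewrite /k leq_max.
  have tk : `|t / k%:R| < e by apply: small; rewrite /k leq_maxl.
  have tk' : `|t / k%:R| < d.
    rewrite normrM normfV [`|k%:R|]ger0_norm // ltr_pdivrMr ?ltr0n //.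
    rewrite mulrC -ltr_pdivrMr //; apply: lt_le_trans (_ : (Num.truncn (`|t| / d)).+1%:R <= _).
      by rewrite truncnS_gt.
    by rewrite ler_nat /k leq_maxr.
  rewrite (zE k) //.
  have := da (t / k%:R); rewrite -ball_normE /ball_ /= sub0r normrN => /(_ tk').
  move: (f _) => b ba; elim: (k) => [|l ih]; first by rewrite expg0 mul1g mulg1.
  by rewrite expgS -mulgA ih mulgA ba mulgA.
Qed.

End Cover.

                                       

(** * Chain rule for directional derivatives *)

Section DirectionalChainRule.
Context {R : realType}.

Lemma is_derive_lineP (V W : normedModType R) (f : V -> W) (x v : V) (df : W) :
  is_derive x v f df <-> is_derive (0 : R) 1 (fun s => f (x + s *: v)) df.
Proof.
split=> [fd|]; first by apply: is_derive_line; rewrite scale0r addr0.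
have E : (fun h : R => h^-1 *: (((fun s => f (x + s *: v)) \o shift 0) (h *: 1)
     - f (x + 0 *: v))) =
   (fun h => h^-1 *: ((f \o shift x) (h *: v) - f x)).
  apply/funext => h /=.
  by rewrite [h *: 1]mulr1 addr0 scale0r addr0 addrC [_ + x]addrC addrC.
by case; rewrite /derivable /derive E => fd dE; apply: DeriveDef.
Qed.

Lemma C1_is_derive_chain (V : normedModType R) m p q (A : set 'cV[R]_m)
    (f : 'cV[R]_m -> 'M[R]_(p, q)) (h : V -> 'cV[R]_m) (x v : V) (w : 'cV[R]_m) :
  open A -> A (h x) -> Ck 1 A f -> is_derive x v h w ->
  is_derive x v (f \o h) ('D_w f (h x)).
Proof.
move=> oA Ax Cf /is_derive_lineP hd; apply/is_derive_lineP.
have := @C1_is_derive_comp R _ _ _ A f (fun s => h (x + s *: v)) 0 w oA.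
by rewrite scale0r addr0; apply.
Qed.

Lemma is_derive_affine (V : normedModType R) (x v : V) :
  is_derive (0 : R) 1 (fun t => x + t *: v) v.
Proof.
exact: ((is_derive_lineP id x v v).1 (is_derive_id x v)).
Qed.

End DirectionalChainRule.

(** * Transformation law of Christoffel symbols: the algebra *)

Section ChristoffelAlgebra.
Context {R : realType} {n : nat}.

Lemma koszul_torsion (d : 'I_n -> 'M[R]_n) (u v : 'cV[R]_n) :
  (forall a, (d a)^T = d a) ->
  let K w := \matrix_(l, b) (2^-1 * \sum_a (w : 'cV[R]_n) a 0 *
    (d a l b + d b l a - d l a b)) in
  K v *m u = K u *m v.
Proof.
move=> ds /=; apply/matrixP => l k; rewrite ord1 !mxE.
under eq_bigr do rewrite mxE mulr_sumr mulr_suml.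
under [in RHS]eq_bigr do rewrite mxE mulr_sumr mulr_suml.
rewrite exchange_big /=; apply: eq_bigr => a _; apply: eq_bigr => b _.
have -> : d l a b = d l b a by rewrite -[in LHS]ds mxE.
by ring.
Qed.

Lemma koszul_linear (d : 'I_n -> 'M[R]_n) (c : R) (u v : 'cV[R]_n) :
  let K w := \matrix_(l, b) (2^-1 * \sum_a (w : 'cV[R]_n) a 0 *
    (d a l b + d b l a - d l a b)) in
  K (c *: u + v) = c *: K u + K v.
Proof.
apply/matrixP => l b; rewrite !mxE mulrCA -mulrDr; congr (_ * _).
rewrite mulr_sumr -big_split /=; apply: eq_bigr => a _.
by rewrite !mxE; ring.
Qed.

Lemma koszul_continuous (T : topologicalType) (d : 'I_n -> T -> 'M[R]_n)
    (y : T -> 'cV[R]_n) x : (forall a, {for x, continuous (d a)}) ->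
  {for x, continuous y} ->
  {for x, continuous (fun t => \matrix_(l, b) (2^-1 * \sum_a y t a 0 *
    (d a t l b + d b t l a - d l t a b)))}.
Proof.
move=> cd cy; apply/continuous_mxP => l b; rewrite /prop_for /continuous_at mxE.
under eq_fun do rewrite mxE.
apply: cvgM; first exact: cvg_cst.
apply: cvg_sum => a; apply: cvgM; first exact: ((continuous_mxP _ _).1 cy).
apply: cvgB; last exact: ((continuous_mxP _ _).1 (cd l)).
by apply: cvgD; [exact: ((continuous_mxP _ _).1 (cd a))|
  exact: ((continuous_mxP _ _).1 (cd b))].
Qed.

                                                                           
                                                                    
(** The connection of chart j pulled back to chart i, with index lowered, is the matrix [K] of the
    proof. It is torsion-free and compatible with [gi], so [koszul_unique] identifies it with the
    Christoffel matrix of chart i; no expansion in indices is required. *)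
Lemma koszul_transform (gi gj J : 'M[R]_n) (Ci Cj dJ Dgi Dgj : 'cV[R]_n -> 'M[R]_n)
    (dgi : 'I_n -> 'M[R]_n) :
  gi = J^T *m gj *m J -> gj^T = gj -> J \in unitmx -> gj \in unitmx ->
  (forall v u, Cj v *m u = Cj u *m v) -> (forall v u, dJ v *m u = dJ u *m v) ->
  (forall v, gj *m Cj v + (Cj v)^T *m gj = Dgj v) ->
  (forall w, Dgi w = (dJ w)^T *m gj *m J + J^T *m Dgj (J *m w) *m J +
     J^T *m gj *m dJ w) ->
  (forall w, Dgi w = \sum_a w a 0 *: dgi a) ->
  (forall v, gi *m Ci v = \matrix_(l, b) (2^-1 * \sum_a v a 0 *
    (dgi a l b + dgi b l a - dgi l a b))) ->
  forall v, Cj (J *m v) *m J = J *m Ci v - dJ v.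
Proof.
move=> giE gT uJ ug tors tJ compat dg dgs CiE v.
pose K w := J^T *m gj *m (Cj (J *m w) *m J + dJ w).
have torsion u w : K w *m u = K u *m w.
  rewrite /K -!mulmxA; congr (_ *m (_ *m _)); rewrite !mulmxDl -!mulmxA.
  by rewrite tors tJ.
have compat' w : K w + (K w)^T = \sum_a w a 0 *: dgi a.
  rewrite -dgs dg -(compat (J *m w)) /K.
  move: (Cj (J *m w)) (dJ w) => C D.
  rewrite !trmx_mul gT trmxK [(C *m J + D)^T]linearD /= trmx_mul.
  rewrite !mulmxDr !mulmxDl !mulmxA.
  move: (J^T *m gj *m C *m J) (J^T *m gj *m D) (J^T *m C^T *m gj *m J)
    (D^T *m gj *m J) => a b c d.
  by rewrite addrACA [b + d]addrC addrA [a + c + d]addrC.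
have KE w : K w = gi *m Ci w by rewrite CiE; exact: koszul_unique.
apply/eqP; rewrite eq_sym subr_eq eq_sym; apply/eqP.
have := KE v; rewrite /K giE -[in RHS]mulmxA.
move=> /(congr1 (mulmx (invmx (J^T *m gj)))).
have u2 : J^T *m gj \in unitmx by rewrite unitmx_mul unitmx_tr uJ.
by rewrite !mulKmx.
Qed.

End ChristoffelAlgebra.

(** * Coordinate changes, metrics and Christoffel symbols on the manifold *)

Section Charts.
Context {R : realType} {n : nat} {M : topologicalType}.
Variable A : oriented_atlas R n M.
Implicit Types i j : A.

Lemma cod_dom i y : cod i y -> dom i (param i y).
Proof. by case=> x xi <-; rewrite coordK. Qed.

Lemma paramK i y : cod i y -> coord i (param i y) = y.
Proof. by case=> x xi <-; rewrite coordK. Qed.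

Lemma dom_cod i x : dom i x -> cod i (coord i x).
Proof. by move=> xi; exists x. Qed.

Definition overlap i j : set 'cV[R]_n := coord i @` (dom i `&` dom j).

Lemma overlapP i j y : overlap i j y <-> cod i y /\ dom j (param i y).
Proof.
split=> [[x [xi xj] <-]|[yi yj]]; first by rewrite coordK //; split => //; exists x.
by exists (param i y); [split => //; exact: cod_dom|exact: paramK].
Qed.

Lemma near_cod i y : cod i y -> \forall z \near y, cod i z.
Proof. by move=> yi; apply: open_nbhs_nbhs; split => //; exact: cod_open. Qed.

Lemma overlap_open i j : open (overlap i j).
Proof.
rewrite openE => y /overlapP[yi yj].
have pc := param_continuous yi.
have nj : \forall z \near y, dom j (param i z).
  by apply: pc; apply: open_nbhs_nbhs; split => //; exact: dom_open.
by apply: filterS2 (near_cod yi) nj => z zi zj; apply/overlapP.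
Qed.

Lemma overlap_coord i j x : dom i x -> dom j x -> overlap i j (coord i x).
Proof. by move=> xi xj; exists x. Qed.

Definition transition i j : 'cV[R]_n -> 'cV[R]_n := coord j \o param i.

Lemma transition_Ck i j k : Ck k (overlap i j) (transition i j).
Proof. exact: change_smooth. Qed.

Lemma transition_derive i j y v : overlap i j y ->
  'D_v (transition i j) y = Jacobian (transition i j) y *m v.
Proof.
move=> yij.
rewrite (C1_derive_sum v (@overlap_open i j) yij (@transition_Ck i j 1)).
apply/matrixP => k l; rewrite ord1 !mxE summxE; apply: eq_bigr => a _.
by rewrite !mxE mulrC.
Qed.

Lemma Jacobian_Ck i j k : Ck k (overlap i j) (Jacobian (transition i j)).
Proof.
apply/Ck_mxP; first exact: overlap_open.
move=> a b; rewrite /Jacobian; under eq_fun do rewrite mxE.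
apply: (Ck_mxP _ _ (@overlap_open i j)).1.
exact: Ck_derive (@transition_Ck i j k.+1).
Qed.

Lemma Jacobian_unit i j y : overlap i j y ->
  Jacobian (transition i j) y \in unitmx.
Proof.
move=> [x [xi xj] <-]; rewrite unitmxE unitfE gt_eqF //.
exact: change_oriented.
Qed.

(** Equality of mixed second derivatives of the transition map; this is what makes the pulled-back
    connection torsion-free. *)
Lemma Jacobian_derive_sym i j y u v : overlap i j y ->
  'D_v (Jacobian (transition i j)) y *m u =
  'D_u (Jacobian (transition i j)) y *m v.
Proof.
move=> yij; have oO := @overlap_open i j.
have C1J : Ck 1 (overlap i j) (Jacobian (transition i j)) by exact: Jacobian_Ck.
have entry w k a : 'D_w (Jacobian (transition i j)) y k a =
    'D_w ('D_(delta_mx a 0) (fun z => transition i j z k 0)) y.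
  have := (is_derive_mxP _ _ _ _).1 (Ck_is_derive w C1J yij) k a.
  case=> _ <-; apply: near_eq_derive; apply: (near_open oO yij) => z zij.
  rewrite mxE.
  have := (is_derive_mxP _ _ _ _).1
    (Ck_is_derive (delta_mx a 0) (@transition_Ck i j 1) zij) k 0.
  by case=> _ <-.
have Ck2 k : Ck 2 (overlap i j) (fun z => transition i j z k 0).
  exact: ((Ck_mxP _ _ oO).1 (@transition_Ck i j 2)).
have C1d k a : Ck 1 (overlap i j) ('D_(delta_mx a 0) (fun z => transition i j z k 0)).
  exact: Ck_derive (Ck2 k).
apply/matrixP => k l; rewrite ord1 !mxE.
have expand w w' : \sum_a 'D_w (Jacobian (transition i j)) y k a * w' a 0 =
   \sum_a \sum_b w b 0 * 'D_(delta_mx b 0) ('D_(delta_mx a 0)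
      (fun z => transition i j z k 0)) y * w' a 0.
  apply: eq_bigr => a _; rewrite entry.
  by rewrite ((C1_differentiable oO yij (C1d k a)).2 w) mulr_suml.
rewrite !expand exchange_big /=; apply: eq_bigr => a _; apply: eq_bigr => b _.
rewrite (schwarz (delta_mx b 0) (delta_mx a 0) oO yij (Ck2 k)).
by move: ('D_(delta_mx b 0) _ y) => D; ring.
Qed.

Section Metric.
Variable g : bilinear_field A.
Hypothesis g_riem : riemannian_metric g.

Lemma metric_posdef i x : dom i x -> posdef (g i x).
Proof.
case: g_riem => gs gp _ _ xi; split; first exact: gs.
by move=> v; exact: gp.
Qed.

Lemma metric_sym i x : dom i x -> (g i x)^T = g i x.
Proof. by case: g_riem => gs _ _ _; exact: gs. Qed.

Lemma metric_unit i x : dom i x -> g i x \in unitmx.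
Proof.
by move=> xi; rewrite unitmxE unitfE gt_eqF // posdef_det_gt0 //; exact: metric_posdef.
Qed.

Lemma metric_Ck i k : Ck k (cod i) (g i \o param i).
Proof. by case: g_riem => _ _ _; exact. Qed.

Lemma metric_change i j x : dom i x -> dom j x ->
  g i x = (change i j x)^T *m g j x *m change i j x.
Proof. by case: g_riem => _ _ gc _; exact: gc. Qed.

Definition metric_derive i x (v : 'cV[R]_n) : 'M[R]_n :=
  'D_v (g i \o param i) (coord i x).

Lemma metric_is_derive i x v : dom i x ->
  is_derive (coord i x) v (g i \o param i) (metric_derive i x v).
Proof.
by move=> xi; exact: Ck_is_derive (@metric_Ck i 1) (dom_cod xi).
Qed.

Lemma metric_derive_sym i x v : dom i x ->
  (metric_derive i x v)^T = metric_derive i x v.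
Proof.
move=> xi; have d := is_derive_trmx (metric_is_derive v xi).
have {d} [_ <-] := d; apply: near_eq_derive.
apply: (near_open (@cod_open _ _ _ A i) (dom_cod xi)) => y yi.
by rewrite /= metric_sym //; exact: cod_dom.
Qed.

Lemma metric_derive_sum i x v : dom i x ->
  metric_derive i x v = \sum_a v a 0 *: metric_derive i x (delta_mx a 0).
Proof.
move=> xi; apply: (C1_derive_sum v (@cod_open _ _ _ A i) (dom_cod xi)).
exact: metric_Ck.
Qed.

Definition koszul i x (v : 'cV[R]_n) : 'M[R]_n := g i x *m christoffel g i x v.

Lemma koszulE i x v : dom i x -> koszul i x v =
  \matrix_(l, b) (2^-1 * \sum_a v a 0 * (metric_derive i x (delta_mx a 0) l b +
    metric_derive i x (delta_mx b 0) l a - metric_derive i x (delta_mx l 0) a b)).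
Proof.
by move=> xi; rewrite /koszul /christoffel mulmxA mulmxV ?mul1mx ?metric_unit.
Qed.

Lemma christoffel_compat i x v : dom i x ->
  g i x *m christoffel g i x v + (christoffel g i x v)^T *m g i x =
  metric_derive i x v.
Proof.
move=> xi; rewrite -{2}(metric_sym xi) -trmx_mul -/(koszul i x v) koszulE //.
rewrite metric_derive_sum // (koszul_compat (d := fun a => metric_derive i x (delta_mx a 0))) //.
by move=> a; exact: metric_derive_sym.
Qed.

Lemma christoffel_torsion i x u v : dom i x ->
  christoffel g i x v *m u = christoffel g i x u *m v.
Proof.
move=> xi.
have tor : koszul i x v *m u = koszul i x u *m v.
  rewrite !koszulE //.
  apply: (koszul_torsion (d := fun a => metric_derive i x (delta_mx a 0))).
  by move=> a; exact: metric_derive_sym.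
move: tor; rewrite /koszul; move: (christoffel g i x u) (christoffel g i x v).
move=> a b /(congr1 (mulmx (invmx (g i x)))).
by rewrite !mulmxA mulVmx ?metric_unit // !mul1mx.
Qed.

Lemma christoffel_change i j x v : dom i x -> dom j x ->
  christoffel g j x (change i j x *m v) *m change i j x =
  change i j x *m christoffel g i x v -
  'D_v (Jacobian (transition i j)) (coord i x).
Proof.
move=> xi xj; have yij : overlap i j (coord i x) by exact: overlap_coord.
have oO := @overlap_open i j.
pose J := change i j x.
pose dJ w := 'D_w (Jacobian (transition i j)) (coord i x).
have transE : transition i j (coord i x) = coord j x.
  by rewrite /transition /= coordK.
(* Differentiation of g_i = J^T g_j J along [w], with g_j evaluated after the transition map. *)
have dg w : metric_derive i x w = (dJ w)^T *m g j x *m J +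
    J^T *m metric_derive j x (J *m w) *m J + J^T *m g j x *m dJ w.
  have dJw : is_derive (coord i x) w (Jacobian (transition i j)) (dJ w).
    exact: Ck_is_derive (@Jacobian_Ck i j 1) yij.
  have dt : is_derive (coord i x) w (transition i j) (J *m w).
    have := Ck_is_derive w (@transition_Ck i j 1) yij.
    by rewrite transition_derive.
  have dgj : is_derive (coord i x) w ((g j \o param j) \o transition i j)
      (metric_derive j x (J *m w)).
    rewrite /metric_derive -transE.
    apply: (@C1_is_derive_chain R _ n n n (cod j) (g j \o param j)) => //;
      first exact: cod_open.
      by rewrite transE; exact: dom_cod.
    exact: metric_Ck.
  have := is_derive_mulmx (is_derive_mulmx (is_derive_trmx dJw) dgj) dJw.
  rewrite /= coordK // coordK // -/J => dd.
  have [_ <-] := metric_is_derive w xi; rewrite mulmxDl in dd.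
  have [_ <-] := dd; apply: near_eq_derive.
  apply: (near_open oO yij) => y /overlapP[yi yj].
  rewrite /= (metric_change (cod_dom yi) yj) /change paramK //.
  by rewrite /transition /= coordK.
apply: (koszul_transform (dgi := fun a => metric_derive i x (delta_mx a 0))
  (dJ := dJ) (metric_change xi xj) (metric_sym xj) (Jacobian_unit yij)
  (metric_unit xj) _ _ _ dg).
- by move=> u w; exact: christoffel_torsion.
- by move=> u w; exact: Jacobian_derive_sym.
- by move=> w; exact: christoffel_compat.
- by move=> w; exact: metric_derive_sum.
- by move=> w; rewrite -/(koszul i x w) koszulE.
Qed.

End Metric.
End Charts.

                           

(** * Local coordinates on the spin bundle and on its orthonormal reduction *)

Section FrameBundle.
Context {R : realType} {n : nat} {M : topologicalType}.
Context {A : oriented_atlas R n M} {G : topGroupType} {theta : G -> 'M[R]_n}.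
Hypothesis theta_cover : universal_cover_GLplus theta.
Variable P : spin_structure A theta.
Implicit Types (i j : A) (q : P).

Lemma continuous_pair (T U V : topologicalType) (f : T -> U) (h : T -> V) x :
  {for x, continuous f} -> {for x, continuous h} ->
  {for x, continuous (fun y => (f y, h y))}.
Proof. exact: cvg_pair. Qed.

Lemma continuous_oppmx (T : topologicalType) (p r : nat)
    (f : T -> 'M[R]_(p, r)) x :
  {for x, continuous f} -> {for x, continuous (fun y => - f y)}.
Proof. exact: cvgN. Qed.

Lemma frame_unit i q : dom i (proj q) -> frame i q \in unitmx.
Proof.
by move=> qi; rewrite unitmxE unitfE gt_eqF //; exact: (frame_oriented qi).
Qed.

Lemma near_dom i x : dom i x -> \forall y \near x, dom i y.
Proof. by move=> xi; apply: open_nbhs_nbhs; split => //; exact: dom_open. Qed.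

Lemma near_dom_proj i q : dom i (proj q) -> \forall r \near q, dom i (proj r).
Proof. by move=> qi; exact: (@proj_continuous _ _ _ _ _ _ P q) _ (near_dom qi). Qed.

Lemma coord_proj_continuous i q : dom i (proj q) ->
  {for q, continuous (fun r : P => coord i (proj r))}.
Proof.
move=> qi; apply: (@continuous_comp _ _ _ (@proj _ _ _ _ _ _ P) (coord i)).
  exact: proj_continuous.
exact: coord_continuous.
Qed.

Lemma same_fiber q q' : proj q = proj q' -> exists a, q' = act q a.
Proof.
move=> qq; have [U [s [h [oU Uq _ hq ha]]]] := locally_trivial P (proj q).
exists ((h q)^-1 * h q')%g.
have [_ E] := hq q Uq; have Uq' : U (proj q') by rewrite -qq.
have [_ E'] := hq q' Uq'.
have -> : act q ((h q)^-1 * h q')%g =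
  act (act (s (proj q)) (h q)) ((h q)^-1 * h q')%g by rewrite E.
by rewrite -actM mulgA mulgV mul1g qq.
Qed.

(** The pair (coordinates of the base point, frame matrix) is a local homeomorphism. Its inverse
    takes a local section s of the bundle and acts by the lift, through a sheet of [theta], of the
    matrix carrying the frame of s to the prescribed one. *)
Lemma local_trivialization i q0 : dom i (proj q0) ->
  exists (V : set ('cV[R]_n * 'M[R]_n)) (lam : 'cV[R]_n * 'M[R]_n -> P),
  [/\ open V, V (coord i (proj q0), frame i q0),
      forall p, V p -> [/\ {for p, continuous lam}, cod i p.1,
        proj (lam p) = param i p.1 & frame i (lam p) = p.2] &
      \forall q \near q0, lam (coord i (proj q), frame i q) = q].
Proof.
move=> q0i.
have [U [s [h [oU Uq0 sU hU _]]]] := locally_trivial P (proj q0).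
have [V' [sg [oV' V'q0 sgq0 sgV' nsg]]] := theta_section theta_cover (h q0).
pose F (p : 'cV[R]_n * 'M[R]_n) := frame i (s (param i p.1)).
pose B (p : 'cV[R]_n * 'M[R]_n) := invmx (F p) *m p.2.
pose D (p : 'cV[R]_n * 'M[R]_n) := cod i p.1 /\ U (param i p.1).
pose V := [set p | D p /\ V' (B p)].
pose lam p := act (s (param i p.1)) (sg (B p)).
have cpar p : cod i p.1 -> {for p, continuous (fun p : 'cV[R]_n * 'M[R]_n => param i p.1)}.
  move=> pi; apply: (@continuous_comp _ _ _ fst (param i)); first exact: cvg_fst.
  exact: param_continuous.
have Ddom p : D p -> dom i (proj (s (param i p.1))).
  by move=> [pi /sU[_ ->]]; exact: cod_dom.
have cs p : D p -> {for p, continuous (fun p : 'cV[R]_n * 'M[R]_n => s (param i p.1))}.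
  move=> [pi Up]; apply: (@continuous_comp _ _ _ (fun p : 'cV[R]_n * 'M[R]_n => param i p.1) s).
    exact: cpar.
  by have [] := sU _ Up.
have cF p : D p -> {for p, continuous F}.
  move=> Dp; apply: (@continuous_comp _ _ _
    (fun p : 'cV[R]_n * 'M[R]_n => s (param i p.1)) (frame i)); first exact: cs.
  exact: (frame_continuous (Ddom p Dp)).
have uF p : D p -> F p \in unitmx by move=> Dp; apply: frame_unit; exact: Ddom.
have cB p : D p -> {for p, continuous B}.
  move=> Dp; apply: continuous_mulmx; last exact: cvg_snd.
  by apply: continuous_invmx; [exact: uF|exact: cF].
have nD p : D p -> \forall p' \near p, D p'.
  move=> [pi Up]; apply: filterI.
    by apply: (@cvg_fst _ _ (nbhs p.1) (nbhs p.2) _); exact: near_cod.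
  by apply: (cpar p pi); exact: open_nbhs_nbhs.
have D0 : D (coord i (proj q0), frame i q0).
  by split => /=; [exact: dom_cod|rewrite coordK].
have Bq q : dom i (proj q) -> U (proj q) ->
    B (coord i (proj q), frame i q) = theta (h q).
  move=> qi Uq; have Dq : D (coord i (proj q), frame i q).
    by split => /=; [exact: dom_cod|rewrite coordK].
  rewrite /B /F /= coordK //.
  have [_ {2}<-] := hU _ Uq; rewrite frame_act; last by have [_ ->] := sU _ Uq.
  rewrite mulKmx //; apply: frame_unit.
  by have [_ ->] := sU _ Uq.
exists V, lam; split.
- rewrite openE => p [Dp V'p]; apply: filterI; first exact: nD.
  by apply: (cB p Dp); exact: open_nbhs_nbhs.
- by split => //; rewrite Bq.
- move=> p [Dp V'p]; have [pi Up] := Dp; split => //.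
  + apply: (@continuous_comp _ _ _ (fun p : 'cV[R]_n * 'M[R]_n =>
      (s (param i p.1), sg (B p))) (fun p : P * G => act p.1 p.2)).
      apply: continuous_pair; first exact: (cs p Dp).
      apply: (@continuous_comp _ _ _ B sg); first exact: cB.
      by have [] := sgV' _ V'p.
    exact: act_continuous.
  + by rewrite /lam proj_act; have [_ ->] := sU _ Up.
  + rewrite /lam frame_act; last exact: Ddom.
    have [_ ->] := sgV' _ V'p.
    by rewrite /B mulKVmx //; exact: uF.
- have nU : \forall q \near q0, U (proj q).
    by apply: (@proj_continuous _ _ _ _ _ _ P q0); exact: open_nbhs_nbhs.
  have nh : \forall q \near q0, sg (theta (h q)) = h q.
    by have [ch _] := hU _ Uq0; exact: ch _ nsg.
  near=> q.
  have qi : dom i (proj q) by near: q; exact: near_dom_proj.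
  have Uq : U (proj q) by near: q.
  rewrite /lam /= Bq // coordK //.
  have -> : sg (theta (h q)) = h q by near: q.
  by have [] := hU _ Uq.
Unshelve. all: by end_near. Qed.

Section Orthonormal.
Variable g : bilinear_field A.
Hypothesis g_riem : riemannian_metric g.

Lemma orthonormal_liftP i q : dom i (proj q) ->
  orthonormal_lift g q <->
  (frame i q)^T *m g i (proj q) *m frame i q = 1%:M.
Proof.
move=> qi; split=> [|E j qj]; first exact.
rewrite (frame_change qi qj) trmx_mul -!mulmxA [(change i j _)^T *m _]mulmxA.
rewrite [((change i j _)^T *m _) *m _]mulmxA -(metric_change g_riem qi qj).
by rewrite mulmxA.
Qed.

(** Gram-Schmidt in the fibre: any point over [x] is moved by a lift of the Cholesky factor of its
    Gram matrix. *)
Lemma orthonormal_exists x : exists2 q : P, proj q = x & orthonormal_lift g q.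
Proof.
have [i xi] := dom_cover A x.
have [U [s [h [oU Ux sU _ _]]]] := locally_trivial P x.
have [_ ps] := sU _ Ux; have si : dom i (proj (s x)) by rewrite ps.
pose S := (frame i (s x))^T *m g i (proj (s x)) *m frame i (s x).
have pS : posdef S.
  by apply: posdef_congr; [exact: metric_posdef|exact: frame_unit].
have [a Ea] := theta_surj theta_cover (cholesky_det_gt0 pS).
exists (act (s x) a); rewrite ?proj_act //.
apply/(@orthonormal_liftP i); rewrite ?proj_act // frame_act // Ea.
by rewrite trmx_mul !mulmxA -(cholesky_gram pS) /S !mulmxA.
Qed.

Lemma orthonormal_fiber q q' : orthonormal_lift g q -> orthonormal_lift g q' ->
  proj q = proj q' -> exists2 a, q' = act q a & orthogonal_mx (theta a).
Proof.
move=> oq oq' qq; have [a Ea] := same_fiber qq; exists a => //.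
have [i qi] := dom_cover A (proj q).
have := oq' i; rewrite Ea proj_act => /(_ qi).
rewrite frame_act // trmx_mul -!mulmxA [_ *m (g _ _ *m _)]mulmxA.
by rewrite [(_ *m g _ _) *m _]mulmxA (oq i qi) mul1mx.
Qed.

                                                                       
(** Base coordinates and frame matrix are packed into one column vector, since plots are defined on
    spaces of column vectors. *)
Definition frame_dim := (n + n * n)%N.

Definition base_part (w : 'cV[R]_frame_dim) : 'cV[R]_n := usubmx w.
Definition frame_part (w : 'cV[R]_frame_dim) : 'M[R]_n := vec_mx (dsubmx w)^T.
Definition encode (y : 'cV[R]_n) (B : 'M[R]_n) : 'cV[R]_frame_dim :=
  col_mx y (mxvec B)^T.

Lemma base_part_encode y B : base_part (encode y B) = y.
Proof. exact: col_mxKu. Qed.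

Lemma frame_part_encode y B : frame_part (encode y B) = B.
Proof. by rewrite /frame_part /encode col_mxKd trmxK mxvecK. Qed.

Lemma base_part_linear : linear base_part.
Proof. by move=> a u v; rewrite /base_part linearP. Qed.

Lemma frame_part_linear : linear frame_part.
Proof.
by move=> a u v; rewrite /frame_part [dsubmx _]linearP [_^T]linearP linearP.
Qed.

Lemma encode_linear a y B y' B' :
  encode (a *: y + y') (a *: B + B') = a *: encode y B + encode y' B'.
Proof.
by rewrite /encode [mxvec _]linearP [_^T]linearP scale_col_mx add_col_mx.
Qed.

Lemma base_part_continuous : continuous base_part.
Proof.
move=> w; apply/continuous_mxP => i j; rewrite /base_part.
rewrite /prop_for /continuous_at mxE.
by under eq_fun do rewrite mxE; exact: matrix_normedtype.coord_continuous.
Qed.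

Lemma frame_part_continuous : continuous frame_part.
Proof.
move=> w; apply/continuous_mxP => i j; rewrite /frame_part.
rewrite /prop_for /continuous_at !mxE.
by under eq_fun do rewrite !mxE; exact: matrix_normedtype.coord_continuous.
Qed.

Lemma encode_continuous (T : topologicalType) (y : T -> 'cV[R]_n)
    (B : T -> 'M[R]_n) (x : T) : {for x, continuous y} -> {for x, continuous B} ->
  {for x, continuous (fun t => encode (y t) (B t))}.
Proof.
move=> /continuous_mxP cy /continuous_mxP cB; apply/continuous_mxP => k l.
rewrite ord1 /prop_for /continuous_at.
case: (split_ordP k) => {}k ->.
  by rewrite col_mxEu; under eq_fun do rewrite col_mxEu; exact: cy.
rewrite col_mxEd mxE; under eq_fun do rewrite col_mxEd mxE.
by case/mxvec_indexP: k => a b; rewrite mxvecE; under eq_fun do rewrite mxvecE;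
  exact: cB.
Qed.

Lemma is_derive_encode (V : normedModType R) (y : V -> 'cV[R]_n)
    (B : V -> 'M[R]_n) (x v : V) dy dB : is_derive x v y dy -> is_derive x v B dB ->
  is_derive x v (fun t => encode (y t) (B t)) (encode dy dB).
Proof.
move=> /is_derive_mxP cy /is_derive_mxP cB; apply/is_derive_mxP => k l.
rewrite ord1.
case: (split_ordP k) => {}k ->.
  by rewrite col_mxEu; under eq_fun do rewrite col_mxEu; exact: cy.
rewrite col_mxEd mxE; under eq_fun do rewrite col_mxEd mxE.
by case/mxvec_indexP: k => a b; rewrite mxvecE; under eq_fun do rewrite mxvecE;
  exact: cB.
Qed.

Definition gram i (w : 'cV[R]_frame_dim) : 'M[R]_n :=
  (frame_part w)^T *m g i (param i (base_part w)) *m frame_part w.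

Definition frame_domain i : set 'cV[R]_frame_dim :=
  [set w | cod i (base_part w) /\ 0 < \det (frame_part w)].

                                                    
(** A smooth retraction of all oriented frames onto the g-orthonormal ones. *)
Definition retract_frame i (w : 'cV[R]_frame_dim) : 'M[R]_n :=
  frame_part w *m cholesky (gram i w).

Lemma frame_domain_open i : open (frame_domain i).
Proof.
rewrite openE => w [wi w0]; apply: filterI.
  by apply: base_part_continuous; exact: near_cod.
have c : {for w, continuous (fun w => \det (frame_part w))}.
  by apply: continuous_det; exact: frame_part_continuous.
exact: (cvgr_gt _ c _ w0).
Qed.

Lemma gram_posdef i w : frame_domain i w -> posdef (gram i w).
Proof.
move=> [wi w0]; apply: posdef_congr.
  by apply: metric_posdef => //; exact: cod_dom.
by rewrite unitmxE unitfE gt_eqF.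
Qed.

Lemma frame_part_Ck i k : Ck k (frame_domain i) frame_part.
Proof.
apply: Ck_linear; first exact: frame_domain_open.
  exact: frame_part_linear.
exact: frame_part_continuous.
Qed.

Lemma gram_Ck i k : Ck k (frame_domain i) (gram i).
Proof.
have oD := @frame_domain_open i.
apply: Ck_mulmx => //; last exact: frame_part_Ck.
apply: Ck_mulmx => //; first by apply: Ck_trmx => //; exact: frame_part_Ck.
apply: (@Ck_subset _ _ _ _ (base_part @^-1` cod i)); first by move=> w [].
apply: (@Ck_precomp_linear _ _ _ _ _ (cod i) base_part (g i \o param i)).
- exact: base_part_linear.
- exact: base_part_continuous.
- exact: metric_Ck.
Qed.

Lemma retract_Ck i k : Ck k (frame_domain i) (retract_frame i).
Proof.
have oD := @frame_domain_open i.
apply: Ck_mulmx => //; first exact: frame_part_Ck.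
apply: (@Ck_cholesky _ _ _ _ _ (gram i)) => //; first exact: gram_posdef.
exact: gram_Ck.
Qed.

Lemma retract_orthonormal i w : frame_domain i w ->
  (retract_frame i w)^T *m g i (param i (base_part w)) *m retract_frame i w = 1%:M.
Proof.
move=> /gram_posdef /cholesky_gram <-.
by rewrite /retract_frame trmx_mul /gram !mulmxA.
Qed.

Definition bundle_coord i q : 'cV[R]_frame_dim :=
  encode (coord i (proj q)) (frame i q).

Lemma bundle_coord_domain i q : dom i (proj q) ->
  frame_domain i (bundle_coord i q).
Proof.
move=> qi; split; first by rewrite base_part_encode; exact: dom_cod.
by rewrite frame_part_encode; exact: (frame_oriented qi).
Qed.

Lemma gram_orthonormal i q : dom i (proj q) -> orthonormal_lift g q ->
  gram i (bundle_coord i q) = 1%:M.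
Proof.
move=> qi oq.
by rewrite /gram frame_part_encode base_part_encode coordK //; exact: oq.
Qed.

Lemma retract_bundle_coord i q : dom i (proj q) -> orthonormal_lift g q ->
  retract_frame i (bundle_coord i q) = frame i q.
Proof.
move=> qi oq.
by rewrite /retract_frame gram_orthonormal // cholesky1 mulmx1 frame_part_encode.
Qed.

Lemma bundle_coord_continuous i q : dom i (proj q) ->
  {for q, continuous (bundle_coord i)}.
Proof.
move=> qi; apply: encode_continuous; first exact: coord_proj_continuous.
exact: frame_continuous.
Qed.

(** Spinor fields are controlled only on orthonormal lifts, which do not form an open set.
    Retracting frames before lifting gives a smooth map [Phi] from an open set of R^(n + n^2) into
    the orthonormal lifts that reproduces each nearby lift from its own coordinates. Composition
    with [Phi] then turns a spinor field into a C^k function to which ordinary calculus applies. *)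
Lemma local_plot i q0 : dom i (proj q0) -> orthonormal_lift g q0 ->
  exists (W : set 'cV[R]_frame_dim) (Phi : 'cV[R]_frame_dim -> P),
  [/\ smooth_plot W Phi, W (bundle_coord i q0),
      forall w, W w -> [/\ frame_domain i w, orthonormal_lift g (Phi w),
        proj (Phi w) = param i (base_part w) &
        frame i (Phi w) = retract_frame i w] &
      \forall q \near q0, orthonormal_lift g q ->
        W (bundle_coord i q) /\ Phi (bundle_coord i q) = q].
Proof.
move=> q0i oq0.
have [V [lam [oV Vq0 lamV nlam]]] := local_trivialization q0i.
have oD := @frame_domain_open i.
pose rho w := (base_part w, retract_frame i w).
have crho w : frame_domain i w -> {for w, continuous rho}.
  move=> Dw; apply: continuous_pair; first exact: base_part_continuous.
  exact: (Ck_continuous (@retract_Ck i 0) Dw).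
pose W := [set w | frame_domain i w /\ V (rho w)].
have rhoq q : dom i (proj q) -> orthonormal_lift g q ->
    rho (bundle_coord i q) = (coord i (proj q), frame i q).
  by move=> qi oq; rewrite /rho retract_bundle_coord // base_part_encode.
have oW : open W.
  rewrite openE => w [Dw Vw]; apply: filterI; first exact: open_nbhs_nbhs.
  by apply: (crho w Dw); exact: open_nbhs_nbhs.
pose Phi w := lam (rho w).
have WPhi w : W w -> [/\ {for w, continuous Phi}, cod i (base_part w),
    proj (Phi w) = param i (base_part w) & frame i (Phi w) = retract_frame i w].
  move=> [Dw Vw]; have [cl wi pl fl] := lamV _ Vw; split => //.
  by apply: (@continuous_comp _ _ _ rho lam); [exact: crho|exact: cl].
have Wi w : W w -> dom i (proj (Phi w)).
  by move=> Ww; have [_ wi -> _] := WPhi w Ww; exact: cod_dom.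
exists W, Phi; split.
- split => //; first by move=> w Ww; have [] := WPhi w Ww.
  move=> j /=; set W' := W `&` _.
  have oW' : open W'.
    rewrite openE => w [Ww wj]; apply: filterI; first exact: open_nbhs_nbhs.
    have [cw _ _ _] := WPhi w Ww.
    exact: (cw _ (near_dom_proj wj)).
  have W'o w : W' w -> overlap i j (base_part w).
    move=> [Ww wj]; have [_ wi pw _] := WPhi w Ww.
    by apply/overlapP; split => //; rewrite -pw.
  split=> k.
    apply: (@Ck_ext _ _ _ _ _ (transition i j \o base_part)) => //.
      by move=> w [Ww _]; have [_ wi pw _] := WPhi w Ww; rewrite /= pw.
    apply: (@Ck_subset _ _ _ _ (base_part @^-1` overlap i j)) => //.
    apply: Ck_precomp_linear; [exact: base_part_linear|
      exact: base_part_continuous|exact: transition_Ck].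
  apply: (@Ck_ext _ _ _ _ _ (fun w => (Jacobian (transition i j) \o base_part) w
    *m retract_frame i w)) => //.
    move=> w [Ww wj]; have [_ wi pw fw] := WPhi w Ww.
    rewrite /= (frame_change (Wi w Ww) wj) fw /change pw paramK //.
  apply: Ck_mulmx => //.
    apply: (@Ck_subset _ _ _ _ (base_part @^-1` overlap i j)) => //.
    apply: Ck_precomp_linear; [exact: base_part_linear|
      exact: base_part_continuous|exact: Jacobian_Ck].
  by apply: Ck_subset (@retract_Ck i k) => w [[]].
- by split; [exact: bundle_coord_domain|rewrite rhoq].
- move=> w Ww; have [_ wi pw fw] := WPhi w Ww; have [Dw _] := Ww; split => //.
  apply/(@orthonormal_liftP i); first exact: Wi.
  by rewrite fw pw; exact: retract_orthonormal.
- have nV : \forall q \near q0, V (coord i (proj q), frame i q).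
    have c : {for q0, continuous (fun q : P => (coord i (proj q), frame i q))}.
      apply: continuous_pair; first exact: coord_proj_continuous.
      exact: frame_continuous.
    by apply: c; exact: open_nbhs_nbhs.
  near=> q => oq.
  have qi : dom i (proj q) by near: q; exact: near_dom_proj.
  split; last by rewrite /Phi rhoq //; near: q.
  split; first exact: bundle_coord_domain.
  by rewrite rhoq //; near: q.
Unshelve. all: by end_near. Qed.

End Orthonormal.
End FrameBundle.

Arguments frame_dim n : clear implicits.

                            

(** * The spin Levi-Civita derivative in local coordinates *)

Lemma connection_change (R : realType) (n : nat) (C J K D E : 'M[R]_n) :
  C *m J = J *m K - D ->
  D *m E + J *m - (K *m E) = - (C *m (J *m E)).
Proof. by move=> CJ; rewrite mulmxA CJ mulmxBl opprB mulmxN mulmxA. Qed.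

Section Nabla.
Context {R : realType} {n : nat} {M : topologicalType}.
Context {A : oriented_atlas R n M} {G : topGroupType} {theta : G -> 'M[R]_n}.
Hypothesis theta_cover : universal_cover_GLplus theta.
Variable P : spin_structure A theta.
Variable g : bilinear_field A.
Hypothesis g_riem : riemannian_metric g.
Variables (N : nat) (psi : spinor_field P N).
Hypothesis psi_smooth : forall m (W : set 'cV[R]_m) c, smooth_plot W c ->
  (forall w, W w -> orthonormal_lift g (c w)) -> smooth W (psi \o c).
Implicit Types (i j : A) (q : P) (X : 'cV[R]_n).

Definition horizontal_velocity i q X : 'cV[R]_(frame_dim n) :=
  encode (frame i q *m X)
    (- (christoffel g i (proj q) (frame i q *m X) *m frame i q)).

Lemma christoffel_linear i x a u v : dom i x ->
  christoffel g i x (a *: u + v) =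
  a *: christoffel g i x u + christoffel g i x v.
Proof.
move=> xi; rewrite /christoffel.
rewrite (koszul_linear (fun a => 'D_(delta_mx a 0) (g i \o param i) (coord i x))).
by rewrite mulmxDr -scalemxAr.
Qed.

Lemma horizontal_velocity_linear i q a X Y : dom i (proj q) ->
  horizontal_velocity i q (a *: X + Y) =
  a *: horizontal_velocity i q X + horizontal_velocity i q Y.
Proof.
move=> qi; rewrite /horizontal_velocity linearP christoffel_linear //.
rewrite mulmxDl -scalemxAl opprD -scalerN -encode_linear.
by [].
Qed.

Lemma horizontal_bundle_coord i q X c : dom i (proj q) ->
  horizontal_curve g q X c ->
  is_derive (0 : R) (1 : R) (bundle_coord i \o c) (horizontal_velocity i q X).
Proof.
by move=> qi [_ _ _ hc]; have [dy dB] := hc i qi; exact: is_derive_encode.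
Qed.

Lemma metric_continuous i q : dom i (proj q) ->
  {for q, continuous (fun r : P => g i (proj r))}.
Proof.
move=> qi.
apply: (@near_continuous _ _ (fun q : P => (g i \o param i) (coord i (proj q)))).
  by apply: filterS (near_dom_proj qi) => r ri /=; rewrite coordK.
apply: (@continuous_comp _ _ _ (fun q : P => coord i (proj q)) (g i \o param i)).
  exact: coord_proj_continuous.
exact: Ck_continuous (@metric_Ck _ _ _ _ _ g_riem i 0) (dom_cod qi).
Qed.

Lemma metric_derive_continuous i q v : dom i (proj q) ->
  {for q, continuous (fun r : P => metric_derive g i (proj r) v)}.
Proof.
move=> qi; apply: (@continuous_comp _ _ _ (fun q : P => coord i (proj q))
  ('D_v (g i \o param i))); first exact: coord_proj_continuous.
exact: Ck_continuous (Ck_derive v (@metric_Ck _ _ _ _ _ g_riem i 1)) (dom_cod qi).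
Qed.

Lemma frame_vector_continuous i q X : dom i (proj q) ->
  {for q, continuous (fun r : P => frame i r *m X)}.
Proof.
move=> qi; apply: (@continuous_mulmx _ _ _ _ _ (frame i) (fun=> X)).
  exact: frame_continuous.
exact: cvg_cst.
Qed.

Lemma christoffel_continuous i q X : dom i (proj q) ->
  {for q, continuous (fun r : P => christoffel g i (proj r) (frame i r *m X))}.
Proof.
move=> qi; apply: (@continuous_mulmx _ _ _ _ _ (fun r : P => invmx (g i (proj r)))).
  apply: continuous_invmx; first exact: metric_unit.
  exact: metric_continuous.
apply: (@koszul_continuous _ _ _
  (fun a (r : P) => metric_derive g i (proj r) (delta_mx a 0))).
  by move=> a; exact: metric_derive_continuous.
exact: frame_vector_continuous.
Qed.

Lemma horizontal_velocity_continuous i q X : dom i (proj q) ->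
  {for q, continuous (fun r => horizontal_velocity i r X)}.
Proof.
move=> qi; apply: (@encode_continuous _ _ _ (fun r : P => frame i r *m X)
  (fun r : P => - (christoffel g i (proj r) (frame i r *m X) *m frame i r))).
  exact: frame_vector_continuous.
apply: (@continuous_oppmx _ _ _ _
  (fun r : P => christoffel g i (proj r) (frame i r *m X) *m frame i r)).
apply: continuous_mulmx; first exact: christoffel_continuous.
exact: frame_continuous.
Qed.

Section Plot.
Variables (i : A) (W : set 'cV[R]_(frame_dim n)) (Phi : 'cV[R]_(frame_dim n) -> P).
Hypothesis Phi_plot : smooth_plot W Phi.
Hypothesis Phi_frame : forall w, W w -> [/\ frame_domain i w,
  orthonormal_lift g (Phi w), proj (Phi w) = param i (base_part w) &
  frame i (Phi w) = retract_frame g i w].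
Variable q : P.
Hypotheses (qi : dom i (proj q)) (oq : orthonormal_lift g q).
Hypothesis PhiK : \forall r \near q, orthonormal_lift g r ->
  W (bundle_coord i r) /\ Phi (bundle_coord i r) = r.

Let w0 := bundle_coord i q.

Lemma plot_open : open W. Proof. by case: Phi_plot. Qed.

Lemma plot_point : W w0 /\ Phi w0 = q.
Proof. exact: (nbhs_singleton PhiK). Qed.

Lemma psi_plot_Ck k : Ck k W (psi \o Phi).
Proof. by apply: psi_smooth => // w /Phi_frame[]. Qed.

(** Near time 0 the curve is [Phi] of its own coordinates, so the derivative of [psi] along it
    depends only on the coordinate velocity. This makes [nabla] independent of the horizontal
    curve. *)
Lemma horizontal_curve_derive X c : horizontal_curve g q X c ->
  is_derive (0 : R) (1 : R) (psi \o c)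
    ('D_(horizontal_velocity i q X) (psi \o Phi) w0).
Proof.
move=> hc; have [c0 cc co _] := hc.
have dw := horizontal_bundle_coord qi hc.
have c0' : (bundle_coord i \o c) 0 = w0 by rewrite /= c0.
have [Ww0 _] := plot_point.
have := @C1_is_derive_comp R _ _ _ W (psi \o Phi) (bundle_coord i \o c) 0
  _ plot_open _ (psi_plot_Ck 1) dw.
rewrite c0' => /(_ Ww0); apply: near_eq_is_derive.
have cq : c @ (0 : R) --> q by rewrite -c0.
have := cq _ PhiK; apply: filterS2 co => t ot /(_ ot)[_ E].
by rewrite /= E.
Qed.

Lemma near_line (w v : 'cV[R]_(frame_dim n)) (B : set 'cV[R]_(frame_dim n)) :
  open B -> B w -> \forall t \near (0 : R), B (w + t *: v).
Proof.
move=> oB Bw.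
have c : (fun t : R => w + t *: v) @ (0 : R) --> w.
  have [cd _] := is_derive_affine w v.
  have := differentiable_continuous ((derivable1_diffP _ _).1 cd).
  by rewrite /prop_for /continuous_at scale0r addr0.
by apply: c; exact: open_nbhs_nbhs.
Qed.

(** Take the straight line in coordinates with horizontal velocity and apply [Phi]. Metric
    compatibility makes the Gram matrix stationary at time 0, so the retraction built into [Phi]
    leaves the velocity of the frame unchanged. *)
Lemma horizontal_curve_exists X : exists c, horizontal_curve g q X c.
Proof.
set v := horizontal_velocity i q X.
set vE := frame i q *m X; set Gam := christoffel g i (proj q) vE.
pose line (t : R) := w0 + t *: v.
pose c t := Phi (line t).
have [Ww0 Phiq] := plot_point.
have line0 : line 0 = w0 by rewrite /line scale0r addr0.
have nW : \forall t \near (0 : R), W (line t) by exact: near_line plot_open Ww0.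
have dline : is_derive (0 : R) (1 : R) line v by exact: is_derive_affine.
have cline : {for 0, continuous line}.
  by have [cd _] := dline; exact: differentiable_continuous ((derivable1_diffP _ _).1 cd).
have baseE t : base_part (line t) = coord i (proj q) + t *: vE.
  rewrite /line addrC base_part_linear.
  by rewrite !base_part_encode addrC.
have frameE t : frame_part (line t) = frame i q + t *: - (Gam *m frame i q).
  rewrite /line addrC frame_part_linear.
  by rewrite !frame_part_encode addrC.
exists c; split.
- by rewrite /c line0.
- apply: (@continuous_comp _ _ _ line Phi); first exact: cline.
  by rewrite line0; case: Phi_plot => _ + _; apply.
- by apply: filterS nW => t /Phi_frame[].
move=> j qj.
have yij : overlap i j (coord i (proj q)) by exact: overlap_coord.
have oO := @overlap_open _ _ _ A i j.
pose bline (t : R) := coord i (proj q) + t *: vE.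
have dbline : is_derive (0 : R) (1 : R) bline vE by exact: is_derive_affine.
have bline0 : bline 0 = coord i (proj q) by rewrite /bline scale0r addr0.
have nO : \forall t \near (0 : R), overlap i j (bline t).
  have cb : bline @ (0 : R) --> coord i (proj q).
    have [cd _] := dbline; have := differentiable_continuous ((derivable1_diffP _ _).1 cd).
    by rewrite /prop_for /continuous_at bline0.
  by apply: cb; exact: open_nbhs_nbhs.
split.
  have : is_derive (0 : R) (1 : R) (transition i j \o bline) (frame j q *m X).
    have -> : frame j q *m X = 'D_vE (transition i j) (bline 0).
      rewrite bline0 transition_derive // (frame_change qi qj).
      by rewrite mulmxA.
    apply: (C1_is_derive_comp (A := overlap i j)) => //; first by rewrite bline0.
    exact: transition_Ck.
  apply: near_eq_is_derive; apply: filterS nW => t Wt.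
  have [_ _ pw _] := Phi_frame Wt.
  by rewrite /c pw baseE.
have EgE : (frame i q)^T *m g i (proj q) *m frame i q = 1%:M by exact: oq.
have dB : is_derive (0 : R) (1 : R) (fun t => frame_part (line t))
    (- (Gam *m frame i q)).
  under eq_fun do rewrite frameE.
  exact: is_derive_affine.
have dgl : is_derive (0 : R) (1 : R) ((g i \o param i) \o bline)
    (metric_derive g i (proj q) vE).
  rewrite /metric_derive -bline0.
  apply: (C1_is_derive_comp (A := cod i)) => //; first exact: cod_open.
    by rewrite bline0; exact: dom_cod.
  exact: metric_Ck.
have gram0 : gram g i (line 0) = 1%:M by rewrite line0 gram_orthonormal.
have dgram : is_derive (0 : R) (1 : R) (fun t => gram g i (line t)) 0.
  have -> : (fun t => gram g i (line t)) = (fun t => (frame_part (line t))^T *m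
      ((g i \o param i) \o bline) t *m frame_part (line t)).
    by apply/funext => t; rewrite /gram baseE.
  have := is_derive_mulmx (is_derive_mulmx (is_derive_trmx dB) dgl) dB.
  rewrite /= bline0 frameE scale0r addr0 coordK //.
  (* The derivative of the metric along the base line is g Gamma + Gamma^T g, which exactly cancels
     the two terms from the frame. *)
  have E0 : (((- (Gam *m frame i q))^T *m g i (proj q) +
      (frame i q)^T *m metric_derive g i (proj q) vE) *m frame i q +
      (frame i q)^T *m g i (proj q) *m - (Gam *m frame i q)) = 0.
    rewrite -(christoffel_compat g_riem vE qi) -/Gam.
    rewrite [(- _)^T]linearN /= trmx_mul mulmxN mulNmx mulmxDr !mulmxDl mulNmx !mulmxA.
    move: ((frame i q)^T *m Gam^T *m g i (proj q) *m frame i q) => a.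
    by rewrite [X in - a + X]addrC addKr subrr.
  by rewrite E0.
have pg0 : posdef (gram g i (line 0)).
  by apply: gram_posdef => //; rewrite line0; have [] := Phi_frame Ww0.
have dchol := @is_derive_cholesky R _ n (fun t => gram g i (line t)) 0 1 pg0 dgram.
have dret := is_derive_mulmx dB dchol.
rewrite /= gram0 cholesky1 mulmx1 mulmx0 addr0 in dret.
have dJ : is_derive (0 : R) (1 : R) (Jacobian (transition i j) \o bline)
    ('D_vE (Jacobian (transition i j)) (bline 0)).
  apply: (C1_is_derive_comp (A := overlap i j)) => //; first by rewrite bline0.
  exact: Jacobian_Ck.
have dF := is_derive_mulmx dJ dret.
rewrite /= gram0 cholesky1 mulmx1 frameE scale0r addr0 bline0 in dF.
(* The horizontality equation in another chart [j]: the inhomogeneous term of the Christoffel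
   transformation law cancels the derivative of the Jacobian. *)
have target : 'D_vE (Jacobian (transition i j)) (coord i (proj q)) *m frame i q +
    Jacobian (transition i j) (coord i (proj q)) *m - (Gam *m frame i q) =
    - (christoffel g j (proj q) (frame j q *m X) *m frame j q).
  have CC := christoffel_change g_riem vE qi qj.
  have jv : frame j q *m X = change i j (proj q) *m vE.
    by rewrite (frame_change qi qj) mulmxA.
  rewrite jv (frame_change qi qj); exact: connection_change CC.
rewrite target in dF.
move: dF; apply: near_eq_is_derive.
apply: filterS2 nW nO => t Wt Ot; have [_ _ pw fw] := Phi_frame Wt.
have ti : dom i (proj (Phi (line t))).
  by rewrite pw baseE; apply: cod_dom; have [] := (overlapP i j _).1 Ot.
have tj : dom j (proj (Phi (line t))).
  by rewrite pw baseE; have [] := (overlapP i j _).1 Ot.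
rewrite /c (frame_change ti tj) fw /retract_frame /change pw baseE paramK //.
by have [] := (overlapP i j _).1 Ot.
Qed.

(** Existence of a horizontal curve and independence of its choice resolve the [xget] in [nabla];
    from here on it is a directional derivative. *)
Lemma nabla_plot X :
  nabla g psi q X = 'D_(horizontal_velocity i q X) (psi \o Phi) w0.
Proof.
have [c hc] := horizontal_curve_exists X.
have dc := horizontal_curve_derive hc.
rewrite /nabla; apply: xget_unique; first by exists c.
move=> y [c' hc' dc'].
have [_ <-] := dc'; have [_ <-] := horizontal_curve_derive hc'.
by [].
Qed.

End Plot.

(** Provides functions continuous at [q0] on the total space that agree with [psi] and [nabla] on
    nearby orthonormal lifts, as [psi] itself is arbitrary off those lifts. *)
Lemma nabla_local q0 : orthonormal_lift g q0 ->
  exists (psi' : P -> 'cV[R]_N.+1) (D : 'cV[R]_n -> P -> 'cV[R]_N.+1),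
  [/\ {for q0, continuous psi'}, forall X, {for q0, continuous (D X)} &
    \forall q \near q0, orthonormal_lift g q ->
      psi q = psi' q /\ forall X, nabla g psi q X = D X q].
Proof.
move=> oq0; have [i q0i] := dom_cover A (proj q0).
have [W [Phi [pPhi Wq0 PhiF PhiK]]] := local_plot theta_cover g_riem q0i oq0.
have oW : open W by case: pPhi.
have C1 : Ck 1 W (psi \o Phi) by apply: psi_smooth => // w /PhiF[].
pose D X q := \sum_k horizontal_velocity i q X k 0 *:
  'D_(delta_mx k 0) (psi \o Phi) (bundle_coord i q).
have cb := bundle_coord_continuous q0i.
exists (psi \o Phi \o bundle_coord i), D; split.
- apply: (@continuous_comp _ _ _ (bundle_coord i) (psi \o Phi)) => //.
  exact: Ck_continuous C1 Wq0.
- move=> X.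
  have cv := @horizontal_velocity_continuous i q0 X q0i.
  apply: cvg_sum => k; apply: cvgZ; first exact: ((continuous_mxP _ _).1 cv).
  apply: (@continuous_comp _ _ _ (bundle_coord i)
    ('D_(delta_mx k 0) (psi \o Phi))) => //.
  exact: Ck_continuous (Ck_derive _ C1) Wq0.
- have PhiK2 := nbhs_interior PhiK.
  apply: filterS2 PhiK2 (near_dom_proj q0i) => q qK qi oq.
  have [Wq Phiq] := nbhs_singleton qK oq.
  split; first by rewrite /= Phiq.
  move=> X; rewrite (nabla_plot pPhi PhiF qi oq qK X).
  exact: C1_derive_sum oW Wq C1.
Qed.

Lemma nabla_linear q a X Y : orthonormal_lift g q ->
  nabla g psi q (a *: X + Y) = a *: nabla g psi q X + nabla g psi q Y.
Proof.
move=> oq; have [i qi] := dom_cover A (proj q).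
have [W [Phi [pPhi Wq PhiF PhiK]]] := local_plot theta_cover g_riem qi oq.
have oW : open W by case: pPhi.
have C1 : Ck 1 W (psi \o Phi) by apply: psi_smooth => // w /PhiF[].
rewrite !(nabla_plot pPhi PhiF qi oq PhiK) horizontal_velocity_linear //.
rewrite !(C1_derive_sum _ oW Wq C1) scaler_sumr -big_split /=.
by apply: eq_bigr => k _; rewrite !mxE scalerDl scalerA.
Qed.

End Nabla.

                                                       

(** * Homotheties of the metric and right translations *)

Lemma koszul_scale (R : realType) (n : nat) (d d' : 'I_n -> 'M[R]_n) (k : R)
    (v : 'cV[R]_n) : (forall a, d' a = k *: d a) ->
  \matrix_(l, b) (2^-1 * \sum_a v a 0 * (d' a l b + d' b l a - d' l a b)) =
  k *: \matrix_(l, b) (2^-1 * \sum_a v a 0 * (d a l b + d b l a - d l a b)).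
Proof.
move=> dd; apply/matrixP => l b; rewrite !mxE mulrCA; congr (_ * _).
by rewrite mulr_sumr; apply: eq_bigr => a _; rewrite !dd !mxE; ring.
Qed.

Section ConformalChange.
Context {R : realType} {n : nat} {M : topologicalType}.
Context {A : oriented_atlas R n M} {G : topGroupType} {theta : G -> 'M[R]_n}.
Hypothesis theta_cover : universal_cover_GLplus theta.
Variable P : spin_structure A theta.
Implicit Types (g : bilinear_field A) (i j : A) (q : P) (X : 'cV[R]_n) (k : R).

Definition scale_metric k g : bilinear_field A := fun i x => k *: g i x.

Lemma scale_metric1 g : scale_metric 1 g = g.
Proof. by apply/funext => i; apply/funext => x; rewrite /scale_metric scale1r. Qed.

Lemma scale_metric_riemannian k g : 0 < k -> riemannian_metric g ->
  riemannian_metric (scale_metric k g).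
Proof.
move=> k0 g_riem; have [gs gp gc gC] := g_riem; split.
- by move=> i x xi; rewrite /scale_metric linearZ /= gs.
- move=> i x v xi v0; rewrite /scale_metric -scalemxAr -scalemxAl mxE.
  by rewrite mulr_gt0 // gp.
- move=> i j x xi xj; rewrite /scale_metric (gc i j x xi xj).
  by rewrite -scalemxAr -scalemxAl.
- move=> i m; apply: (@Ck_scalemx _ _ _ _ _ _ (fun=> k) (g i \o param i)).
  + exact: cod_open.
  + by apply: Ck_cst; exact: cod_open.
  + exact: gC.
Qed.

(** The constant factor of the differentiated metric cancels against that of the inverse metric. *)
Lemma christoffel_scale k g i x v : 0 < k -> riemannian_metric g -> dom i x ->
  christoffel (scale_metric k g) i x v = christoffel g i x v.
Proof.
move=> k0 g_riem xi; rewrite /christoffel.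
have k_neq0 : k != 0 by rewrite gt_eqF.
have dE a : 'D_(delta_mx a 0) (scale_metric k g i \o param i) (coord i x) =
    k *: 'D_(delta_mx a 0) (g i \o param i) (coord i x).
  have [gd _] := metric_is_derive g_riem (delta_mx a 0) xi.
  exact: (deriveZ k gd).
rewrite (koszul_scale v dE) /scale_metric invmxZ.
  by rewrite -scalemxAr -scalemxAl scalerA mulfV // scale1r.
by rewrite unitmxZ ?unitfE //; exact: metric_unit xi.
Qed.

Lemma orthonormal_scale k a g q : 0 < k ->
  (theta a)^T *m theta a = (k^-1)%:M -> orthonormal_lift g q ->
  orthonormal_lift (scale_metric k g) (act q a).
Proof.
move=> k0 ta oq i; rewrite proj_act => qi.
rewrite frame_act // /scale_metric trmx_mul -scalemxAr -scalemxAl !mulmxA.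
rewrite -[_ *m _ *m g i _ *m frame i q]mulmxA -[_ *m _ *m (g i _ *m _)]mulmxA.
rewrite [_ *m (g i _ *m _)]mulmxA oq // mulmx1 ta.
by rewrite scale_scalar_mx mulfV // gt_eqF.
Qed.

(** The connection is the same for [g] and its multiple, and horizontality is invariant under
    constant right translation; the vector changes only because its components refer to the
    translated frame. *)
Lemma horizontal_curve_act k a g q X c : 0 < k -> riemannian_metric g ->
  (theta a)^T *m theta a = (k^-1)%:M ->
  horizontal_curve g q (theta a *m X) c ->
  horizontal_curve (scale_metric k g) (act q a) X (fun t => act (c t) a).
Proof.
move=> k0 g_riem ta [c0 cc co cd]; split.
- by rewrite c0.
- apply: (@continuous_comp _ _ _ (fun t => (c t, a)) (fun p : P * G => act p.1 p.2)).
    by apply: continuous_pair => //; exact: cvg_cst.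
  exact: act_continuous.
- by apply: filterS co => t; exact: orthonormal_scale.
move=> i; rewrite proj_act => qi; have [dy dE] := cd i qi.
split.
  have -> : (fun t => coord i (proj (act (c t) a))) =
            (fun t => coord i (proj (c t))).
    by apply/funext => t; rewrite proj_act.
  by rewrite frame_act // -mulmxA.
have dEa := is_derive_mulmx dE (is_derive_cst (theta a) (0 : R) 1).
rewrite /cst mulmx0 addr0 in dEa.
rewrite (christoffel_scale _ k0 g_riem qi) frame_act // -(mulmxA _ _ X).
rewrite mulmxA -mulNmx; move: dEa; apply: near_eq_is_derive.
have cq : c @ (0 : R) --> q by rewrite -c0.
have nd : \forall t \near (0 : R), dom i (proj (c t)).
  by exact: cq _ (near_dom_proj qi).
by apply: filterS nd => t ti; rewrite frame_act.
Qed.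

Section Nabla.
Variables (N : nat).
Implicit Type psi : spinor_field P N.

Definition smooth_spinor g psi := forall m (W : set 'cV[R]_m) c,
  smooth_plot W c -> (forall w, W w -> orthonormal_lift g (c w)) ->
  smooth W (psi \o c).

Lemma horizontal_curveP g psi q X : riemannian_metric g -> smooth_spinor g psi ->
  orthonormal_lift g q ->
  (exists c, horizontal_curve g q X c) /\
  forall c, horizontal_curve g q X c ->
    is_derive (0 : R) (1 : R) (psi \o c) (nabla g psi q X).
Proof.
move=> g_riem psi_smooth oq; have [i qi] := dom_cover A (proj q).
have [W [Phi [pPhi Wq PhiF PhiK]]] := local_plot theta_cover g_riem qi oq.
split; first exact: (horizontal_curve_exists g_riem pPhi PhiF qi oq PhiK).
move=> c hc; rewrite (nabla_plot g_riem psi_smooth pPhi PhiF qi oq PhiK).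
exact: (horizontal_curve_derive psi_smooth pPhi PhiF qi oq PhiK).
Qed.

(** Serves two purposes: k = 1 with [a] over SO(n) and L a spin matrix gives equivariance of
    [nabla], and k = e^(2t) with [a] a lifted dilation and L = 1 gives its scaling. *)
Lemma nabla_act k a g psi psi' (L : 'M[R]_N.+1) q X : 0 < k ->
  riemannian_metric g -> smooth_spinor g psi ->
  smooth_spinor (scale_metric k g) psi' ->
  (theta a)^T *m theta a = (k^-1)%:M ->
  (forall r, orthonormal_lift g r -> psi' (act r a) = L *m psi r) ->
  orthonormal_lift g q ->
  nabla (scale_metric k g) psi' (act q a) X = L *m nabla g psi q (theta a *m X).
Proof.
move=> k0 g_riem sp sp' ta pp oq.
have [[c hc] dc] := horizontal_curveP (theta a *m X) g_riem sp oq.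
have [_ dc'] := horizontal_curveP X (scale_metric_riemannian k0 g_riem) sp'
  (orthonormal_scale k0 ta oq).
have [_ <-] := dc' _ (horizontal_curve_act k0 g_riem ta hc).
have d1 := is_derive_mulmx (is_derive_cst L (0 : R) 1) (dc _ hc).
rewrite mul0mx add0r in d1.
suff [_ ->] : is_derive (0 : R) (1 : R) (psi' \o (fun t => act (c t) a))
  (L *m nabla g psi q (theta a *m X)) by [].
move: d1; apply: near_eq_is_derive.
by have [_ _ co _] := hc; apply: filterS co => t /pp.
Qed.

End Nabla.
End ConformalChange.

(** * Frame independence of the norm of T_r *)

Section TensorNorm.
Context {R : realType} {n : nat} {M : topologicalType}.
Context {A : oriented_atlas R n M} {G : topGroupType} {theta : G -> 'M[R]_n}.
Hypothesis theta_cover : universal_cover_GLplus theta.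
Variable P : spin_structure A theta.
Variables (Cl : algType R) (iota : {linear 'cV[R]_n -> Cl}) (kappa : G -> Cl).
Hypothesis kappa_spin : spin_identification theta iota kappa.
Variables (N : nat) (rho : {lrmorphism Cl -> 'M[R]_N.+1}) (Q : 'M[R]_N.+1).
Hypothesis Q_prod : spinor_product iota rho Q.
Implicit Types (g : bilinear_field A) (psi : spinor_field P N) (q : P).

Lemma inner_scaleDl a (u v w : 'cV[R]_N.+1) :
  inner Q (a *: u + v) w = a * inner Q u w + inner Q v w.
Proof.
by rewrite /inner linearP /= !mulmxDl -!scalemxAl !mxE.
Qed.

Lemma inner_scaleDr a (u v w : 'cV[R]_N.+1) :
  inner Q w (a *: u + v) = a * inner Q w u + inner Q w v.
Proof. by rewrite /inner mulmxDr -!scalemxAr !mxE. Qed.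

Section Metric.
Variables (g : bilinear_field A) (psi : spinor_field P N).
Hypothesis g_riem : riemannian_metric g.
Hypothesis psi_section : spinor_section kappa rho g psi.

Lemma smooth_spinor_section : smooth_spinor g psi.
Proof. by case: psi_section. Qed.

Lemma orthogonal_thetaV a : orthogonal_mx (theta a) ->
  orthogonal_mx (theta a^-1%g).
Proof.
rewrite /orthogonal_mx /= (thetaV theta_cover) => ta.
have -> : invmx (theta a) = (theta a)^T.
  by rewrite -[RHS]mulmx1 -(mulmxV (theta_unit theta_cover a)) mulmxA ta mul1mx.
by rewrite trmxK mulmx1C.
Qed.

Lemma kappa_word a (s : seq 'cV[R]_n) : orthogonal_mx (theta a) ->
  (\prod_(v <- s) iota v) * kappa a^-1%g =
  kappa a^-1%g * \prod_(v <- s) iota (theta a *m v).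
Proof.
move=> ta; have ta' := orthogonal_thetaV ta.
have [_ _ kiota _] := kappa_spin.
elim: s => [|v s ih]; first by rewrite !big_nil mul1r mulr1.
rewrite !big_cons -mulrA ih !mulrA; congr (_ * _).
have := kiota a^-1%g; rewrite inE => /(_ ta' (theta a *m v)) ->.
by rewrite mulmxA (thetaV theta_cover) mulVmx ?theta_unit // mul1mx.
Qed.

Lemma nabla_spin_act q a X : orthonormal_lift g q -> orthogonal_mx (theta a) ->
  nabla g psi (act q a) X = rho (kappa a^-1%g) *m nabla g psi q (theta a *m X).
Proof.
move=> oq ta; have [psi_act _] := psi_section.
have := @nabla_act _ _ _ _ _ _ theta_cover P N 1 a g psi psi
  (rho (kappa a^-1%g)) q X ltr01 g_riem smooth_spinor_section.
rewrite scale_metric1 invr1; apply=> //; first exact: smooth_spinor_section.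
by move=> r or; exact: psi_act.
Qed.

(** The spin element that transforms both [nabla] and [psi] is moved through the Clifford word by
    [kappa_word], rotating each vector, and then disappears by invariance of the scalar product. *)
Lemma Ttensor_act r q a X : orthonormal_lift g q -> orthogonal_mx (theta a) ->
  @Ttensor _ _ _ _ _ _ P Cl iota N rho Q r g psi (act q a) X =
  Ttensor iota rho Q g psi q (fun k => theta a *m X k).
Proof.
move=> oq ta; rewrite /Ttensor nabla_spin_act //.
have [psi_act _] := psi_section; rewrite psi_act //.
have [kb _ _ _] := kappa_spin; have ta' := orthogonal_thetaV ta.
rewrite mulmxA -[_ *m rho (kappa _)]rmorphM /=.
have -> : (\prod_(k < r) iota (X (lift ord0 k))) * kappa a^-1%g =
    kappa a^-1%g * \prod_(k < r) iota (theta a *m X (lift ord0 k)).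
  have := kappa_word [seq X (lift ord0 k) | k <- index_enum 'I_r] ta.
  by rewrite !big_map.
have [_ _ Q_inv _] := Q_prod.
rewrite rmorphM /= -mulmxA Q_inv //.
by have [kf _ _] := kb; apply: kf.
Qed.

Definition frame_norm2 r g' psi' q : R :=
  \sum_(e : {ffun 'I_r.+1 -> 'I_n})
    (@Ttensor _ _ _ _ _ _ P Cl iota N rho Q r g' psi' q
       (fun k => delta_mx (e k) 0)) ^+ 2.

Lemma Ttensor_multilinear r q (B : 'M[R]_n) (f : {ffun 'I_r.+1 -> 'I_n}) :
  orthonormal_lift g q ->
  @Ttensor _ _ _ _ _ _ P Cl iota N rho Q r g psi q
    (fun k => B *m delta_mx (f k) 0) =
  \sum_(e : {ffun 'I_r.+1 -> 'I_n}) (\prod_k B (e k) (f k)) *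
    Ttensor iota rho Q g psi q (fun k => delta_mx (e k) 0).
Proof.
move=> oq; rewrite /Ttensor.
have BE k : B *m delta_mx k 0 = \sum_i B i k *: (delta_mx i 0 : 'cV[R]_n).
  rewrite -colE [LHS]matrix_sum_delta; apply: eq_bigr => i _.
  by rewrite big_ord1 mxE.
have nE : nabla g psi q (B *m delta_mx (f ord0) 0) =
    \sum_i B i (f ord0) *: nabla g psi q (delta_mx i 0).
  rewrite BE; elim/big_rec2: _ => [|i u w _ <-].
    have := nabla_linear theta_cover g_riem smooth_spinor_section (-1) 0 0 oq.
    by rewrite scaler0 addr0 scaleN1r addNr.
  by rewrite (nabla_linear theta_cover g_riem smooth_spinor_section _ _ _ oq).
have wE : \prod_(k < r) iota (B *m delta_mx (f (lift ord0 k)) 0) =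
    \sum_(e : {ffun 'I_r -> 'I_n}) (\prod_k B (e k) (f (lift ord0 k))) *:
      \prod_(k < r) iota (delta_mx (e k) 0).
  under eq_bigr => k _ do rewrite BE linear_sum /=.
  rewrite bigA_distr_bigA; apply: eq_bigr => e _.
  by rewrite -scaler_prod; apply: eq_bigr => k _; rewrite linearZ.
rewrite nE wE.
have iE (I J : finType) (a : I -> R) (u : I -> 'cV[R]_N.+1) (b : J -> R)
    (x : J -> Cl) : inner Q (\sum_i a i *: u i) (rho (\sum_j b j *: x j) *m psi q) =
    \sum_i \sum_j (a i * b j) * inner Q (u i) (rho (x j) *m psi q).
  elim/big_rec2: _ => [|i y w _ <-]; first by rewrite /inner trmx0 !mul0mx mxE.
  rewrite inner_scaleDl; congr (_ + _).
  elim/big_rec2: _ => [|j y' w' _ ih].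
    by rewrite rmorph0 mul0mx /inner mulmx0 mxE mulr0.
  by rewrite linearP mulmxDl -scalemxAl inner_scaleDr mulrDr ih mulrA.
rewrite iE -sum_ffun_recl; apply: eq_bigr => e _.
rewrite big_ord_recl; congr (_ * _ * inner _ _ (rho _ *m _)).
  by apply: eq_bigr => k _; rewrite ffunE.
by apply: eq_bigr => k _; rewrite ffunE.
Qed.

Lemma frame_norm2_act r q a : orthonormal_lift g q -> orthogonal_mx (theta a) ->
  frame_norm2 r g psi (act q a) = frame_norm2 r g psi q.
Proof.
move=> oq ta; rewrite /frame_norm2.
rewrite -[RHS](orthogonal_sum_sq _ ta); apply: eq_bigr => f _.
by rewrite Ttensor_act // Ttensor_multilinear.
Qed.

(** Two orthonormal lifts of one point differ by an element over SO(n), which rotates the components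
    orthogonally; so the value chosen in [Tnorm2] can be computed at any of them. *)
Lemma Tnorm2E r q : orthonormal_lift g q ->
  Tnorm2 iota rho Q r g psi (proj q) = frame_norm2 r g psi q.
Proof.
move=> oq; apply: xget_unique; first by exists q.
move=> _ [q' [qq oq' ->]].
have [a -> ta] := orthonormal_fiber oq oq' (esym qq).
exact: frame_norm2_act.
Qed.

End Metric.
End TensorNorm.

                           

(** * The curve of homotheties through a unit pair *)

Section ScalingCurve.
Context {R : realType} {n : nat} {M : topologicalType}.
Context {A : oriented_atlas R n M} {G : topGroupType} {theta : G -> 'M[R]_n}.
Hypothesis theta_cover : universal_cover_GLplus theta.
Variable P : spin_structure A theta.
Variables (Cl : algType R) (iota : {linear 'cV[R]_n -> Cl}) (kappa : G -> Cl).
Hypothesis kappa_spin : spin_identification theta iota kappa.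
Variables (N : nat) (rho : {lrmorphism Cl -> 'M[R]_N.+1}) (Q : 'M[R]_N.+1).
Hypothesis Q_prod : spinor_product iota rho Q.
Variables (g : bilinear_field A) (psi : spinor_field P N).
Hypothesis gpsi : unit_pair kappa rho Q g psi.
Variable z : R -> G.
Hypotheses (z0 : z 0 = 1%g) (z_continuous : continuous z).
Hypothesis theta_z : forall t, theta (z t) = (expR t)%:M.
Hypothesis z_central : forall t a, (z t * a = a * z t)%g.

Definition dilate_metric (t : R) : bilinear_field A := scale_metric (expR (2 * t)) g.
(** Right translation by z(t)^(-1) identifies the orthonormal lifts of [g] with those of the
    rescaled metric; under this identification the spinor stays constant in [t]. *)
Definition dilate_spinor (t : R) : spinor_field P N := fun q => psi (act q (z t)).

Lemma dilate0 : dilate_metric 0 = g /\ dilate_spinor 0 = psi.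
Proof.
split; first by rewrite /dilate_metric mulr0 expR0 scale_metric1.
by apply/funext => q; rewrite /dilate_spinor z0 act1.
Qed.

Lemma expR2 (t : R) : expR (2 * t) = expR t * expR t.
Proof. by rewrite mulr_natl mulr2n expRD. Qed.

Lemma dilation_gram t : (theta (z t))^T *m theta (z t) = (expR (2 * t))%:M.
Proof. by rewrite theta_z tr_scalar_mx -scalar_mxM expR2. Qed.

Lemma dilation_gramV t :
  (theta (z t)^-1%g)^T *m theta (z t)^-1%g = ((expR (2 * t))^-1)%:M.
Proof.
rewrite (thetaV theta_cover) theta_z invmx_scalar tr_scalar_mx -scalar_mxM.
by rewrite expR2 invfM.
Qed.

Lemma orthonormal_dilate t (q : P) : orthonormal_lift g q ->
  orthonormal_lift (dilate_metric t) (act q (z t)^-1%g).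
Proof. by apply: orthonormal_scale; [exact: expR_gt0|exact: dilation_gramV]. Qed.

Lemma orthonormal_undilate t (q : P) : orthonormal_lift (dilate_metric t) q ->
  orthonormal_lift g (act q (z t)).
Proof.
move=> oq; have e0 : 0 < (expR (2 * t))^-1 :> R by rewrite invr_gt0 expR_gt0.
have ta : (theta (z t))^T *m theta (z t) = (((expR (2 * t))^-1)^-1)%:M.
  by rewrite invrK dilation_gram.
have := orthonormal_scale e0 ta oq.
have -> // : scale_metric (expR (2 * t))^-1 (dilate_metric t) = g.
apply/funext => i; apply/funext => x.
by rewrite /dilate_metric /scale_metric scalerA mulVf ?scale1r // gt_eqF // expR_gt0.
Qed.

(** [z] is known only to be continuous, but smoothness of a plot is tested on base coordinates,
    which do not move, and on frames, which are multiplied by the smooth function e^tau. *)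
Lemma smooth_plot_act m (W : set 'cV[R]_m) (tau : 'cV[R]_m -> R)
    (c : 'cV[R]_m -> P) : smooth W tau -> smooth_plot W c ->
  smooth_plot W (fun w => act (c w) (z (tau w))).
Proof.
move=> stau [oW cW sc]; split=> //.
  move=> w Ww; apply: (@continuous_comp _ _ _ (fun w => (c w, z (tau w)))
    (fun p : P * G => act p.1 p.2)); last exact: act_continuous.
  apply: continuous_pair; first exact: cW.
  apply: (@continuous_comp _ _ _ tau z); last exact: z_continuous.
  exact: (stau 0%N w Ww).
move=> i; have [sy sE] := sc i.
have WE : [set w | dom i (proj (act (c w) (z (tau w))))] =
    [set w | dom i (proj (c w))].
  by apply/seteqP; split=> w /=; rewrite proj_act.
rewrite WE; set W' := W `&` _ in sy sE *.
have oW' : open W'.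
  rewrite openE => w [Ww wi]; have nd := near_dom_proj wi.
  have n1 : \forall w' \near w, dom i (proj (c w')) by exact: (cW w Ww _ nd).
  have n2 : \forall w' \near w, W w' by exact: open_nbhs_nbhs.
  by apply: filterS2 n1 n2 => w' ? ?; split.
split.
  have -> // : coord i \o proj (s := P) \o (fun w => act (c w) (z (tau w))) =
    coord i \o proj (s := P) \o c.
  by apply/funext => w /=; rewrite proj_act.
move=> k; apply: (@Ck_ext _ _ _ _ _ (fun w => expR (tau w) *: frame i (c w))) => //.
  by move=> w [_ wi] /=; rewrite frame_act // theta_z mul_mx_scalar.
apply: (@Ck_scalemx _ _ _ _ _ _ (fun w => expR (tau w)) (frame i \o c)) => //.
by apply: Ck_expR => //; apply: Ck_subset (stau k); exact: subIsetl.
Qed.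

Lemma smooth_dilate m (W : set 'cV[R]_m) (tau : 'cV[R]_m -> R)
    (c : 'cV[R]_m -> P) : smooth W tau -> smooth_plot W c ->
  (forall w, W w -> orthonormal_lift (dilate_metric (tau w)) (c w)) ->
  smooth W (fun w => dilate_spinor (tau w) (c w)).
Proof.
move=> stau sc oc; have [_ [_ sp] _] := gpsi.
apply: (sp _ _ _ (smooth_plot_act stau sc)) => w Ww.
by apply: orthonormal_undilate; exact: oc.
Qed.

Lemma dilate_unit_pair t : unit_pair kappa rho Q (dilate_metric t) (dilate_spinor t).
Proof.
have [g_riem [psi_act _] psi_unit] := gpsi; split.
- by apply: scale_metric_riemannian => //; exact: expR_gt0.
- split.
    (* Centrality of [z] is what keeps the translated spinor Spin(n)-equivariant. *)
    move=> q a oq ta; rewrite /dilate_spinor -actM -z_central actM.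
    by rewrite psi_act //; exact: orthonormal_undilate.
  move=> m W c sc oc.
  apply: (@smooth_dilate _ W (fun=> t) c) => //.
  by move=> k; apply: Ck_cst; case: sc.
- by move=> q oq; apply: psi_unit; exact: orthonormal_undilate.
Qed.

Lemma dilate_metric_smooth i : smooth [set p : R * 'cV[R]_n | cod i p.2]
  (fun p => dilate_metric p.1 i (param i p.2)).
Proof.
have [g_riem _ _] := gpsi.
have c1 : continuous (fst : R * 'cV[R]_n -> R) by move=> p; exact: cvg_fst.
have c2 : continuous (snd : R * 'cV[R]_n -> 'cV[R]_n) by move=> p; exact: cvg_snd.
have oD : open [set p : R * 'cV[R]_n | cod i p.2].
  have -> : [set p : R * 'cV[R]_n | cod i p.2] = snd @^-1` cod i by [].
  by apply: open_comp => [p _|]; [exact: c2|exact: cod_open].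
move=> k; apply: (@Ck_scalemx _ _ _ _ _ _ (fun p : R * 'cV[R]_n => expR (2 * p.1))
  (fun p => g i (param i p.2))) => //.
  apply: Ck_expR => //; apply: CkM => //; first exact: Ck_cst.
  by apply: Ck_linear.
apply: (@Ck_precomp_linear _ _ _ _ _ (cod i) snd (g i \o param i)) => //.
exact: metric_Ck.
Qed.

Lemma dilate_smooth_curve : smooth_curve kappa rho Q dilate_metric dilate_spinor.
Proof.
split; [exact: dilate_unit_pair|exact: dilate_metric_smooth|].
by move=> m W tau c; exact: smooth_dilate.
Qed.

(** In the rescaled orthonormal frame the vector in slot 0 is shorter by e^(-t), whereas [psi] and
    the Clifford words have the same components as before. Each component of T_r is thus multiplied
    by e^(-t), whatever [r] is. *)
Lemma Tnorm2_dilate r t x :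
  Tnorm2 iota rho Q r (dilate_metric t) (dilate_spinor t) x =
  expR (- (2 * t)) * Tnorm2 iota rho Q r g psi x.
Proof.
have [g_riem psi_section _] := gpsi.
have [gt_riem psit_section _] := dilate_unit_pair t.
have [q <- oq] := orthonormal_exists theta_cover P g_riem x.
have oq' : orthonormal_lift (dilate_metric t) (act q (z t)^-1%g) by exact: orthonormal_dilate.
rewrite (Tnorm2E theta_cover kappa_spin Q_prod g_riem psi_section) //.
rewrite -(proj_act q (z t)^-1%g).
rewrite (Tnorm2E theta_cover kappa_spin Q_prod gt_riem psit_section) //.
rewrite /frame_norm2 mulr_sumr; apply: eq_bigr => e _.
have psiE q' : dilate_spinor t (act q' (z t)^-1%g) = 1%:M *m psi q'.
  by rewrite /dilate_spinor -actM mulVg act1 mul1mx.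
have nE X : nabla (dilate_metric t) (dilate_spinor t) (act q (z t)^-1%g) X =
    expR (- t) *: nabla g psi q X.
  rewrite (nabla_act theta_cover _ (expR_gt0 _) g_riem
    (smooth_spinor_section psi_section) (smooth_spinor_section psit_section)
    (dilation_gramV t) (fun r _ => psiE r) oq) mul1mx.
  rewrite (thetaV theta_cover) theta_z invmx_scalar mul_scalar_mx -expRN.
  have L := nabla_linear theta_cover g_riem (smooth_spinor_section psi_section) _ _ _ oq.
  rewrite -[_ *: X]addr0 L.
  have := L (-1) 0 0; rewrite scaler0 addr0 scaleN1r addNr => ->.
  by rewrite addr0.
rewrite /Ttensor nE psiE mul1mx.
have -> u v : inner Q (expR (- t) *: u) v = expR (- t) * inner Q u v.
  by rewrite /inner linearZ /= -!scalemxAl mxE.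
rewrite exprMn; congr (_ * _).
by rewrite -mulrN expR2.
Qed.

End ScalingCurve.

                         

(** * Positivity and scaling of the volume integral *)

Lemma continuous_mulr (R : realType) (T : topologicalType) (f h : T -> R) (x : T) :
  {for x, continuous f} -> {for x, continuous h} ->
  {for x, continuous (fun y => f y * h y)}.
Proof. by move=> cf ch; exact: cvgM. Qed.

Section Energy.
Context {R : realType} {n : nat} {M : topologicalType}.
Hypothesis M_compact : compact [set: M].
Context {A : oriented_atlas R n M}.
Variable chi : partition_of_unity A.
Implicit Types (g : bilinear_field A) (f : M -> R).

Definition integrand g f (k : 'I_(pu_size chi)) (y : 'cV[R]_n) : R :=
  let i := pu_chart k in let x := param i y in
  \1_(cod i) y * (pu_fun k x * f x * Num.sqrt (\det (g i x))).

(** The compact set is the chart image of the closed support of the partition function, which lies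
    inside the chart domain and is compact because [M] is. *)
Lemma integrand_support g f k : exists2 C : set 'cV[R]_n, compact C &
  C `<=` cod (pu_chart k) /\ forall y, ~ C y -> integrand g f k y = 0.
Proof.
set i := pu_chart k.
pose S := closure [set x | pu_fun k x != 0].
have Si : S `<=` dom i by exact: pu_support.
have cS : compact S.
  by apply: (subclosed_compact (@closed_closure _ _) M_compact) => x.
exists (coord i @` S).
  apply: continuous_compact cS; apply: continuous_in_subspaceT => x.
  by rewrite inE => Sx; apply: coord_continuous; exact: Si.
split; first by move=> _ [x Sx <-]; exact: dom_cod (Si _ Sx).
move=> y nC; rewrite /integrand indicE; case: (boolP (y \in _)); last by rewrite mul0r.
rewrite inE => yi; case: (eqVneq (pu_fun k (param i y)) 0) => [->|kx].
  by rewrite !mul0r mulr0.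
case: nC; exists (param i y); last exact: paramK.
by apply: subset_closure.
Qed.

(** Inside the chart image the indicator is locally 1. A point outside it lies in the open
    complement of the compact support, where the integrand is identically 0, so the cut-off creates
    no jump. *)
Lemma integrand_continuous g f k : riemannian_metric g -> continuous f ->
  continuous (integrand g f k).
Proof.
move=> g_riem fc y.
have [C cC [Ci C0]] := integrand_support g f k.
set i := pu_chart k in Ci *.
case: (pselect (cod i y)) => [yi|nyi]; last first.
  have oC : open (~` C).
    by apply: closed_openC; apply: compact_closed => //; exact: norm_hausdorff.
  apply: (@near_continuous _ _ (fun=> 0) (integrand g f k) y); last first.
    exact: (@cst_continuous 'cV[R]_n R 0 y).
  have nC : ~ C y by move/Ci.
  by apply: filterS (open_nbhs_nbhs (conj oC nC)) => u nCu; rewrite C0.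
apply: (@near_continuous _ _ (fun y => pu_fun k (param i y) * f (param i y) *
    Num.sqrt (\det ((g i \o param i) y)))).
  apply: filterS (near_cod yi) => u ui.
  by rewrite /integrand indicE mem_set // mul1r.
have pc : {for y, continuous (param i)} by exact: param_continuous.
apply: continuous_mulr; first apply: continuous_mulr.
- by apply: (@continuous_comp _ _ _ (param i) (pu_fun k)) => //; exact: pu_continuous.
- by apply: (@continuous_comp _ _ _ (param i) f) => //; exact: fc.
apply: (@continuous_comp _ _ _ (fun y => \det ((g i \o param i) y)) Num.sqrt);
  last exact: sqrt_continuous.
apply: continuous_det.
exact: Ck_continuous (metric_Ck g_riem i 0) yi.
Qed.

Lemma integrand_supp_box g f k : exists2 K, 0 <= K & supp_box K (integrand g f k).
Proof.
have [C cC [_ C0]] := integrand_support g f k.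
have [K [_ KC]] := compact_bounded cC.
exists (`|K| + 1) => [|y i Ky]; first by rewrite addr_ge0.
apply: C0 => Cy.
have := KC (`|K| + 1); rewrite (le_lt_trans (ler_norm K)) ?ltrDl // => /(_ erefl y Cy).
by move=> /(le_trans (norm_coord y i 0)); rewrite leNgt Ky.
Qed.

Lemma integrand_ge0 g f k y : (forall x, 0 <= f x) -> 0 <= integrand g f k y.
Proof.
move=> f0; apply: mulr_ge0; first by rewrite indicE.
by rewrite !mulr_ge0 ?sqrtr_ge0 ?pu_ge0.
Qed.

Lemma vol_integral_ge0 g f : riemannian_metric g -> continuous f ->
  (forall x, 0 <= f x) -> 0 <= vol_integral chi g f.
Proof.
move=> g_riem fc f0; apply: sumr_ge0 => k _.
have [K K0 sK] := integrand_supp_box g f k.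
have c := @integrand_continuous g f k g_riem fc.
by apply: (iint_ge0 (iint_specP n K0)) c sK _ => y; exact: integrand_ge0.
Qed.

(** All summands are nonnegative, so each is 0 and each continuous integrand vanishes pointwise; at
    a given [x] some partition function is nonzero and the density sqrt(det g) is positive. *)
Lemma vol_integral_eq0 g f : riemannian_metric g -> continuous f ->
  (forall x, 0 <= f x) -> vol_integral chi g f = 0 -> forall x, f x = 0.
Proof.
move=> g_riem fc f0 I0 x.
have [k kx] : exists k, pu_fun (p := chi) k x != 0.
  apply: contrapT => nk; have := pu_sum chi x; rewrite big1.
    by move/eqP; rewrite eq_sym oner_eq0.
  by move=> k _; apply/eqP; apply: contraPT nk => kx; apply; exists k.
have xi : dom (pu_chart k) x by apply: pu_support; exact: subset_closure.
have [K K0 sK] := integrand_supp_box g f k.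
have c := @integrand_continuous g f k g_riem fc.
have i0 y := @integrand_ge0 g f k y f0.
have Ik : iterated_integral (integrand g f k) = 0.
  apply: (psumr_eq0P (P := xpredT) (F := fun k => iterated_integral (integrand g f k))) => //.
  move=> l _; have [L L0 sL] := integrand_supp_box g f l.
  apply: (iint_ge0 (iint_specP n L0)) (@integrand_continuous g f l g_riem fc) sL _ => y.
  exact: integrand_ge0.
have := iint_eq0 (iint_specP n K0) c sK i0 Ik (coord (pu_chart k) x).
rewrite /integrand indicE mem_set ?coordK //; last exact: dom_cod.
rewrite mul1r => /eqP; rewrite !mulf_eq0 (negbTE kx) /= => /orP[/eqP //|].
by rewrite gt_eqF // sqrtr_gt0; apply: posdef_det_gt0; exact: metric_posdef.
Qed.

(** The determinant of a^2 g is a^(2n) det g, so the density is multiplied by a^n. *)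
Lemma vol_integralZ a b g f : 0 < a -> riemannian_metric g -> continuous f ->
  vol_integral chi (scale_metric (a ^+ 2) g) (fun x => b * f x) =
  b * a ^+ n * vol_integral chi g f.
Proof.
move=> a0 g_riem fc; rewrite /vol_integral mulr_sumr; apply: eq_bigr => k _.
have [K K0 sK] := integrand_supp_box g f k.
have c := @integrand_continuous g f k g_riem fc.
(* Homogeneity is read off from the affine form of [iint_lin] with zero second summand. *)
pose zf (y : 'cV[R]_n) : R := 0.
have zc : continuous zf by exact: (@cst_continuous 'cV[R]_n R 0).
have zs : supp_box K zf by [].
have lin := iint_lin (iint_specP n K0).
have z0 : iterated_integral zf = 0.
  have := lin (-1) zf zf zc zc zs zs.
  have -> : (fun y : 'cV[R]_n => -1 * zf y + zf y) = zf.
    by apply/funext => y; rewrite /zf mulr0 addr0.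
  by rewrite mulN1r addNr.
have := lin (b * a ^+ n) _ zf c zc sK zs; rewrite z0 addr0 => <-.
congr iterated_integral; apply/funext => y.
rewrite /integrand /scale_metric /zf addr0 detZ -exprM mulnC exprM.
rewrite sqrtrM ?sqr_ge0 // sqrtr_sqr ger0_norm ?exprn_ge0 ?ltW //; ring.
Qed.

End Energy.

                        

(** * From vanishing tensors to a parallel spinor *)

Section Critical.
Context {R : realType} {n : nat} {M : topologicalType}.
Context {A : oriented_atlas R n M} {G : topGroupType} {theta : G -> 'M[R]_n}.
Hypothesis theta_cover : universal_cover_GLplus theta.
Variable P : spin_structure A theta.
Variables (Cl : algType R) (iota : {linear 'cV[R]_n -> Cl}) (kappa : G -> Cl).
Hypothesis kappa_spin : spin_identification theta iota kappa.
Variables (N : nat) (rho : {lrmorphism Cl -> 'M[R]_N.+1}) (Q : 'M[R]_N.+1).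
Hypothesis Q_prod : spinor_product iota rho Q.
Variables (g : bilinear_field A) (psi : spinor_field P N).
Hypothesis gpsi : unit_pair kappa rho Q g psi.

Lemma continuous_inner (T : topologicalType) (u v : T -> 'cV[R]_N.+1) x :
  {for x, continuous u} -> {for x, continuous v} ->
  {for x, continuous (fun y => inner Q (u y) (v y))}.
Proof.
move=> cu cv.
have c : {for x, continuous (fun y => (u y)^T *m Q *m v y)}.
  apply: (@continuous_mulmx _ _ _ _ _ (fun y => (u y)^T *m Q) v); last exact: cv.
  apply: (@continuous_mulmx _ _ _ _ _ (fun y => (u y)^T) (fun=> Q)).
    by apply: continuous_trmx; exact: cu.
  exact: cvg_cst.
exact: ((continuous_mxP _ _).1 c).
Qed.

(** The frame matrix is kept fixed while the base point varies; the plot orthonormalises it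
    continuously. *)
Lemma orthonormal_section x0 : exists s : M -> P,
  [/\ {for x0, continuous s} & \forall x \near x0,
    proj (s x) = x /\ orthonormal_lift g (s x)].
Proof.
have [g_riem _ _] := gpsi.
have [q0 <- oq0] := orthonormal_exists theta_cover P g_riem x0.
have [i q0i] := dom_cover A (proj q0).
have [W [Phi [[oW cPhi _] Wq PhiF PhiK]]] := local_plot theta_cover g_riem q0i oq0.
pose e (x : M) := encode (coord i x) (frame i q0).
have ce : {for proj q0, continuous e}.
  apply: (@encode_continuous _ _ _ (coord i) (fun=> frame i q0)).
    exact: coord_continuous.
  exact: cvg_cst.
exists (Phi \o e); split.
  by apply: (@continuous_comp _ _ _ e Phi) => //; exact: cPhi.
have nW : \forall x \near proj q0, W (e x) by apply: (ce W); exact: open_nbhs_nbhs.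
apply: filterS2 nW (near_dom q0i) => x Wx xi.
have [_ ox px _] := PhiF _ Wx.
by rewrite /= px base_part_encode coordK.
Qed.

(** Along a continuous orthonormal section the norm is a finite sum of squares of the continuous
    representatives supplied by [nabla_local]. *)
Lemma Tnorm2_continuous r : continuous (Tnorm2 iota rho Q r g psi).
Proof.
move=> x0; have [g_riem psi_section _] := gpsi.
have [s [sc sP]] := orthonormal_section x0.
have [s0 o0] := nbhs_singleton sP.
have [psi' [D [psi'c Dc nD]]] :=
  nabla_local theta_cover g_riem (smooth_spinor_section psi_section) o0.
apply: (@near_continuous _ _ (fun x => \sum_(e : {ffun 'I_r.+1 -> 'I_n})
  (inner Q (D (delta_mx (e ord0) 0) (s x))
    (rho (\prod_(k < r) iota (delta_mx (e (lift ord0 k)) 0)) *m psi' (s x))) ^+ 2)).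
  have nDs := sc _ nD; apply: filterS2 sP nDs => x [sx ox] /(_ ox)[px nx].
  rewrite -[in RHS]sx (Tnorm2E theta_cover kappa_spin Q_prod g_riem psi_section) //.
  by apply: eq_bigr => e _; rewrite /Ttensor px nx.
apply: cvg_sum => e.
have c : {for x0, continuous (fun x => inner Q (D (delta_mx (e ord0) 0) (s x))
    (rho (\prod_(k < r) iota (delta_mx (e (lift ord0 k)) 0)) *m psi' (s x)))}.
  apply: continuous_inner.
    by apply: (@continuous_comp _ _ _ s (D (delta_mx (e ord0) 0))) => //; exact: Dc.
  apply: (@continuous_mulmx _ _ _ _ _
    (fun=> rho (\prod_(k < r) iota (delta_mx (e (lift ord0 k)) 0))) (psi' \o s)).
    exact: cvg_cst.
  exact: (@continuous_comp _ _ _ s psi').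
by apply: cvg_trans (continuous_mulr c c) => //.
Qed.

Lemma Tnorm2_ge0 r x : 0 <= Tnorm2 iota rho Q r g psi x.
Proof.
have [g_riem psi_section _] := gpsi.
have [q <- oq] := orthonormal_exists theta_cover P g_riem x.
rewrite (Tnorm2E theta_cover kappa_spin Q_prod g_riem psi_section) //.
by apply: sumr_ge0 => e _; exact: sqr_ge0.
Qed.

Lemma Tnorm2_eq0 r q : orthonormal_lift g q ->
  Tnorm2 iota rho Q r g psi (proj q) = 0 ->
  forall j (s : seq 'I_n), size s = r ->
    inner Q (nabla g psi q (delta_mx j 0)) (rho (basis_word iota s) *m psi q) = 0.
Proof.
move=> oq + j s sr; have [g_riem psi_section _] := gpsi.
rewrite (Tnorm2E theta_cover kappa_spin Q_prod g_riem psi_section) // => T0.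
(* The multi-index (j, s); its list has r + 1 entries, so the default of [nth] is never reached. *)
pose e : {ffun 'I_r.+1 -> 'I_n} := [ffun k : 'I_r.+1 => nth j (j :: s) k].
have /eqP := @psumr_eq0P _ _ xpredT
  (fun e : {ffun 'I_r.+1 -> 'I_n} => (Ttensor iota rho Q g psi q
    (fun k => delta_mx (e k) 0)) ^+ 2) (fun e _ => sqr_ge0 _) T0 e erefl.
rewrite sqrf_eq0 => /eqP; rewrite /Ttensor ffunE /= => <-.
congr (inner _ _ (rho _ *m _)).
rewrite /basis_word (big_nth j) sr big_mkord; apply: eq_bigr => k _.
by rewrite ffunE.
Qed.

(** Orthogonality to the words of length n and n-1 applied to [psi] extends to all of Cl psi by
    [clifford_vanish]. This orbit is the whole module, so the derivative is orthogonal to itself. *)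
Lemma nabla_eq0 q : is_clifford_algebra iota -> irreducible_module rho -> (0 < n)%N ->
  orthonormal_lift g q ->
  (forall j (s : seq 'I_n), size s = n \/ size s = n.-1 ->
    inner Q (nabla g psi q (delta_mx j 0)) (rho (basis_word iota s) *m psi q) = 0) ->
  forall X, nabla g psi q X = 0.
Proof.
move=> Cl_clifford rho_irr n0 oq H X; have [g_riem psi_section psi_unit] := gpsi.
have L := nabla_linear theta_cover g_riem (smooth_spinor_section psi_section) _ _ _ oq.
have nabla0 : nabla g psi q 0 = 0.
  by have := L (-1) 0 0; rewrite scaler0 addr0 scaleN1r addNr.
have vanish j a : inner Q (nabla g psi q (delta_mx j 0)) (rho a *m psi q) = 0.
  pose l (a : Cl) : R^o := inner Q (nabla g psi q (delta_mx j 0)) (rho a *m psi q).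
  have l_lin : linear l.
    by move=> c x y; rewrite /l linearP mulmxDl -scalemxAl inner_scaleDr.
  pose lL : {linear Cl -> R^o} := HB.pack l (GRing.isLinear.Build _ _ _ _ l l_lin).
  by apply: (clifford_vanish Cl_clifford (l := lL) n0) => s; exact: H.
have psi_q := psi_unit q oq.
(* A submodule containing [psi q], which is nonzero because it has norm 1; irreducibility makes it
   everything. *)
pose W := [set v : 'cV[R]_N.+1 | exists a, v = rho a *m psi q].
have WT : W = setT.
  have [||||W0|//] := rho_irr W.
  - by exists 0; rewrite rmorph0 mul0mx.
  - by move=> _ _ [a ->] [b ->]; exists (a + b); rewrite rmorphD mulmxDl.
  - by move=> t _ [a ->]; exists (t *: a); rewrite linearZ /= -scalemxAl.
  - by move=> a _ [b ->]; exists (a * b); rewrite rmorphM mulmxA.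
  have : W (psi q) by exists 1; rewrite rmorph1 mul1mx.
  rewrite W0 /= => p0; move: psi_q; rewrite p0 /inner mulmx0 mxE.
  by move/eqP; rewrite eq_sym oner_eq0.
have dX j : nabla g psi q (delta_mx j 0) = 0.
  have [_ Q_pos _ _] := Q_prod; apply: contrapT => /eqP /Q_pos.
  have [a E] : W (nabla g psi q (delta_mx j 0)) by rewrite WT.
  by rewrite [X in inner Q _ X]E vanish ltxx.
rewrite [X]matrix_sum_delta; elim/big_rec: _ => [//|i Y _ YE].
by rewrite big_ord1 L dX scaler0 add0r.
Qed.

End Critical.

(** * Conclusion: criticality along the homothety curve *)

Lemma criticality_constant (R : realType) (a E : R) : a != 0 ->
  is_derive (0 : R) (1 : R) (fun t : R => expR (a * t) * E) 0 -> E = 0.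
Proof.
move=> a0 [_ d0].
have da : is_derive (0 : R) (1 : R) (fun t : R => a * t) a.
  have := is_derive_affine (0 : R) a.
  by congr is_derive; apply/funext => t; rewrite add0r [RHS]mulrC.
have de := is_derive1_comp (is_derive_expR (a * 0)) da.
have dE := is_deriveM de (is_derive_cst E (0 : R) (1 : R)).
move: d0; have [_ ->] := dE; rewrite mulr0 expR0 /cst !scaler0 add0r.
by move=> /eqP; rewrite scaler_eq0 /= mul1r (negbTE a0) orbF => /eqP.
Qed.

Theorem proposition0p2 (R : realType) (n : nat) (n_ge3 : (3 <= n)%N)
    (M : topologicalType) (M_hausdorff : hausdorff_space M)
    (M_compact : compact [set: M]) (M_connected : connected [set: M])
    (A : oriented_atlas R n M)
    (G : topGroupType) (theta : G -> 'M[R]_n)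
    (theta_cover : universal_cover_GLplus theta)
    (P : spin_structure A theta)
    (Cl : algType R) (iota : {linear 'cV[R]_n -> Cl})
    (Cl_clifford : is_clifford_algebra iota)
    (kappa : G -> Cl) (kappa_spin : spin_identification theta iota kappa)
    (N : nat) (rho : {lrmorphism Cl -> 'M[R]_N.+1})
    (rho_irr : irreducible_module rho)
    (Q : 'M[R]_N.+1) (Q_prod : spinor_product iota rho Q)
    (chi : partition_of_unity A)
    (g : bilinear_field A) (psi : spinor_field P N) :
  unit_pair kappa rho Q g psi ->
  critical_point kappa rho Q
    (fun g' psi' => energy iota rho Q chi n g' psi' +
                    energy iota rho Q chi n.-1 g' psi') g psi ->
  forall q : P, orthonormal_lift g q -> forall X : 'cV[R]_n, nabla g psi q X = 0.
Proof.
move=> gpsi crit q oq; have [g_riem _ _] := gpsi.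
have [z [z0 zc tz cz]] := dilation_lift theta_cover.
have curve := dilate_smooth_curve gpsi zc tz cz.
have [g0 psi0] := dilate0 g psi z0.
have Tc r := Tnorm2_continuous theta_cover kappa_spin Q_prod gpsi (r := r).
have T0 r := Tnorm2_ge0 theta_cover kappa_spin Q_prod gpsi r.
(* The factor e^(-2t) of the squared norm combines with e^(nt) of the volume. The exponent does not
   depend on [r], so the sum of the two energies scales in the same way. *)
have scaling r t : energy iota rho Q chi r (dilate_metric g t) (dilate_spinor psi z t) =
    expR ((n%:R - 2) * t) * energy iota rho Q chi r g psi.
  have TE : Tnorm2 iota rho Q r (dilate_metric g t) (dilate_spinor psi z t) =
      fun x => expR (- (2 * t)) * Tnorm2 iota rho Q r g psi x.
    apply/funext => x.
    exact: (Tnorm2_dilate theta_cover kappa_spin Q_prod gpsi zc tz cz).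
  rewrite /energy TE /dilate_metric expR2 -expr2.
  rewrite (vol_integralZ M_compact chi _ (expR_gt0 t) g_riem (@Tc r)).
  rewrite -expRM_natl -expRD mulrCA; congr (expR _ * _).
  by rewrite mulrBl addrC.
have E0 : energy iota rho Q chi n g psi + energy iota rho Q chi n.-1 g psi = 0.
  (* The exponent n - 2 is nonzero since n is at least 3. *)
  apply: (@criticality_constant R (n%:R - 2)).
    by rewrite subr_eq0 (eqr_nat R n 2) gtn_eqF.
  have := crit _ _ curve g0 psi0.
  by under eq_fun do rewrite !scaling -mulrDr.
have E_ge0 r : 0 <= energy iota rho Q chi r g psi.
  apply: mulr_ge0; first by rewrite invr_ge0.
  exact: (vol_integral_ge0 M_compact chi g_riem (@Tc r) (T0 r)).
have T_eq0 r : energy iota rho Q chi r g psi = 0 ->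
    forall x, Tnorm2 iota rho Q r g psi x = 0.
  move=> /eqP; rewrite mulf_eq0 invr_eq0 pnatr_eq0 /= => /eqP.
  exact: (vol_integral_eq0 M_compact g_riem (@Tc r) (T0 r)).
have /andP[/eqP En /eqP En1] : (energy iota rho Q chi n g psi == 0) &&
    (energy iota rho Q chi n.-1 g psi == 0) by rewrite -paddr_eq0 // E0.
have n0 : (0 < n)%N by exact: leq_trans n_ge3.
apply: (nabla_eq0 theta_cover Q_prod gpsi Cl_clifford rho_irr n0 oq) => j s [] sn.
  exact: (Tnorm2_eq0 theta_cover kappa_spin Q_prod gpsi oq (T_eq0 _ En _)).
exact: (Tnorm2_eq0 theta_cover kappa_spin Q_prod gpsi oq (T_eq0 _ En1 _)).
Qed.
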